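(* Let $K\in\mathbb{R}$, $N\in[1,\infty)$, let $(X,d,\mathfrak{m})$ be an $RCD^*(K,N)$ space and let $k\in[1,N]\cap\mathbb{N}$. If $g\in\mathrm{Iso}(X)$ and $p\in\mathcal{R}_k$, then $gp\in\mathcal{R}_k$.
   Context: A metric measure space (m.m.s.) $(X,d,\mathfrak{m})$ is a complete, separable, geodesic metric space $(X,d)$ with a Radon measure $\mathfrak{m}$ on its Borel $\sigma$-algebra, with $\mathrm{supp}\,\mathfrak{m}=X$. $\mathbb{P}_2(X)$ is the space of Borel probability measures with finite second moment, with the $L^2$-Wasserstein distance $\mathbb{W}_2$. For $\mu\in\mathbb{P}_2(X)$ put $\mathrm{Ent}_{\mathfrak{m}}(\mu)=\int\rho\log\rho\,d\mathfrak{m}$ if $\mu=\rho\mathfrak{m}$ and $(\rho\log\rho)_+$ is $\mathfrak{m}$-integrable, and $+\infty$ otherwise; $D(\mathrm{Ent}_{\mathfrak{m}})=\{\mathrm{Ent}_{\mathfrak{m}}<\infty\}$ and $\mathcal{U}_N(\mu)=\exp(-\frac1N\mathrm{Ent}_{\mathfrak{m}}(\mu))$. For $t\in[0,1]$, $\theta\geq 0$: $\sigma^{(t)}_{K/N}(\theta)=\infty$ if $K\theta^2\geq N\pi^2$; $=\frac{\sin(t\theta\sqrt{K/N})}{\sin(\theta\sqrt{K/N})}$ if $0<K\theta^2<N\pi^2$; $=t$ if $K\theta^2=0$; $=\frac{\sinh(t\theta\sqrt{-K/N})}{\sinh(\theta\sqrt{-K/N})}$ if $K\theta^2<0$. $CD^e(K,N)$: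 for all $\mu_0,\mu_1\in D(\mathrm{Ent}_{\mathfrak{m}})$ there is a $\mathbb{W}_2$-geodesic $(\mu_t)_{t\in[0,1]}$ in $D(\mathrm{Ent}_{\mathfrak{m}})$ joining them with $\mathcal{U}_N(\mu_t)\geq\sigma^{(1-t)}_{K/N}(\mathbb{W}_2(\mu_0,\mu_1))\,\mathcal{U}_N(\mu_0)+\sigma^{(t)}_{K/N}(\mathbb{W}_2(\mu_0,\mu_1))\,\mathcal{U}_N(\mu_1)$ for all $t\in[0,1]$. Cheeger energy of $f\in L^2(\mathfrak{m})$: $\mathrm{Ch}_{\mathfrak{m}}(f)=\inf\{\liminf_n\frac12\int|\mathrm{Lip} f_n|^2d\mathfrak{m}\}$ over sequences of real-valued Lipschitz $f_n\to f$ in $L^2(\mathfrak{m})$, where $\mathrm{Lip} f(x)=\limsup_{y\to x}|f(x)-f(y)|/d(x,y)$ ($0$ at isolated points). $W^{1,2}(\mathfrak{m})=\{\mathrm{Ch}_{\mathfrak{m}}<\infty\}$ with norm $(\|f\|_{L^2(\mathfrak{m})}^2+2\mathrm{Ch}_{\mathfrak{m}}(f))^{1/2}$. The space is infinitesimally Hilbertian if $W^{1,2}(\mathfrak{m})$ is a Hilbert space. $(X,d,\mathfrak{m})$ is an $RCD^*(K,N)$ space if it satisfies $CD^e(K,N)$ and is infinitesimally Hilbertian (equivalent to the usual definition, by Erbar–Kuwada–Sturm). $\mathrm{Iso}(X)$ is the group of isometries of $(X,d)$ (they are not assumed to preserve $\mathfrak{m}$). Regular points: for $p\in X$, $\mathrm{Tan}(X,p)$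 is the set of all pointed measured Gromov–Hausdorff limits of sequences $(X,\lambda_nd,\mathfrak{m}_{\lambda_n},p)$ with $\lambda_n\to\infty$, where $\mathfrak{m}_\lambda=\left(\int_{B_p(\lambda^{-1})}1-\lambda d(p,\cdot)\,d\mathfrak{m}\right)^{-1}\mathfrak{m}$. For $k\in[1,N]\cap\mathbb{N}$, $\mathcal{R}_k$ is the set of $k$-regular points, i.e. points $x$ with $\mathrm{Tan}(X,x)=\{(\mathbb{R}^k,d_E,\mathcal{L}^k,0)\}$, where $d_E$ is the Euclidean distance and $\mathcal{L}^k$ is Lebesgue measure (rescaled so that $\int_{B_0(1)}(1-|x|)\,d\mathcal{L}^k=1$). *)

(* Defs.v *)
From HB Require Import structures.
From mathcomp Require Import all_boot all_order all_algebra.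
From mathcomp Require Import all_classical all_reals all_analysis.
From mathcomp Require Import ring lra.

Set Implicit Arguments.
Unset Strict Implicit.
Unset Printing Implicit Defensive.

Import Order.TTheory GRing.Theory Num.Theory.
Import numFieldNormedType.Exports.

Local Open Scope classical_set_scope.
Local Open Scope ring_scope.

(* Complete metric spaces. The structure comes with a canonical point only
   because measurable types in the library are pointed; it plays no role. *)
#[short(type="completeMetricType")]
HB.structure Definition CompleteMetric (R : numDomainType) :=
  {T of CompletePseudoMetric R T & Metric R T}.

Definition borel (T : ptopologicalType) := g_sigma_algebraType (@open T).

(* The metric space (X, l d). The uniform structure, hence the topology and
   the Borel sets, are definitionally those of X, so that a measure on
   [borel X] is also a measure on [borel (rescale l X)]. *)
Definition rescale (R : realType) (l : {posnum R})
  (X : completeMetricType R) : Type := X.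

Section rescaling.
Context {R : realType} (l : {posnum R}) (X : completeMetricType R).
Local Notation rescale := (rescale l X).

HB.instance Definition _ := Complete.copy rescale X.

Let sdist (x y : rescale) : R := l%:num * mdist (x : X) (y : X).
Let sball (x : rescale) (e : R) : set rescale := [set y | sdist x y < e].

Let sball_center x (e : R) : 0 < e -> sball x e x.
Proof. by move=> e0; rewrite /sball/= /sdist mdistxx mulr0. Qed.

Let sball_sym x y (e : R) : sball x e y -> sball y e x.
Proof. by rewrite /sball/= /sdist metric_sym. Qed.

Let sball_triangle x y z e1 e2 :
  sball x e1 y -> sball y e2 z -> sball x (e1 + e2) z.
Proof.
rewrite /sball/= /sdist => xy yz; apply: le_lt_trans (ltrD xy yz).
by rewrite -mulrDr ler_pM2l// metric_triangle.
Qed.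

Let sentourageE : entourage = entourage_ sball.
Proof.
rewrite -(@entourage_ballE R X); apply/seteqP; split => A [e/= e0 eA].
  exists (l%:num * e); first by rewrite /= mulr_gt0.
  move=> xy /=; rewrite /sball/= /sdist ltr_pM2l// => xye.
  by apply: eA => /=; rewrite ballEmdist.
exists (l%:num^-1 * e); first by rewrite /= mulr_gt0.
move=> xy /=; rewrite ballEmdist/= => xye.
by apply: eA; rewrite /= /sball/= /sdist -ltr_pdivlMl.
Qed.

HB.instance Definition _ := @Uniform_isPseudoMetric.Build R rescale
  sball sball_center sball_sym sball_triangle sentourageE.

Let sdist_ge0 x y : 0 <= sdist x y.
Proof. by rewrite mulr_ge0// mdist_ge0. Qed.

Let sdist_positivity x y : sdist x y = 0 -> x = y.
Proof.
by move=> /eqP; rewrite mulf_eq0 gt_eqF//= => /eqP/mdist_positivity.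
Qed.

Let sballE x e : ball x e = [set y | sdist x y < e]. Proof. by []. Qed.

HB.instance Definition _ := @PseudoMetric_isMetric.Build R rescale
  sdist sdist_ge0 sdist_positivity sballE.

End rescaling.

Definition euclid (R : realType) (k : nat) : Type := 'rV[R]_k.

Section euclidean.
Context {R : realType} (k : nat).
Local Notation E := (euclid R k).

HB.instance Definition _ := Complete.copy E 'rV[R]_k.

Definition edist (x y : E) : R := Num.sqrt (\sum_(i < k) (x ord0 i - y ord0 i) ^+ 2).
Let eball (x : E) (e : R) : set E := [set y | edist x y < e].

Let edistxx x : edist x x = 0.
Proof. by rewrite /edist big1 ?sqrtr0// => i _; rewrite subrr expr0n. Qed.

Let edist_ge0 x y : 0 <= edist x y.
Proof. exact: sqrtr_ge0. Qed.

Let sqr_edist x y : edist x y ^+ 2 = \sum_(i < k) (x ord0 i - y ord0 i) ^+ 2.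
Proof. by rewrite sqr_sqrtr// sumr_ge0// => i _; exact: sqr_ge0. Qed.

Let edist_sym x y : edist x y = edist y x.
Proof.
by congr Num.sqrt; apply: eq_bigr => i _; rewrite -sqrrN opprB.
Qed.

Let edist_ge (x y : E) i : `|x ord0 i - y ord0 i| <= edist x y.
Proof.
rewrite -sqrtr_sqr ler_wsqrtr// (bigD1 i)//= lerDl sumr_ge0// => j _.
exact: sqr_ge0.
Qed.

Let edist_positivity (x y : E) : edist x y = 0 -> x = y.
Proof.
move=> xy0; apply/rowP => i; apply/eqP; rewrite -subr_eq0 -normr_le0.
by rewrite (le_trans (edist_ge x y i)) ?xy0.
Qed.

Let cauchy_schwarz (a b : 'I_k -> R) :
  (\sum_i a i * b i) ^+ 2 <= (\sum_i a i ^+ 2) * (\sum_i b i ^+ 2).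
Proof.
set A := \sum_i a i ^+ 2; set B := \sum_i b i ^+ 2; set C := \sum_i a i * b i.
have A0 : 0 <= A by apply: sumr_ge0 => i _; exact: sqr_ge0.
have H (s t : R) : 0 <= s ^+ 2 * A + 2 * s * t * C + t ^+ 2 * B.
  have -> : s ^+ 2 * A + 2 * s * t * C + t ^+ 2 * B =
      \sum_i (s * a i + t * b i) ^+ 2.
    rewrite /A /B /C !mulr_sumr -!big_split/=; apply: eq_bigr => i _; ring.
  by apply: sumr_ge0 => i _; exact: sqr_ge0.
have [A00|An0] := eqVneq A 0.
  have a0 i : a i = 0.
    apply/eqP; rewrite -sqrf_eq0; move/eqP : A00.
    by rewrite psumr_eq0 => [/allP/(_ i)/[!mem_index_enum]/(_ isT)//|j _];
      exact: sqr_ge0.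
  by rewrite /C big1 ?expr0n ?mulr_ge0// ?sumr_ge0// => i _;
    rewrite ?a0 ?mul0r ?sqr_ge0.
have Ap : 0 < A by rewrite lt0r An0.
have := H (- C) A.
have -> : (- C) ^+ 2 * A + 2 * (- C) * A * C + A ^+ 2 * B =
    A * (A * B - C ^+ 2) by ring.
by rewrite pmulr_rge0// subr_ge0.
Qed.

Let edist_triangle y x z : edist x z <= edist x y + edist y z.
Proof.
rewrite -ler_sqr ?nnegrE ?addr_ge0// sqrrD !sqr_edist.
set a := fun i => x ord0 i - y ord0 i; set b := fun i => y ord0 i - z ord0 i.
have -> : \sum_(i < k) (x ord0 i - z ord0 i) ^+ 2 =
    \sum_i a i ^+ 2 + (\sum_i a i * b i) *+ 2 + \sum_i b i ^+ 2.
  rewrite -mulr_natl mulr_sumr -!big_split/=; apply: eq_bigr => i _.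
  rewrite /a /b; ring.
rewrite lerD2r lerD2l ler_pMn2r//.
rewrite (le_trans (ler_norm _))// -ler_sqr ?nnegrE ?mulr_ge0//.
by rewrite exprMn !sqr_edist real_normK ?num_real// cauchy_schwarz.
Qed.

Let eball_center x (e : R) : 0 < e -> eball x e x.
Proof. by move=> e0; rewrite /eball/= edistxx. Qed.

Let eball_sym x y (e : R) : eball x e y -> eball y e x.
Proof. by rewrite /eball/= edist_sym. Qed.

Let eball_triangle x y z e1 e2 :
  eball x e1 y -> eball y e2 z -> eball x (e1 + e2) z.
Proof.
rewrite /eball/= => xy yz; apply: le_lt_trans (ltrD xy yz).
exact: edist_triangle.
Qed.

Let edist_lt (x y : E) (e : R) : 0 < e ->
  (forall i, `|x ord0 i - y ord0 i| < e / k.+1%:R) -> edist x y < e.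
Proof.
move=> e0 xye; rewrite -ltr_sqr ?nnegrE// ?ltW// sqr_edist.
apply: (@le_lt_trans _ _ (\sum_(i < k) (e / k.+1%:R) ^+ 2)).
  apply: ler_sum => i _; rewrite -real_normK ?num_real// ler_sqr ?nnegrE//.
  - exact/ltW.
  - by rewrite divr_ge0// ltW.
rewrite sumr_const card_ord -[X in X < _]mulr_natr expr_div_n -mulrA.
rewrite gtr_pMr ?exprn_gt0// mulrC ltr_pdivrMr ?exprn_gt0// mul1r -natrX.
by rewrite ltr_nat expnS expn1 (leq_trans (ltnSn k))// leq_pmulr.
Qed.

Let eentourageE : entourage = entourage_ eball.
Proof.
rewrite -(@entourage_ballE R 'rV[R]_k); apply/seteqP; split => A [e/= e0 eA].
  exists e => // xy /=; rewrite /eball/= => xye; apply: eA; split => // i j.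
  by rewrite (ord1 i); exact: le_lt_trans (edist_ge _ _ _) xye.
exists (e / k.+1%:R) => /=; first by rewrite divr_gt0.
move=> xy [_ xye]; apply: eA => /=; rewrite /eball/=; apply: edist_lt => // i.
exact: xye.
Qed.

HB.instance Definition _ := @Uniform_isPseudoMetric.Build R E
  eball eball_center eball_sym eball_triangle eentourageE.

Let eballE x e : ball x e = [set y | edist x y < e]. Proof. by []. Qed.

HB.instance Definition _ := @PseudoMetric_isMetric.Build R E
  edist edist_ge0 edist_positivity eballE.

End euclidean.

Section image_measure.
Context d1 d2 (T1 : measurableType d1) (T2 : measurableType d2) {R : realType}.
Variables (m : {measure set T1 -> \bar R}) (f : T1 -> T2).

Definition image_measure (mf : measurable_fun [set: T1] f) : set T2 -> \bar R :=
  pushforward m f.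

Variable mf : measurable_fun [set: T1] f.

Let image_measure0 : image_measure mf set0 = 0%E.
Proof. exact: measure0. Qed.

Let image_measure_ge0 A : (0 <= image_measure mf A)%E.
Proof. exact: measure_ge0. Qed.

Let image_measure_sigma_additive : semi_sigma_additive (image_measure mf).
Proof. exact: measure_semi_sigma_additive. Qed.

HB.instance Definition _ := isMeasure.Build _ _ _ (image_measure mf)
  image_measure0 image_measure_ge0 image_measure_sigma_additive.

End image_measure.

Section lebesgue.
Context {R : realType}.

Definition vec_of_tuple k (t : k.-tuple (measurableTypeR R)) :
  borel (euclid R k) := \row_i tnth t i.

Lemma measurable_vec_of_tuple k : measurable_fun [set: _] (@vec_of_tuple k).
Proof.
refine (@measurability _ _ _ _ setT (@vec_of_tuple k) (@open (euclid R k)) erefl _).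
move=> _ [U oU <-]; rewrite setTI.
pose box (q : 'rV[rat]_k * rat) : set (euclid R k) :=
  [set x | forall i, `|x ord0 i - ratr (q.1 ord0 i)| < ratr q.2].
pose F q : set (k.-tuple (measurableTypeR R)) :=
  if `[< box q `<=` U >] then @vec_of_tuple k @^-1` box q else set0.
rewrite (_ : _ @^-1` U = \bigcup_q F q).
  apply: countable_bigcupT_measurable => // q; rewrite /F; case: ifPn => // _.
  rewrite (_ : _ @^-1` _ = \bigcap_(i in [set: 'I_k]) (fun t =>
      tnth t i) @^-1` (ball (ratr (q.1 ord0 i) : R) (ratr q.2))).
    apply: fin_bigcap_measurable => // i _.
    rewrite -[X in measurable X]setTI; apply: measurable_tnth => //.
    by rewrite ball_itv; exact: measurable_itv.
  by apply/seteqP; split => t /= + i => /(_ i); rewrite /ball/= !mxE distrC//;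
    apply.
apply/seteqP; split => [t Ut|t [q _]]; last first.
  by rewrite /F; case: ifPn => // /asboolP qU; exact: qU.
move: oU; rewrite openE => /(_ _ Ut); rewrite /interior.
move=> /(@nbhs_ballP R 'rV[R]_k) [e/= e0 eU].
have [d d0 de] : exists2 d : rat, 0 < d & ratr d < e / 2 :> R.
  have : 0 < e / 2 by rewrite divr_gt0.
  by move=> /rat_in_itvoo[d]; rewrite in_itv/= => /andP[]; rewrite ltr0q; exists d.
have hq i : exists q : rat, `|tnth t i - ratr q| < ratr d :> R.
  have : tnth t i - ratr d < tnth t i + ratr d :> R.
    by rewrite ltrD2l gtrN// ltr0q.
  move=> /rat_in_itvoo[q]; rewrite in_itv/= => /andP[q1 q2]; exists q.
  by rewrite distrC ltr_distl q1.
have [q hqt] := choice hq.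
exists (\row_i q i, d) => //; rewrite /F ifT.
  by move=> i; rewrite /vec_of_tuple !mxE.
apply/asboolP => x /= xq; apply: eU; split => // a i; rewrite (ord1 a).
have := xq i; have := hqt i; rewrite /ball/= !mxE => tq xqi.
have -> : tnth t i - x ord0 i =
    (tnth t i - ratr (q i)) + (ratr (q i) - x ord0 i) :> R by ring.
apply: (le_lt_trans (ler_normD _ _)); rewrite [X in _ + X]distrC.
have {}tq := lt_trans tq de; have {}xqi := lt_trans xqi de.
by have := ltrD tq xqi; rewrite -splitr.
Qed.

Lemma measurable_snoc k : measurable_fun [set: _]
  (fun u : k.-tuple (measurableTypeR R) * measurableTypeR R =>
    [the k.+1.-tuple _ of u.2 :: u.1]).
Proof. exact: measurable_cons. Qed.

(* Lebesgue measure on k-tuples, as an iterated product. *)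
Fixpoint lebesgue_tuple k :
    {measure set (k.-tuple (measurableTypeR R)) -> \bar R} :=
  if k is k'.+1 then
    image_measure (lebesgue_tuple k' \x (@lebesgue_measure R))%E
      (@measurable_snoc k')
  else \d_[tuple].

Definition lebesgue_euclid k : {measure set (borel (euclid R k)) -> \bar R} :=
  image_measure (lebesgue_tuple k) (@measurable_vec_of_tuple k).

End lebesgue.

Section metric_measure_space.
Context {R : realType}.

Definition separable_space (X : topologicalType) : Prop :=
  exists2 D : set X, countable D & dense D.

(* Constant speed minimizing geodesic on [0, 1]; only the values of gamma on
   [0, 1] matter. *)
Definition is_geodesic (T : Type) (dist : T -> T -> R) (gamma : R -> T) :=
  forall s t : R, 0 <= s <= 1 -> 0 <= t <= 1 ->
    dist (gamma s) (gamma t) = `|s - t| * dist (gamma 0) (gamma 1).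

Definition geodesic_space (X : metricType R) : Prop :=
  forall x y : X, exists gamma : R -> X,
    [/\ is_geodesic mdist gamma, gamma 0 = x & gamma 1 = y].

Definition radon (X : ptopologicalType)
    (m : {measure set (borel X) -> \bar R}) : Prop :=
  (forall x : X, exists2 U : set X, open_nbhs x U & (m U < +oo)%E) /\
  (forall B : set (borel X), measurable B ->
    m B = ereal_sup [set m C | C in [set C : set X | compact C /\ C `<=` B]]).

Definition support (X : ptopologicalType)
    (m : {measure set (borel X) -> \bar R}) : set X :=
  [set x | forall U : set X, open_nbhs x U -> (0 < m U)%E].

Definition is_mms (X : completeMetricType R)
    (m : {measure set (borel X) -> \bar R}) : Prop :=
  [/\ separable_space X, geodesic_space X, radon m & support m = setT].

Definition isometric (X Y : metricType R) (f : X -> Y) : Prop :=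
  forall x y, mdist (f x) (f y) = mdist x y.

Definition is_isometry (X : metricType R) (g : X -> X) : Prop :=
  isometric g /\ bijective g.

End metric_measure_space.

Section wasserstein.
Context {R : realType} {X : completeMetricType R}.
Implicit Types mu nu : probability (borel X) R.
Local Open Scope ereal_scope.

Definition finite_second_moment mu : Prop :=
  exists x0 : X, \int[mu]_x ((mdist x0 (x : X) ^+ 2)%R)%:E < +oo.

Definition coupling mu nu : set (probability (borel X * borel X)%type R) :=
  [set q | forall A : set (borel X), measurable A ->
    q (A `*` setT) = mu A /\ q (setT `*` A) = nu A].

(* The infimum is finite when mu and nu have finite second moments. *)
Definition W2 mu nu : R := Num.sqrt (fine (ereal_inf
  [set \int[q]_u ((mdist (u.1 : X) (u.2 : X) ^+ 2)%R)%:E | q in coupling mu nu])).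

End wasserstein.

Section curvature_dimension.
Context {R : realType} {X : completeMetricType R}.
Variable m : {measure set (borel X) -> \bar R}.
Implicit Types mu : probability (borel X) R.
Local Open Scope ereal_scope.

Definition is_density mu (rho : borel X -> R) : Prop :=
  [/\ measurable_fun setT rho, forall x, (0 <= rho x)%R &
      forall A, measurable A -> mu A = \int[m]_(x in A) (rho x)%:E].

(* With [ln 0 = 0] in the library, [rho * ln rho] vanishes where rho does. *)
Definition rho_log_rho (rho : borel X -> R) (x : borel X) : \bar R :=
  (rho x * ln (rho x))%:E.

(* The set has at most one element, since densities are unique m-almost
   everywhere; if it is empty its infimum is +oo. *)
Definition entropy mu : \bar R :=
  ereal_inf [set \int[m]_x rho_log_rho rho x | rho in
    [set rho | is_density mu rho /\
               m.-integrable setT (rho_log_rho rho)^\+]].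

Definition entropy_domain mu : Prop :=
  finite_second_moment mu /\ entropy mu < +oo.

(* Extended-real valued, because the entropy may be -oo. *)
Definition U_N (N : R) mu : \bar R := expeR (- ((N^-1)%:E * entropy mu)).

Definition sinh (x : R) : R := ((expR x - expR (- x)) / 2)%R.

Definition sigma (K N t theta : R) : \bar R :=
  if (N * pi ^+ 2 <= K * theta ^+ 2)%R then +oo
  else if (0 < K * theta ^+ 2)%R then
    (sin (t * theta * Num.sqrt (K / N)) / sin (theta * Num.sqrt (K / N)))%:E
  else if (K * theta ^+ 2 == 0)%R then t%:E
  else (sinh (t * theta * Num.sqrt (- K / N)) /
        sinh (theta * Num.sqrt (- K / N)))%:E.

Definition CDe (K N : R) : Prop :=
  forall mu0 mu1, entropy_domain mu0 -> entropy_domain mu1 ->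
  exists mu_ : R -> probability (borel X) R,
    [/\ mu_ 0%R = mu0, mu_ 1%R = mu1, is_geodesic W2 mu_ &
      forall t : R, (0 <= t <= 1)%R ->
        entropy_domain (mu_ t) /\
        sigma K N (1 - t) (W2 mu0 mu1) * U_N N mu0 +
          sigma K N t (W2 mu0 mu1) * U_N N mu1 <= U_N N (mu_ t)].

End curvature_dimension.

Section cheeger.
Context {R : realType} {X : completeMetricType R}.
Variable m : {measure set (borel X) -> \bar R}.
Implicit Types f g h : borel X -> R.
Local Open Scope ereal_scope.

Definition lipschitz_fun f : Prop :=
  exists L : R, forall x y : X, (`|f x - f y| <= L * mdist x y)%R.

(* The maximum with 0 only matters at isolated points, where the punctured
   neighborhood filter is degenerate and its upper limit is -oo. *)
Definition slope f (x : X) : \bar R :=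
  maxe 0 (limf_esup (fun y : X => (`|f x - f y| / mdist x y)%:E) x^').

Definition Cheeger f : \bar R :=
  ereal_inf [set limn_einf (fun n => 2^-1%:E * \int[m]_x (slope (f_ n) x) ^+ 2)
    | f_ in [set f_ : nat -> borel X -> R |
        (forall n, lipschitz_fun (f_ n) /\ f_ n \in Lfun m 2%:E) /\
        (fun n => 'N[m]_2%:E[EFin \o (f_ n \- f)%R]) @ \oo --> 0]].

Definition W12 f : Prop := f \in Lfun m 2%:E /\ Cheeger f < +oo.

Definition W12norm f : R :=
  Num.sqrt (fine ('N[m]_2%:E[EFin \o f] ^+ 2 + 2%:E * Cheeger f)).

(* W12 (modulo m-a.e. equality) is a Hilbert space: its norm comes from an
   inner product and is complete. The form B is defined on functions; it
   descends to m-a.e. classes, and is definite there, because its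
   quadratic form W12norm ^+ 2 dominates the squared L2 norm. *)
Definition infinitesimally_hilbertian : Prop :=
  (exists B : (borel X -> R) -> (borel X -> R) -> R,
    [/\ forall f g, W12 f -> W12 g -> B f g = B g f,
        forall (a : R) f g h, W12 f -> W12 g -> W12 h ->
          B (fun x => a * f x + g x)%R h = (a * B f h + B g h)%R &
        forall f, W12 f -> B f f = (W12norm f ^+ 2)%R]) /\
  (forall f_ : nat -> borel X -> R, (forall n, W12 (f_ n)) ->
    (forall e : R, (0 < e)%R -> exists n0, forall i j,
      (n0 <= i)%N -> (n0 <= j)%N -> (W12norm (f_ i \- f_ j)%R < e)%R) ->
    exists2 f, W12 f & (fun n => W12norm (f_ n \- f)%R) @ \oo --> 0%R).

Definition RCDstar (K N : R) : Prop :=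
  CDe m K N /\ infinitesimally_hilbertian.

End cheeger.

(* Pointed metric measure spaces; [is_mms] is imposed separately. *)
Record pmms (R : realType) := Pmms {
  pmms_space :> completeMetricType R ;
  pmms_measure : {measure set (borel pmms_space) -> \bar R} ;
  pmms_point : pmms_space }.

Section convergence.
Context {R : realType}.

Definition pmms_isomorphic (Y Z : pmms R) : Prop :=
  exists T : Y -> Z, [/\ isometric T, bijective T,
    T (pmms_point Y) = pmms_point Z &
    forall A : set (borel Z), measurable A ->
      pushforward (pmms_measure Y) (T : borel Y -> borel Z) A =
      pmms_measure Z A].

Definition neighborhood (Z : metricType R) (e : R) (A : set Z) : set Z :=
  [set z | exists2 a, A a & mdist a z < e].

(* Pointed measured Gromov-Hausdorff convergence: isometric embeddings in a
   common space Z in which balls converge in the Hausdorff sense and the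
   measures converge weakly against continuous functions with bounded
   support. *)
Definition pmGH_cvg (Xs : nat -> pmms R) (Y : pmms R) : Prop :=
  exists (Z : completeMetricType R) (i_ : forall n, Xs n -> Z) (i : Y -> Z),
  [/\ separable_space Z,
      (forall n, isometric (i_ n)) /\ isometric i,
      forall e r : R, 0 < e -> 0 < r -> \forall n \near \oo,
        i @` ball (pmms_point Y) r `<=`
          neighborhood e (i_ n @` ball (pmms_point (Xs n)) (r + e)) /\
        i_ n @` ball (pmms_point (Xs n)) r `<=`
          neighborhood e (i @` ball (pmms_point Y) (r + e)) &
      forall phi : Z -> R, continuous phi ->
        (exists M : R, forall z, `|phi z| <= M) ->
        (exists (z0 : Z) (r : R), forall z, phi z != 0 -> mdist z0 z <= r) ->
        (\int[pushforward (pmms_measure (Xs n))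
               (i_ n : borel (Xs n) -> borel Z)]_z (phi z)%:E)%E
          @[n --> \oo] -->
        (\int[pushforward (pmms_measure Y)
               (i : borel Y -> borel Z)]_z (phi z)%:E)%E].

End convergence.

Section tangents.
Context {R : realType}.

Section normalization.
Context {X : completeMetricType R}.
Variables (m : {measure set (borel X) -> \bar R}) (p : X) (l : {posnum R}).

Definition normalization_factor : R :=
  (\int[m]_(x in ball p (l%:num^-1)) (1 - l%:num * mdist p (x : X)))^-1.

Lemma normalization_factor_ge0 : 0 <= normalization_factor.
Proof.
rewrite invr_ge0 Rintegral_ge0// => x; rewrite ballEmdist/= => xp.
by rewrite subr_ge0 mulrC -ler_pdivlMr// mul1r ltW.
Qed.

Definition normalized_measure : {measure set (borel X) -> \bar R} :=
  mscale (NngNum normalization_factor_ge0) m.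

Definition rescaled_pmms : pmms R :=
  @Pmms R (rescale l X) normalized_measure p.

End normalization.

Definition Tan {X : completeMetricType R}
    (m : {measure set (borel X) -> \bar R}) (p : X) (Y : pmms R) : Prop :=
  is_mms (pmms_measure Y) /\
  exists l : nat -> {posnum R}, (l n)%:num @[n --> \oo] --> +oo /\
    pmGH_cvg (fun n => rescaled_pmms m p (l n)) Y.

Definition euclid_pmms (k : nat) : pmms R :=
  @Pmms R (euclid R k)
    (normalized_measure (lebesgue_euclid k) (0 : 'rV[R]_k) 1%:pos) (0 : 'rV[R]_k).

(* Tan is invariant under isomorphism, and equality with the singleton is
   meant up to isomorphism. *)
Definition regular_points {X : completeMetricType R}
    (m : {measure set (borel X) -> \bar R}) (k : nat) : set X :=
  [set p | Tan m p (euclid_pmms k) /\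
    forall Y, Tan m p Y -> pmms_isomorphic Y (euclid_pmms k)].

End tangents.

(* Main.v *)
(* An isometry g carries the blow-ups (X, l d) at p to those at g p as metric
   spaces, but not their measures. Hence the tangents at p and at g p have the
   same underlying metric spaces (extracting convergent subsequences of
   measures), and the point is that the limit measure on R^k does not depend
   on the base point.

   Applying CD^e to conditioned measures on a set A and near a point y, with
   Jensen's inequality for the entropy, gives
     m (A_t) >= ((1 - e) (1 - t)) ^ N m A
   for the set A_t of near t-intermediate points from A to y, when A is close
   to y. Balls of small radius are therefore doubling, and along any
   Gromov-Hausdorff convergent sequence of blow-ups the measures have weak
   limit points mu. In the limit the inequality holds on R^k without any
   restriction on the diameter: mu ((1 - t) C + v) >= (1 - t) ^ N mu C with
   v = t y, where y is arbitrary. Letting t go to 0 with v fixed gives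
   mu (C + v) >= mu C, so that mu is translation invariant, and the
   normalization of the blow-ups determines it. *)
Require Import Defs.
From HB Require Import structures.
From mathcomp Require Import all_boot all_order all_algebra.
From mathcomp Require Import all_classical all_reals all_analysis.
From mathcomp Require Import measurable_realfun.
From mathcomp Require Import ring lra.

Import Order.TTheory GRing.Theory Num.Theory.
Import numFieldNormedType.Exports.

Local Open Scope classical_set_scope.
Local Open Scope ring_scope.

Set Implicit Arguments.
Unset Strict Implicit.
Unset Printing Implicit Defensive.

(** Three difficulties shape the proof. [CDe] speaks of geodesics between measures, not of geodesics
    of X. The passage to points glues almost optimal couplings over a fine partition, so optimal
    plans, disintegration and selections of geodesics are all avoided. The price is a slack [d] in
    the intermediate sets, chosen of order 1/l in the blow-ups and absorbed by the parallelogram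
    identity of R^k. Next, the space Z carrying the embeddings need not be locally compact, so weak
    limits are built on the limit space itself: its closed balls are compact by doubling, and a
    content on its compact sets is read off from limits of masses of countably many open sets of Z.
    Finally, Lebesgue measure is never analysed: at a regular point p it is itself a blow-up limit,
    and uniqueness among blow-up limits on R^k identifies any other one with it. For an arbitrary
    tangent Y at g p, regularity of p is applied to Y with a different measure, which yields an
    isometry onto R^k; only then is the original measure of Y carried over and compared. *)

Section borel_sets.
Context {R : realType}.

(** * Borel sets of separable metric spaces *)

Lemma open_borel (T : ptopologicalType) (A : set T) :
  open A -> measurable (A : set (borel T)).
Proof. by move=> oA; apply: sub_sigma_algebra. Qed.

Lemma closed_borel (T : ptopologicalType) (A : set T) :
  closed A -> measurable (A : set (borel T)).
Proof.
by move=> /closed_openC/open_borel/(@measurableC _ (borel T)); rewrite setCK.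
Qed.

Lemma compact_borel (T : completeMetricType R) (A : set T) :
  compact A -> measurable (A : set (borel T)).
Proof.
by move=> cA; apply: closed_borel; apply: compact_closed => //; exact: metric_hausdorff.
Qed.

Lemma continuous_borel (T U : ptopologicalType) (f : T -> U) :
  continuous f -> measurable_fun [set: borel T] (f : borel T -> borel U).
Proof.
move=> /continuousP cf.
refine (@measurability _ _ (borel T) (borel U) setT f (@open U) erefl _).
by move=> _ [V oV <-]; rewrite setTI; apply: open_borel; exact: cf.
Qed.

Lemma continuous_borel_real (T : ptopologicalType) (f : T -> R) :
  continuous f -> measurable_fun [set: borel T] (f : borel T -> R).
Proof.
move=> /continuousP cf; apply: (measurability _ (measurable_realfun.RGenOpens.measurableE R)).
move=> _ [_ [a [b ->] <-]]; rewrite setTI; apply: open_borel.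
exact/cf/interval_open.
Qed.

Lemma mball_open (T : metricType R) (x : T) (e : R) : open (ball x e).
Proof.
rewrite openE => y; rewrite ballEmdist/= => xy.
apply/(@nbhs_ballP R T); exists (e - mdist x y) => /=; first by rewrite subr_gt0.
move=> z; rewrite !ballEmdist/= => yz.
by apply: le_lt_trans (metric_triangle x y z) _; rewrite -ltrBrDl.
Qed.

Lemma open_sub_ball (T : metricType R) (U : set T) (x : T) : open U -> U x ->
  exists2 r : R, 0 < r & ball x r `<=` U.
Proof.
by rewrite openE => oU /oU; rewrite /interior => /(@nbhs_ballP R T)[r]; exists r.
Qed.

Lemma ball_borel (T : completeMetricType R) (x : T) (e : R) :
  measurable (ball x e : set (borel T)).
Proof. by apply: open_borel; exact: mball_open. Qed.

Lemma mdist_lip (T : metricType R) (x y y' : T) :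
  `|mdist x y - mdist x y'| <= mdist y y'.
Proof.
rewrite ler_norml; apply/andP; split.
  by rewrite lerNl opprB lerBlDl; exact: metric_triangle.
by rewrite lerBlDl (metric_sym y); exact: metric_triangle.
Qed.

Lemma lip_continuous (T : metricType R) (f : T -> R) :
  (forall x y, `|f x - f y| <= mdist x y) -> continuous f.
Proof.
move=> lf x; apply/cvgrPdist_lt => e e0.
apply/(@metricType_numDomainType.nbhs_mdistP R T); exists e => // y/= xy.
exact: le_lt_trans (lf x y) xy.
Qed.

Lemma mdist_continuous (T : metricType R) (x : T) : continuous (mdist x).
Proof. by apply: lip_continuous => y z; exact: mdist_lip. Qed.

Lemma dense_sequence (X : completeMetricType R) : separable_space X ->
  exists e : nat -> X, forall (x : X) (r : R),
  0 < r -> exists n, mdist (e n) x < r.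
Proof.
move=> [D cD dD].
have [g gD] : exists g : nat -> X, set_surj setT D g.
  exact/(@pcard_surjP X)/cD.
exists g => x r r0.
have [||y [xy /gD[n _ gn]]] := dD (ball x r).
- by exists x; exact: ballxx.
- exact: mball_open.
- by exists n; rewrite gn metric_sym; move: xy; rewrite ballEmdist.
Qed.

Lemma inv_nat_lt (r : R) : 0 < r -> exists n : nat, n.+1%:R^-1 < r.
Proof.
move=> r0; exists (Num.trunc r^-1).
by rewrite invf_plt ?posrE//; exact: truncnS_gt.
Qed.

(** Separability puts open sets of the product into the product of the Borel algebras: [U] is the
    union of the countably many rectangles of balls, centred on dense sequences, that it contains.
    Joint measurability of the distance, hence of transport costs, rests on this. *)
Lemma open_prod_borel (X Y : completeMetricType R) (U : set (X * Y)) :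
  separable_space X -> separable_space Y ->
  (forall u, U u -> exists2 r : R, 0 < r &
    forall v, mdist u.1 v.1 < r -> mdist u.2 v.2 < r -> U v) ->
  measurable (U : set (borel X * borel Y)%type).
Proof.
move=> /dense_sequence[e he] /dense_sequence[f hf] oU.
pose B (k : nat * nat * nat) : set (borel X * borel Y)%type :=
  ball (e k.1.1) k.2.+1%:R^-1 `*` ball (f k.1.2) k.2.+1%:R^-1.
pose F k := if `[< B k `<=` U >] then B k else set0.
rewrite (_ : U = \bigcup_k F k).
  apply: countable_bigcupT_measurable => // k; rewrite /F.
  case: ifPn => // _; apply: measurableX; exact: ball_borel.
apply/seteqP; split => [u Uu|u [k _]]; last first.
  by rewrite /F; case: ifPn => // /asboolP kU; exact: kU.
have [r r0 rU] := oU u Uu.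
have [n nr] : exists n : nat, n.+1%:R^-1 < r / 2.
  by apply: inv_nat_lt; rewrite divr_gt0.
have n0 : 0 < n.+1%:R^-1 :> R by rewrite invr_gt0.
have [a ha] := he u.1 _ n0; have [b hb] := hf u.2 _ n0.
exists (a, b, n) => //; rewrite /F ifT.
  by split; rewrite ballEmdist.
apply/asboolP => v []; rewrite !ballEmdist/= => va vb; apply: rU.
  apply: le_lt_trans (metric_triangle _ (e a) _) _.
  by rewrite (splitr r) (metric_sym u.1) ltrD//; apply: lt_trans nr.
apply: le_lt_trans (metric_triangle _ (f b) _) _.
by rewrite (splitr r) (metric_sym u.2) ltrD//; apply: lt_trans nr.
Qed.

Lemma measurable_mdist (X : completeMetricType R) : separable_space X ->
  measurable_fun [set: (borel X * borel X)%type]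
    (fun u => mdist (u.1 : X) (u.2 : X) : R).
Proof.
move=> sX; apply: (measurability _ (measurable_realfun.RGenOpens.measurableE R)).
move=> _ [_ [a [b ->] <-]]; rewrite setTI; apply: open_prod_borel => // u Uu.
have := @interval_open R (BRight a) (BLeft b) isT isT.
rewrite openE => /(_ _ Uu); rewrite /interior => /nbhs_ballP[r/= r0 rU].
exists (r / 2); first by rewrite divr_gt0.
move=> v h1 h2; apply: rU; rewrite /ball/=.
have -> : mdist u.1 u.2 - mdist v.1 v.2 = (mdist u.1 u.2 - mdist u.1 v.2) +
   (mdist v.2 u.1 - mdist v.2 v.1).
  by rewrite (metric_sym v.2 u.1) (metric_sym v.2 v.1); ring.
apply: le_lt_trans (ler_normD _ _) _.
by have := mdist_lip u.1 u.2 v.2; have := mdist_lip v.2 u.1 v.1; lra.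
Qed.

End borel_sets.

(** * Gluing of couplings *)

Section unit_mass_measure.
Context d (T : measurableType d) {R : realType}.
Variables (mu : {measure set T -> \bar R}) (mu1 : mu setT = 1%E).

(** The proof of total mass one is an argument so that the probability structure can be attached to
    the resulting term; [sigma_finite_pack] follows the same pattern. *)
Definition unit_mass & mu setT = 1%E : set T -> \bar R := mu.

HB.instance Definition _ := Measure.copy (unit_mass mu1) mu.

HB.instance Definition _ :=
  Measure_isProbability.Build _ _ _ (unit_mass mu1) mu1.

End unit_mass_measure.

Section sigma_finite_measure.
Context d (T : measurableType d) {R : realType}.
Variables (mu : {measure set T -> \bar R}) (mus : sigma_finite setT mu).

Definition sigma_finite_pack & sigma_finite setT mu : set T -> \bar R := mu.

HB.instance Definition _ := Measure.copy (sigma_finite_pack mus) mu.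

HB.instance Definition _ :=
  Measure_isSigmaFinite.Build _ _ _ (sigma_finite_pack mus) mus.

End sigma_finite_measure.

Section gluing.
Context d d1 d2 (T : measurableType d) (T1 : measurableType d1)
  (T2 : measurableType d2) {R : realType}.
Local Open Scope ereal_scope.

Lemma measure_probability d0 (T0 : measurableType d0)
    (mu : {measure set T0 -> \bar R}) : mu setT = 1 ->
  exists P : probability T0 R, forall A, P A = mu A.
Proof. by move=> mu1; exists (unit_mass mu1). Qed.

(* The glued measure makes the two coordinates in T conditionally independent
   inside each cell C i; it avoids disintegration, at the price of
   identifying these coordinates only up to the partition C. *)
Lemma approximate_gluing (P : probability (T1 * T)%type R)
    (Q : probability (T * T2)%type R) (C : (set T)^nat) :
  (forall i, measurable (C i)) -> trivIset setT C -> \bigcup_i C i = setT ->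
  (forall A, measurable A -> P (setT `*` A) = Q (A `*` setT)) ->
  exists Pi : probability ((T1 * T) * (T * T2))%type R,
  [/\ forall E, measurable E -> Pi (E `*` setT) = P E,
      forall E, measurable E -> Pi (setT `*` E) = Q E &
      Pi (\bigcup_i ((setT `*` C i) `*` (C i `*` setT))) = 1].
Proof.
move=> mC tC UC PQ.
pose D i : set ((T1 * T) * (T * T2)) := (setT `*` C i) `*` (C i `*` setT).
have mD i : measurable (D i).
  by apply: measurableX; exact: measurableX.
pose w i : R := fine (P (setT `*` C i)).
have w_ge0 i : (0 <= (w i)^-1)%R by rewrite invr_ge0 fine_ge0.
(* By the equality of marginals the product measure has mass [w i] squared on the cell; dividing by
   [w i] restores both marginals there. *)
pose m i : {measure set ((T1 * T) * (T * T2)) -> \bar R} :=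
  mscale (NngNum (w_ge0 i)) (mrestr (P \x Q) (mD i)).
pose mu : {measure set ((T1 * T) * (T * T2)) -> \bar R} := mseries m 0.
have wE i : (w i)%:E = P (setT `*` C i).
  by rewrite /= fineK// fin_num_measure//; exact: measurableX.
have mE A B i : measurable A -> measurable B ->
    m i (A `*` B) = ((w i)^-1)%:E *
       (P (A `&` (setT `*` C i)) * Q (B `&` (C i `*` setT))).
  move=> mA mB; rewrite -[LHS]/(((w i)^-1)%:E * (P \x Q) ((A `*` B) `&` D i)).
  rewrite /D -setXI product_measure1E//.
    by apply: measurableI => //; exact: measurableX.
  by apply: measurableI => //; exact: measurableX.
have tD1 : trivIset setT (fun i => (setT `*` C i : set (T1 * T))).
  apply/trivIsetP => i j _ _ ij; rewrite -setXI.
  by move/trivIsetP : tC => /(_ i j I I ij) ->; rewrite setX0.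
have tD2 : trivIset setT (fun i => (C i `*` setT : set (T * T2))).
  apply/trivIsetP => i j _ _ ij; rewrite -setXI.
  by move/trivIsetP : tC => /(_ i j I I ij) ->; rewrite set0X.
have muP E : measurable E -> mu (E `*` setT) = P E.
  move=> mE0; rewrite /mu/= /mseries.
  transitivity (\sum_(i <oo) P (E `&` (setT `*` C i))).
    apply: eq_eseriesr => i _; rewrite mE// setTI -PQ// -wE.
    (* A cell of mass zero gets the weight [0^-1 = 0], which is correct because [P] then gives no
       mass to any part of it. *)
    have [w0|w0] := eqVneq (w i) 0%R.
      rewrite w0 invr0 mul0e; apply/esym/eqP; rewrite eq_le measure_ge0 andbT.
      have <- : P (setT `*` C i) = 0 by rewrite -wE w0.
      apply: le_measure; rewrite ?inE//.
      - by apply: measurableI => //; exact: measurableX.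
      - exact: measurableX.
    by rewrite muleCA -EFinM mulVf// mule1.
  rewrite -[in RHS](setIT E) -setXTT -UC setX_bigcupr setI_bigcupr.
  apply/esym/measure_semi_bigcup.
  - by move=> i; apply: measurableI => //; exact: measurableX.
  - exact: trivIset_setIl.
  - apply: bigcupT_measurable => i.
    by apply: measurableI => //; exact: measurableX.
have muQ E : measurable E -> mu (setT `*` E) = Q E.
  move=> mE0; rewrite /mu/= /mseries.
  transitivity (\sum_(i <oo) Q (E `&` (C i `*` setT))).
    apply: eq_eseriesr => i _; rewrite mE// setTI -wE.
    have [w0|w0] := eqVneq (w i) 0%R.
      rewrite w0 invr0 mul0e; apply/esym/eqP; rewrite eq_le measure_ge0 andbT.
      have <- : Q (C i `*` setT) = 0 by rewrite -PQ// -wE w0.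
      apply: le_measure; rewrite ?inE//.
      - by apply: measurableI => //; exact: measurableX.
      - exact: measurableX.
    by rewrite muleA -EFinM mulVf// mul1e.
  rewrite -[in RHS](setIT E) -setXTT -UC setX_bigcupl setI_bigcupr.
  apply/esym/measure_semi_bigcup.
  - by move=> i; apply: measurableI => //; exact: measurableX.
  - exact: trivIset_setIl.
  - apply: bigcupT_measurable => i.
    by apply: measurableI => //; exact: measurableX.
have muT : mu setT = 1 by rewrite -setXTT muP// probability_setT.
have [Pi PiE] := measure_probability muT.
exists Pi; split => [E mE0|E mE0|]; rewrite PiE ?muP ?muQ//.
rewrite -muT /mu/= /mseries; apply: eq_eseriesr => i _.
rewrite /m/= /mscale/= /mrestr setTI (_ : _ `&` D i = D i)//.
by apply/seteqP; split => [x []//|x Dx]; split => //; exists i.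
Qed.

Lemma eq_ge0_integral d0 (T0 : measurableType d0) d3 (T3 : measurableType d3)
    (mu : {measure set T0 -> \bar R}) (nu : {measure set T3 -> \bar R})
    (h : T0 -> T3) (f : T3 -> \bar R) : measurable_fun setT h ->
  (forall E, measurable E -> mu (h @^-1` E) = nu E) ->
  measurable_fun setT f -> (forall x, 0 <= f x) ->
  \int[mu]_x f (h x) = \int[nu]_x f x.
Proof.
move=> mh muE mf f0.
rewrite -[LHS]/(\int[mu]_(x in h @^-1` setT) (f \o h) x).
rewrite -(@ge0_integral_pushforward _ _ _ _ _ _ mh mu setT)//.
by apply: eq_measure_integral => E mE _; exact: muE.
Qed.

End gluing.

(** * Distortion coefficients at small distances *)

Section distortion.
Context {R : realType}.

Lemma tangent_id_at0 (f : R -> R) (e : R) : is_derive (0 : R) 1 f 1 -> f 0 = 0 ->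
  0 < e -> exists2 d : R, 0 < d & forall h : R, 0 <= h < d ->
    (1 - e) * h <= f h <= (1 + e) * h.
Proof.
move=> [df dfE] f0 e0.
have : (fun h => h^-1 *: ((f \o shift 0) (h *: (1 : R)) - f 0)) @ 0^' -->
    'D_1 f 0 by exact: df.
rewrite dfE => /cvgrPdist_lt/(_ e e0)[/= d d0 H]; exists d => // h /andP[h0 hd].
have [->|hn0] := eqVneq h 0; first by rewrite f0 !mulr0 lexx.
have hp : 0 < h by rewrite lt0r hn0.
have := H h; rewrite /ball/= sub0r normrN gtr0_norm// => /(_ hd hn0).
rewrite f0 subr0 addr0 /GRing.scale/= mulr1 ltr_norml => /andP[A B].
have fE : f h = h * (h^-1 * f h) by rewrite mulrA mulfV// mul1r.
by rewrite fE; apply/andP; split; rewrite [_ * h]mulrC ler_pM2l//; lra.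
Qed.

Lemma ratio_ge (f : R -> R) (e d : R) : 0 < e < 1 ->
  (forall h : R, 0 <= h < d -> (1 - e / 2) * h <= f h <= (1 + e / 2) * h) ->
  forall t x : R, 0 <= t <= 1 -> 0 < x < d -> (1 - e) * t <= f (t * x) / f x.
Proof.
move=> /andP[e0 e1] fd t x /andP[t0 t1] /andP[x0 xd].
have /fd/andP[fx1 fx2] : 0 <= x < d by rewrite (ltW x0).
have tx : 0 <= t * x < d.
  by rewrite mulr_ge0 ?(ltW x0)//= (le_lt_trans _ xd)// ler_piMl// ltW.
have /andP[ft1 ft2] := fd _ tx.
have fx0 : 0 < f x by apply: lt_le_trans fx1; rewrite mulr_gt0//; lra.
(* What remains is (1 - e) (1 + e / 2) <= 1 - e / 2. *)
rewrite ler_pdivlMr//; apply: le_trans ft1.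
apply: (@le_trans _ _ ((1 - e) * t * ((1 + e / 2) * x))).
  by rewrite ler_wpM2l// mulr_ge0//; lra.
have -> : (1 - e) * t * ((1 + e / 2) * x) = ((1 - e) * (1 + e / 2)) * (t * x) by ring.
rewrite ler_wpM2r//; first by case/andP : tx.
by nra.
Qed.

Lemma is_derive_sinh0 : is_derive (0 : R) 1 (@sinh R) 1.
Proof.
rewrite (_ : @sinh R = fun x => 2^-1 * (expR x - expR (- x))); last first.
  by apply/funext => x; rewrite /sinh mulrC.
apply: is_derive_eq.
by rewrite /GRing.scale/= oppr0 expR0; lra.
Qed.

(** Both trigonometric branches are quotients f (t x) / f x with f tangent to the identity at 0, so
    they are close to [t] uniformly in [t]. The curvature [K] influences only the size of [d], which
    is why it leaves no trace in the blow-ups. *)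
Lemma sigma_ge (K N e : R) : 0 < N -> 0 < e < 1 ->
  exists2 d : R, 0 < d & forall t theta : R, 0 <= t <= 1 -> 0 <= theta <= d ->
    (((1 - e) * t)%:E <= sigma K N t theta)%E.
Proof.
move=> N0 /[dup] e01 /andP[e0 e1]; have e20 : 0 < e / 2 by lra.
have dsin : is_derive (0 : R) 1 (@sin R) 1.
  by rewrite -[X in is_derive _ _ _ X](cos0 R); exact: is_derive_sin.
have [d1 d10 sinE] := tangent_id_at0 dsin (sin0 R) e20.
have sinh0 : sinh (0 : R) = 0 by rewrite /sinh oppr0 subrr mul0r.
have [d2 d20 sinhE] := tangent_id_at0 is_derive_sinh0 sinh0 e20.
(* [r] dominates both frequencies, of which at least one is 0 because [Num.sqrt] vanishes on
   negative numbers; the summand 1 keeps it positive when [K = 0]. *)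
pose r := Num.sqrt (K / N) + Num.sqrt (- K / N) + 1.
have r0 : 0 < r by rewrite ltr_pwDr// addr_ge0// sqrtr_ge0.
have [d d0 [dd1 dd2]] : exists2 d : R, 0 < d & d < d1 / r /\ d < d2 / r.
  exists (Num.min (d1 / r) (d2 / r) / 2).
    by rewrite divr_gt0// lt_min !divr_gt0.
  have : 0 < Num.min (d1 / r) (d2 / r) by rewrite lt_min !divr_gt0.
  have : Num.min (d1 / r) (d2 / r) <= d1 / r by rewrite ge_min lexx.
  have : Num.min (d1 / r) (d2 / r) <= d2 / r by rewrite ge_min lexx orbT.
  by split; lra.
exists d => // t theta t01 /andP[th0 thd]; rewrite /sigma.
case: ifPn => _; first exact: leey.
have small (b s : R) : 0 <= s -> s <= r -> d < b / r -> theta * s < b.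
  move=> s0 sr db; apply: le_lt_trans (_ : d * r < b).
    exact: ler_pM.
  by rewrite -ltr_pdivlMr.
case: ifPn => [Kt|Kt].
  have th : theta != 0 by apply: contraTneq Kt => ->; rewrite expr0n mulr0 ltxx.
  have K0 : 0 < K by move: Kt; rewrite pmulr_lgt0// exprn_even_gt0.
  have s0 : 0 < Num.sqrt (K / N) by rewrite sqrtr_gt0 divr_gt0.
  rewrite lee_fin -mulrA; apply: (ratio_ge e01 sinE) => //.
  apply/andP; split; first by rewrite mulr_gt0// lt0r th.
apply: small => //.
  by rewrite /r -addrA lerDl addr_ge0// sqrtr_ge0.
case: ifPn => [_|Kt0].
  by rewrite lee_fin; case/andP : t01 => t0 _; rewrite ler_piMl//; lra.
have th : theta != 0 by apply: contraNneq Kt0 => ->; rewrite expr0n mulr0.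
have K0 : K < 0.
  have : K * theta ^+ 2 < 0 by rewrite lt_neqAle Kt0/= leNgt.
  by rewrite pmulr_llt0// exprn_even_gt0.
have s0 : 0 < Num.sqrt (- K / N) by rewrite sqrtr_gt0 divr_gt0// oppr_gt0.
rewrite lee_fin -mulrA; apply: (ratio_ge e01 sinhE) => //.
apply/andP; split; first by rewrite mulr_gt0// lt0r th.
apply: small => //.
by rewrite /r addrAC lerDr addr_ge0// sqrtr_ge0.
Qed.

End distortion.

(** * Entropy of uniform measures and Jensen's inequality *)

Section entropy_bounds.
Context {R : realType} {X : completeMetricType R}.
Variable m : {measure set (borel X) -> \bar R}.
Implicit Types (mu : probability (borel X) R) (A S : set (borel X)).
Local Open Scope ereal_scope.

Lemma uniform_probability A : measurable A -> 0 < m A < +oo ->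
  exists mu, forall B, measurable B ->
    mu B = ((fine (m A))^-1)%:E * m (B `&` A).
Proof.
move=> mA /andP[mA0 mAy].
have v0 : (0 <= (fine (m A))^-1)%R by rewrite invr_ge0 fine_ge0// ltW.
pose nu : {measure set (borel X) -> \bar R} :=
  mscale (NngNum v0) (mrestr m mA).
have nu1 : nu setT = 1.
  rewrite -[LHS]/(((fine (m A))^-1)%:E * m (setT `&` A)) setTI.
  rewrite -[X in _ * X]fineK ?ge0_fin_numE// 1?ltW// -EFinM mulVf//.
  by rewrite gt_eqF// fine_gt0// mA0.
by have [mu muE] := measure_probability nu1; exists mu => B mB; rewrite muE.
Qed.

(** [entropy] is an infimum over densities, so the constant density on [A] is enough for an upper
    bound. *)
Lemma uniform_entropy_le mu A : measurable A -> 0 < m A < +oo ->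
  (forall B, measurable B -> mu B = ((fine (m A))^-1)%:E * m (B `&` A)) ->
  entropy m mu <= (- ln (fine (m A)))%:E.
Proof.
move=> mA /andP[mA0 mAy] muE.
have mAf : m A \is a fin_num by rewrite ge0_fin_numE// ltW.
set v := fine (m A); have v0 : (0 < v)%R by rewrite fine_gt0// mA0.
pose rho (x : borel X) : R := (v^-1 * \1_A x)%R.
have iA : m.-integrable setT (fun x : borel X => (\1_A x)%:E).
  apply/integrableP; split; first exact/measurable_EFinP.
  under eq_integral do rewrite gee0_abs ?lee_fin//.
  by rewrite integral_indic// setIT.
have rhoE : rho_log_rho rho = fun x => (v^-1 * ln v^-1)%:E * (\1_A x)%:E.
  apply/funext => x; rewrite /rho_log_rho /rho indicE -EFinM.
  by case: (x \in A); rewrite ?mulr1// !mulr0 mul0r.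
have irho : m.-integrable setT (rho_log_rho rho).
  by rewrite rhoE; exact: integrableZl.
apply: ge_ereal_inf => /=; exists (\int[m]_x rho_log_rho rho x).
  exists rho => //; split; last exact: integrable_funepos.
  split => [|x|B mB].
  - exact: measurable_funM.
  - by rewrite /rho mulr_ge0// invr_ge0 ltW.
  - under eq_integral do rewrite EFinM.
    rewrite ge0_integralZl//; first by rewrite integral_indic// setIC muE.
    + by apply/measurable_EFinP; exact: measurable_funTS.
    + by rewrite lee_fin invr_ge0 ltW.
rewrite rhoE integralZl// integral_indic// setIT -(fineK mAf) -/v -EFinM lee_fin.
by rewrite mulrAC mulVf ?gt_eqF// mul1r lnV.
Qed.

(** Jensen's inequality in tangent-line form: with v the mass of [S], convexity of x ln x at 1/v
    gives rho ln rho >= (1 - ln v) rho - 1/v on [S], and integration over [S] gives -ln v. The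
    tangent line itself comes from ln z <= z - 1 at z = 1/(v rho). *)
Lemma entropy_ge mu S : measurable S -> mu S = 1 -> m S < +oo ->
  entropy m mu < +oo -> 0 < m S /\ (- ln (fine (m S)))%:E <= entropy m mu.
Proof.
move=> mS muS mSy entmu.
have density_null rho : is_density m mu rho -> 
    \forall x \ae m, (~ S x -> rho x = 0%R).
  move=> [mrho rho0 muE].
  have : \int[m]_(x in ~` S) `|(rho x)%:E| = 0.
    under eq_integral do rewrite gee0_abs ?lee_fin//.
    rewrite -muE; last exact: measurableC.
    by rewrite probability_setC// muS subee.
  move=> /(ae_eq_integral_abs m (measurableC mS) _).1 H.
  have {}H := H ltac:(exact/measurable_EFinP/measurable_funTS).
  by apply: filterS H => x + nSx => /(_ nSx)[].
(* Finite entropy provides a density, and a density gives no mass to an m-null set, against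
   [mu S = 1]. *)
have mS0 : 0 < m S.
  rewrite lt0e measure_ge0 andbT; apply/negP => /eqP mS0.
  have [rho [rd _]] : exists rho, is_density m mu rho /\ m.-integrable setT (rho_log_rho rho)^\+.
    apply/not_existsP => nrho; move: entmu; rewrite /entropy.
    rewrite (_ : [set _ | _ in _] = set0) ?ereal_inf0 ?ltxx//.
    by apply/seteqP; split => [_ /= [rho rhoP _]|//]; exact: (nrho rho rhoP).
  have [mrho rho0 muE] := rd.
  have := muE S mS; rewrite muS.
  rewrite (null_set_integral mS)//; first by move=> [] /eqP; rewrite oner_eq0.
  exact/measurable_EFinP/measurable_funTS.
split => //; apply: le_ereal_inf_tmp => _ /= [rho [rd ifp] <-].
have [mrho rho0 muE] := rd.
set v := fine (m S); have v0 : (0 < v)%R by rewrite fine_gt0// mS0.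
have mSf : m S \is a fin_num by rewrite ge0_fin_numE// ltW.

pose y (x : borel X) : R := (rho x * ln (rho x))%R.
have my : measurable_fun setT y.
  by apply: measurable_funM => //; apply: measurableT_comp => //; exact: measurable_ln.
pose Lp := Num.max (- ln v)%R 0%R; pose Ln := Num.max (ln v)%R 0%R.
have Lp0 : (0 <= Lp)%R by rewrite le_max lexx orbT.
have Ln0 : (0 <= Ln)%R by rewrite le_max lexx orbT.
have max_opp (a : R) : (Num.max a 0 = a + Num.max (- a) 0)%R.
  by case: (leP a 0%R) => h; case: leP => h'; lra.
have LE : (Lp - Ln = - ln v)%R by rewrite /Ln (max_opp (ln v)) /Lp; lra.
have my1 : measurable_fun setT (rho_log_rho rho) by exact/measurable_EFinP.
have int1 c : (0 <= c)%R -> \int[m]_x (c * rho x)%:E = c%:E.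
  move=> c0; under eq_integral do rewrite EFinM.
  rewrite ge0_integralZl//.
  - by rewrite -(muE setT)// probability_setT mule1.
  - exact/measurable_EFinP.
  - by move=> x _; rewrite lee_fin.
(* The tangent-line inequality with its terms distributed so that both sides are nonnegative: the
   negative part of rho ln rho might a priori have infinite integral, and -ln v = Lp - Ln has no
   fixed sign. *)
have ineq : \int[m]_x ((rho_log_rho rho)^\- x + ((Lp + 1) * rho x)%:E) <=
    \int[m]_x ((rho_log_rho rho)^\+ x + ((Ln * rho x)%:E + (v^-1 * \1_S x)%:E)).
  apply: ae_ge0_le_integral => //.
  - by move=> x _; rewrite adde_ge0// lee_fin mulr_ge0// addr_ge0.
  - apply: emeasurable_funD; first exact: measurable_funeneg.
    by apply/measurable_EFinP; exact: measurable_funM.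
  - by move=> x _; rewrite !adde_ge0// lee_fin ?mulr_ge0// invr_ge0 ltW.
  - apply: emeasurable_funD; first exact: measurable_funepos.
    by apply: emeasurable_funD; apply/measurable_EFinP; exact: measurable_funM.
  apply: filterS (density_null rho rd) => x nS _.
  rewrite funenegE funeposE /rho_log_rho -EFinN -!EFin_max -!EFinD lee_fin.
  rewrite (max_opp (rho x * ln (rho x))%R).
  suff : (- ln v * rho x + rho x <= rho x * ln (rho x) + v^-1 * \1_S x)%R.
    by rewrite -LE; lra.
  rewrite indicE; case: (boolP (x \in S)) => xS; last first.
    by rewrite nS ?mulr0 ?mul0r ?addr0//; rewrite notin_setE in xS.
  rewrite mulr1; have [->|rn0] := eqVneq (rho x) 0%R.
    by rewrite mulr0 mul0r !add0r invr_ge0 ltW.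
  have rp : (0 < rho x)%R by rewrite lt0r rn0 rho0.
  have z0 : (0 < (v * rho x)^-1)%R by rewrite invr_gt0 mulr_gt0.
  have : (ln (v * rho x)^-1 <= (v * rho x)^-1 - 1)%R.
    have := @le_ln1Dx R ((v * rho x)^-1 - 1); rewrite addrCA subrr addr0; apply.
    by rewrite ltrBDr addNr.
  rewrite lnV ?posrE ?mulr_gt0// lnM ?posrE// => H.
  have : (rho x * (- (ln v + ln (rho x))) <= rho x * ((v * rho x)^-1 - 1))%R.
    by rewrite ler_pM2l.
  have -> : (rho x * ((v * rho x)^-1 - 1) = v^-1 - rho x)%R.
    by rewrite mulrBr mulr1 invfM mulrCA mulfV ?mulr1.
  by lra.
move: ineq; rewrite ge0_integralD//; last 3 first.
- exact: measurable_funeneg.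
- by move=> x _; rewrite lee_fin mulr_ge0// addr_ge0.
- by apply/measurable_EFinP; exact: measurable_funM.
rewrite [in leRHS]ge0_integralD//; last 3 first.
- exact: measurable_funepos.
- by move=> x _; rewrite adde_ge0// lee_fin mulr_ge0// invr_ge0 ltW.
- by apply: emeasurable_funD; apply/measurable_EFinP; exact: measurable_funM.
rewrite [X in _ + X <= _]int1 ?addr_ge0//.
rewrite [X in _ <= _ + X]ge0_integralD//; last 4 first.
- by move=> x _; rewrite lee_fin mulr_ge0.
- by apply/measurable_EFinP; exact: measurable_funM.
- by move=> x _; rewrite lee_fin mulr_ge0// invr_ge0 ltW.
- by apply/measurable_EFinP; exact: measurable_funM.
rewrite int1//.
have -> : \int[m]_x (v^-1 * \1_S x)%:E = 1.
  under eq_integral do rewrite EFinM.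
  rewrite ge0_integralZl//.
  - by rewrite integral_indic// setIT -(fineK mSf) -/v -EFinM mulVf// gt_eqF.
  - exact/measurable_EFinP.
  - by rewrite lee_fin invr_ge0 ltW.
have ifp_fin := integrable_fin_num measurableT ifp.
rewrite [X in _ -> _ <= X]integralE -(fineK ifp_fin).
have : 0 <= \int[m]_x (rho_log_rho rho)^\- x.
  by apply: integral_ge0 => x _; exact: funeneg_ge0.
case: (\int[m]_x (rho_log_rho rho)^\- x) => [r _||]//.
by rewrite -!EFinD !lee_fin -LE; lra.
Qed.

End entropy_bounds.

(** * Couplings and the quadratic transport cost *)

Section transport.
Context {R : realType} {X : completeMetricType R}.
Hypothesis sX : separable_space X.
Implicit Types (mu nu : probability (borel X) R).
Local Open Scope ereal_scope.

Let cost (q : probability (borel X * borel X)%type R) : \bar R :=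
  \int[q]_u ((mdist (u.1 : X) (u.2 : X) ^+ 2)%R)%:E.

Lemma probability1_ae d (T : measurableType d) (P : probability T R)
    (A : set T) : measurable A -> P A = 1 -> {ae P, forall x, A x}.
Proof.
move=> mA PA; exists (~` A); split; first exact: measurableC.
  by rewrite probability_setC// PA subee.
by [].
Qed.

Lemma ae_setI d (T : measurableType d) (P : probability T R) (A B : set T) :
  {ae P, forall x, A x} -> {ae P, forall x, B x} ->
  {ae P, forall x, (A `&` B) x}.
Proof. by move=> PA PB; apply: filterS2 PA PB => x. Qed.

Lemma ae_sub d (T : measurableType d) (P : probability T R) (A B : set T) :
  {ae P, forall x, A x} -> (forall x, A x -> B x) -> {ae P, forall x, B x}.
Proof. by move=> PA AB; apply: filterS PA => x /AB. Qed.

Lemma ae_le_integral d (T : measurableType d) (P : probability T R) (A : set T)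
    (f g : T -> \bar R) : {ae P, forall x, A x} ->
  (forall x, 0 <= f x) -> measurable_fun setT f ->
  (forall x, 0 <= g x) -> measurable_fun setT g ->
  (forall x, A x -> f x <= g x) -> \int[P]_x f x <= \int[P]_x g x.
Proof.
move=> PA f0 mf g0 mg fg; apply: ae_ge0_le_integral => //.
by apply: filterS PA => x /fg.
Qed.

Lemma measurable_sqr_mdist d (T : measurableType d) (f g : T -> borel X) :
  measurable_fun setT f -> measurable_fun setT g ->
  measurable_fun setT (fun x => ((mdist (f x : X) (g x : X) ^+ 2)%R : R)).
Proof.
move=> mf mg; apply: measurable_funX.
apply: (measurableT_comp (measurable_mdist sX) (g := fun x => (f x, g x))).
exact: measurable_fun_pair.
Qed.

Lemma coupling_fst mu nu q (f : borel X -> \bar R) : coupling mu nu q ->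
  measurable_fun setT f -> (forall x, 0 <= f x) ->
  \int[q]_u f u.1 = \int[mu]_x f x.
Proof.
move=> qc mf f0; apply: eq_ge0_integral => // E mE.
rewrite (_ : fst @^-1` E = E `*` setT); first by have [] := qc E mE.
by apply/seteqP; split => -[x y]//= [].
Qed.

Lemma coupling_snd mu nu q (f : borel X -> \bar R) : coupling mu nu q ->
  measurable_fun setT f -> (forall x, 0 <= f x) ->
  \int[q]_u f u.2 = \int[nu]_x f x.
Proof.
move=> qc mf f0; apply: eq_ge0_integral => // E mE.
rewrite (_ : snd @^-1` E = setT `*` E); first by have [] := qc E mE.
by apply/seteqP; split => -[x y]//= [].
Qed.

Lemma product_coupling mu nu : coupling mu nu (mu \x nu).
Proof.
move=> A mA.
split.
  rewrite [LHS](@product_measure1E _ _ _ _ R mu nu A setT)//.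
  by rewrite [X in _ * X]probability_setT mule1.
rewrite [LHS](@product_measure1E _ _ _ _ R mu nu setT A)//.
by rewrite [X in X * _]probability_setT mul1e.
Qed.

(** Guarantees that the infimum in [W2] is a real number; otherwise [fine] would silently turn +oo
    into distance 0. *)
Lemma second_moment_cost mu nu : finite_second_moment mu ->
  finite_second_moment nu -> exists2 q, coupling mu nu q & cost q < +oo.
Proof.
move=> [x0 mx0] [y0 ny0].
have [q qc] : exists q, coupling mu nu q.
  by exists (mu \x nu); exact: product_coupling.
exists q => //.
have mc (z : X) : measurable_fun setT
    (fun x : borel X => ((mdist z (x : X) ^+ 2)%R)%:E).
  by apply/measurable_EFinP; exact: measurable_sqr_mdist.
apply: (@le_lt_trans _ _ (\int[q]_u (3%R%:E *
  (((mdist x0 (u.1 : X) ^+ 2)%R)%:E + ((mdist y0 (u.2 : X) ^+ 2)%R)%:E) +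
  ((3 * mdist x0 y0 ^+ 2)%R)%:E))).
  apply: ge0_le_integral => //.
  - by move=> u _; rewrite lee_fin sqr_ge0.
  - by apply/measurable_EFinP; exact: measurable_sqr_mdist.
  - apply: emeasurable_funD => //; apply: measurable_funeM.
    apply: emeasurable_funD.
      exact: (measurableT_comp (mc x0) measurable_fst).
    exact: (measurableT_comp (mc y0) measurable_snd).
  - move=> -[x y] _ /=.
    rewrite -[leRHS]/((3 * (mdist x0 x ^+ 2 + mdist y0 y ^+ 2) +
      3 * mdist x0 y0 ^+ 2)%R%:E) lee_fin.
    have := metric_triangle x x0 y; have := metric_triangle x0 y0 y.
    rewrite (metric_sym x x0).
    have := @mdist_ge0 R X x y; have := @mdist_ge0 R X x0 x.
    have := @mdist_ge0 R X y0 y; have := @mdist_ge0 R X x0 y0.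
    move: (mdist x y) (mdist x0 x) (mdist x0 y0) (mdist y0 y) (mdist x0 y).
    move=> a b c d e c0 d0 b0 a0 e1 a1.
    have h : (a <= b + c + d)%R by lra.
    apply: (@le_trans _ _ ((b + c + d) ^+ 2)%R); first by rewrite ler_sqr ?nnegrE//; lra.
    have := sqr_ge0 (b - c); have := sqr_ge0 (c - d); have := sqr_ge0 (b - d).
    by rewrite !expr2; nra.
have mc1 := measurableT_comp (mc x0) (@measurable_fst _ _ (borel X) (borel X)).
have mc2 := measurableT_comp (mc y0) (@measurable_snd _ _ (borel X) (borel X)).
have sq0 (z x : X) : 0 <= ((mdist z x ^+ 2)%R)%:E by rewrite lee_fin sqr_ge0.
rewrite ge0_integralD//; last 3 first.
- by move=> u _; apply: mule_ge0; [rewrite lee_fin|exact: adde_ge0].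
- by apply: measurable_funeM; exact: emeasurable_funD.
- by move=> u _; rewrite lee_fin mulr_ge0// sqr_ge0.
rewrite ge0_integralZl//; last 2 first.
- exact: emeasurable_funD.
- by move=> u _; exact: adde_ge0.
rewrite ge0_integralD//.
rewrite (coupling_fst qc (mc x0)); last first.
  by move=> x; rewrite lee_fin sqr_ge0.
rewrite (coupling_snd qc (mc y0)); last first.
  by move=> x; rewrite lee_fin sqr_ge0.
rewrite [X in _ + X]integral_cst// [X in _ + _ * X](@probability_setT _ _ _ q) mule1.
rewrite lte_add_pinfty// ?ltry//.
by rewrite lte_mul_pinfty// lte_add_pinfty.
Qed.

Lemma W2_ge0 mu nu : (0 <= W2 mu nu)%R.
Proof. exact: sqrtr_ge0. Qed.

Lemma W2_le_cost mu nu q : coupling mu nu q ->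
  ((W2 mu nu ^+ 2)%R)%:E <= cost q.
Proof.
move=> qc; rewrite /W2; set I := ereal_inf _.
have I0 : 0 <= I.
  apply: le_ereal_inf_tmp => _ [r _ <-]; apply: integral_ge0 => u _.
  by rewrite lee_fin sqr_ge0.
rewrite sqr_sqrtr ?fine_ge0//; apply: le_trans (_ : I <= _); last first.
  by apply: ge_ereal_inf; exists (cost q) => //; exists q.
by case: I I0 => [r||]//= _; exact: leey.
Qed.

(** Almost optimal couplings stand in for optimal ones, whose existence would require compactness of
    the set of couplings. *)
Lemma W2_approx mu nu (e : R) : finite_second_moment mu ->
  finite_second_moment nu -> (0 < e)%R ->
  exists2 q, coupling mu nu q & cost q <= (W2 mu nu ^+ 2 + e)%:E.
Proof.
move=> m2 n2 e0; rewrite /W2; set I := ereal_inf _.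
have I0 : 0 <= I.
  apply: le_ereal_inf_tmp => _ [r _ <-]; apply: integral_ge0 => u _.
  by rewrite lee_fin sqr_ge0.
have Ify : I < +oo.
  have [q qc qy] := second_moment_cost m2 n2; apply: le_lt_trans qy.
  by apply: ge_ereal_inf; exists (cost q) => //; exists q.
have If : I \is a fin_num by rewrite ge0_fin_numE.
rewrite sqr_sqrtr ?fine_ge0// EFinD fineK//.
have [_ [q qc <-] /ltW qI] := lb_ereal_inf_adherent e0 If.
by exists q.
Qed.

Lemma W2_le mu nu (A B : set (borel X)) (D : R) : measurable A -> measurable B ->
  mu A = 1 -> nu B = 1 -> (0 <= D)%R ->
  (forall x y : X, A x -> B y -> (mdist x y <= D)%R) -> (W2 mu nu <= D)%R.
Proof.
move=> mA mB muA nuB D0 AB.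
rewrite -ler_sqr ?nnegrE ?W2_ge0// -lee_fin.
have [q qc qAB] : exists2 q, coupling mu nu q & q (A `*` B) = 1.
  exists (mu \x nu); first exact: product_coupling.
  rewrite [LHS](@product_measure1E _ _ _ _ R mu nu A B)//.
  by rewrite [X in X * _]muA [X in _ * X]nuB mule1.
apply: le_trans (W2_le_cost qc) _.
rewrite -[leRHS]mule1 -(@probability_setT _ _ _ q).
rewrite -integral_cst//; apply: ae_ge0_le_integral => //.
- by move=> u _; rewrite lee_fin sqr_ge0.
- by apply/measurable_EFinP; exact: measurable_sqr_mdist.
- by move=> u _; rewrite lee_fin sqr_ge0.
have : {ae q, forall u, (A `*` B) u}.
  by apply: probability1_ae => //; exact: measurableX.
apply: filterS => -[x y] [/= Ax By] _.
by rewrite lee_fin ler_sqr ?nnegrE ?mdist_ge0// AB.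
Qed.

End transport.

(** * Geodesics of measures concentrate on intermediate points *)

Section intermediate_points.
Context {R : realType} {X : completeMetricType R}.
Hypothesis sX : separable_space X.
Implicit Types (mu nu : probability (borel X) R) (A B : set X).

(* The points z which, up to d, divide a segment from A to B in the
   proportion t : 1 - t. *)
Definition near_intermediate (t d : R) A B : set X :=
  [set z | exists x y, [/\ A x, B y, mdist x z < t * mdist x y + d &
                           mdist z y < (1 - t) * mdist x y + d]].

Lemma open_near_intermediate t d A B : open (near_intermediate t d A B).
Proof.
rewrite (_ : near_intermediate t d A B =
  \bigcup_(u in A `*` B) (ball u.1 (t * mdist u.1 u.2 + d) `&`
                          ball u.2 ((1 - t) * mdist u.1 u.2 + d))).
  by apply: bigcup_open => u _; apply: openI; exact: mball_open.
apply/seteqP; split => z.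
  move=> [x [y [Ax By xz zy]]]; exists (x, y) => //=.
  by rewrite !ballEmdist/= (metric_sym y).
move=> [[x y] [/= Ax By]]; rewrite !ballEmdist/= => -[xz yz].
by exists x, y; split => //; rewrite metric_sym.
Qed.

(* With a + b = D + s and w = (1 - t) a - t b one has
   a^2 / t + b^2 / (1 - t) = (D + s)^2 + w^2 / (t (1 - t)). *)
Lemma split_defect (t d a b D : R) : 0 < t < 1 -> 0 < d -> 0 <= D ->
  D <= a + b -> t * D + d <= a \/ (1 - t) * D + d <= b ->
  D ^+ 2 + d ^+ 2 / 4 <= a ^+ 2 / t + b ^+ 2 / (1 - t).
Proof.
move=> /andP[t0 t1] d0 D0 Dab H.
have t1' : 0 < 1 - t by rewrite subr_gt0.
pose s := a + b - D; pose w := (1 - t) * a - t * b.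
have -> : a ^+ 2 / t + b ^+ 2 / (1 - t) = (D + s) ^+ 2 + w ^+ 2 / (t * (1 - t)).
  by rewrite /s /w; field; rewrite !gt_eqF.
have s0 : 0 <= s by rewrite subr_ge0.
have tt0 : 0 < t * (1 - t) by rewrite mulr_gt0.
have tt1 : t * (1 - t) <= 1 by nra.
have h1 : w ^+ 2 <= w ^+ 2 / (t * (1 - t)).
  by rewrite ler_pdivlMr// ler_piMr// sqr_ge0.
(* Since a = t (D + s) + w and b = (1 - t) (D + s) - w, a violation of size [d] on either side must
   be paid by the excess [s] or the imbalance [w]. *)
have h2 : d <= s + `|w|.
  have ts : t * s <= s by rewrite ler_piMl// ltW.
  have ts0 : 0 <= t * s by rewrite mulr_ge0// ltW.
  have [H1|H1] := H.
    have := ler_norm w; have : w = a - t * D - t * s by rewrite /w /s; ring.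
    by lra.
  have := ler_norm (- w); rewrite normrN.
  have : - w = b - (1 - t) * D - (s - t * s) by rewrite /w /s; ring.
  by lra.
have h3 : d ^+ 2 / 4 <= s ^+ 2 + w ^+ 2.
  rewrite -(real_normK (num_real w)).
  have := normr_ge0 w; move: `|w| h2 => v h2 v0.
  have : d ^+ 2 <= (s + v) ^+ 2 by rewrite ler_sqr ?nnegrE//; lra.
  have := sqr_ge0 (s - v); have := sqr_ge0 s; have := sqr_ge0 v.
  by rewrite !expr2; nra.
have : 0 <= D * s by rewrite mulr_ge0.
by move: h1 h3; rewrite !expr2; nra.
Qed.

Lemma split_defect0 (t a b D : R) : 0 < t < 1 -> 0 <= D ->
  D <= a + b -> D ^+ 2 <= a ^+ 2 / t + b ^+ 2 / (1 - t).
Proof.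
move=> /andP[t0 t1] D0 Dab.
have t1' : 0 < 1 - t by rewrite subr_gt0.
have -> : a ^+ 2 / t + b ^+ 2 / (1 - t) = (a + b) ^+ 2 +
    ((1 - t) * a - t * b) ^+ 2 / (t * (1 - t)).
  by field; rewrite !gt_eqF.
apply: (@le_trans _ _ ((a + b) ^+ 2)).
  by rewrite ler_sqr ?nnegrE// (le_trans D0).
by rewrite lerDl divr_ge0 ?sqr_ge0// mulr_ge0// ltW.
Qed.

Lemma small_cells (e : R) : 0 < e -> exists C : (set (borel X))^nat,
  [/\ forall i, measurable (C i), trivIset setT C, \bigcup_i C i = setT &
      forall i x y, C i x -> C i y -> mdist (x : X) (y : X) < e].
Proof.
move=> e0; have [f hf] := dense_sequence sX.
have e20 : 0 < e / 2 by rewrite divr_gt0.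
pose D i : set (borel X) := ball (f i) (e / 2).
exists (seqDU D); split.
- move=> i; apply: measurableD; first exact: ball_borel.
  by apply: bigsetU_measurable => j _; exact: ball_borel.
- exact: trivIset_seqDU.
- rewrite -seqDU_bigcup_eq; apply/seteqP; split => // x _.
  by have [n xn] := hf x _ e20; exists n => //; rewrite /D ballEmdist.
- move=> i x y [+ _] [+ _]; rewrite /D !ballEmdist/= => xi yi.
  rewrite (splitr e); apply: le_lt_trans (metric_triangle _ (f i) _) _.
  by rewrite ltrD// metric_sym.
Qed.

Local Open Scope ereal_scope.

(** Almost optimal couplings of ([mu0], [mut]) and ([mut], [mu1]) are glued along [mut]. Their
    costs, weighted by 1/t and 1/(1 - t), add up to t W^2 + (1 - t) W^2 = W^2 up to O(e), while the
    outer pair costs at least W^2. By [split_defect] every middle point outside the intermediate set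
    wastes at least d^2/4, so such points have mass O(e), hence 0. *)
Lemma geodesic_concentrated mu0 mut mu1 A B (t d : R) :
  measurable (A : set (borel X)) -> measurable (B : set (borel X)) ->
  mu0 A = 1 -> mu1 B = 1 ->
  finite_second_moment mu0 -> finite_second_moment mut ->
  finite_second_moment mu1 -> (0 < t < 1)%R -> (0 < d)%R ->
  (W2 mu0 mut = t * W2 mu0 mu1)%R -> (W2 mut mu1 = (1 - t) * W2 mu0 mu1)%R ->
  mut (near_intermediate t d A B) = 1.
Proof.
move=> mA mB muA muB f0 ft f1 t01 d0 W0 W1.
set S := near_intermediate t d A B; set W := W2 mu0 mu1.
have mS : measurable (S : set (borel X)).
  by apply: open_borel; exact: open_near_intermediate.
have mSC : measurable (~` S : set (borel X)) by exact: measurableC.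
have /andP[t0 t1] := t01; have t1' : (0 < 1 - t)%R by rewrite subr_gt0.
suff H : forall e : R, (0 < e < 1)%R ->
    ((W ^+ 2)%R%:E + (d ^+ 2 / 4)%R%:E * mut (~` S) <=
    (W ^+ 2 + e * (t^-1 + W ^+ 2 + 4 / (1 - t)))%R%:E).
  have muSf : mut (~` S) \is a fin_num by rewrite fin_num_measure.
  have : (fine (mut (~` S)) <= 0)%R.
    have d4 : (0 < d ^+ 2 / 4)%R by rewrite divr_gt0// exprn_gt0.
    rewrite -(pmulr_rle0 _ d4); apply/ler_addgt0Pl => e e0; rewrite addr0.
    pose c := (t^-1 + W ^+ 2 + 4 / (1 - t))%R.
    have c0 : (0 < c)%R.
      have ? : (0 < t^-1)%R by rewrite invr_gt0.
      have ? : (0 < 4 / (1 - t))%R by rewrite divr_gt0.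
      by have := sqr_ge0 W; rewrite /c; lra.
    pose e' : R := (Num.min (e / c) 2^-1)%R.
    have e'01 : (0 < e' < 1)%R.
      rewrite /e' lt_min divr_gt0// invr_gt0 ltr0n/= gt_min.
      by apply/orP; right; rewrite invf_lt1// ltr1n.
    have := H _ e'01; rewrite -(fineK muSf) -EFinM -EFinD lee_fin lerD2l.
    move=> /le_trans; apply; rewrite -/c -ler_pdivlMr//.
    by rewrite /e' ge_min lexx.
  move=> h; have muSC0 : mut (~` S) = 0.
    by apply/eqP; rewrite eq_le measure_ge0 andbT -(fineK muSf) lee_fin.
  by rewrite -[S]setCK probability_setC// muSC0 sube0.
move=> e /andP[e0 e1].
have [q0 q0c q0W] := W2_approx sX f0 ft e0.
have [q1 q1c q1W] := W2_approx sX ft f1 e0.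
have [C [mC tC UC dC]] := small_cells e0.
have marg (E : set (borel X)) : measurable E -> q0 (setT `*` E) = q1 (E `*` setT).
  move=> mE; have [_ ->] := q0c E mE.
  by have [-> _] := q1c E mE.
have [Pi [Pi0 Pi1 PiC]] := approximate_gluing mC tC UC marg.
pose ends (u : (borel X * borel X) * (borel X * borel X)) : borel X * borel X :=
  (u.1.1, u.2.2).
have mends : measurable_fun setT ends.
  apply: measurable_fun_pair.
    exact: (measurableT_comp measurable_fst measurable_fst).
  exact: (measurableT_comp measurable_snd measurable_snd).
(* The outer coordinates of the glued plan couple [mu0] and [mu1], so their cost bounds W^2 from
   above. *)
have [q qE] : exists q : probability (borel X * borel X)%type R,
    forall E, q E = Pi (ends @^-1` E).
  have [|q qE] := measure_probability (mu := image_measure Pi mends).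
    exact: (@probability_setT _ _ _ Pi).
  by exists q => E; rewrite qE.
have qc : coupling mu0 mu1 q.
  move=> E mE; have [E0 _] := q0c E mE; have [_ E1] := q1c E mE.
  split.
    rewrite qE (_ : _ @^-1` _ = (E `*` setT) `*` setT) ?Pi0//.
      exact: measurableX.
    by apply/seteqP; split => -[[x z] [z' y]]//= [[]].
  rewrite qE (_ : _ @^-1` _ = setT `*` (setT `*` E)) ?Pi1//.
    exact: measurableX.
  by apply/seteqP; split => -[[x z] [z' y]]//= [_ []].
have msq := @measurable_sqr_mdist _ _ sX.
pose D2 (u : (borel X * borel X) * (borel X * borel X)) : R := (mdist (u.1.1 : X) (u.2.2 : X) ^+ 2)%R.
pose A2 (u : (borel X * borel X) * (borel X * borel X)) : R := (mdist (u.1.1 : X) (u.1.2 : X) ^+ 2)%R.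
pose B2 (u : (borel X * borel X) * (borel X * borel X)) : R := (mdist (u.2.1 : X) (u.2.2 : X) ^+ 2)%R.
have mA2 : measurable_fun setT A2.
  by apply: msq; apply: measurableT_comp.
have mB2 : measurable_fun setT B2.
  by apply: msq; apply: measurableT_comp.
have mD2 : measurable_fun setT D2.
  by apply: msq; apply: measurableT_comp.
have WD : (W ^+ 2)%R%:E <= \int[Pi]_u (D2 u)%:E.
  apply: le_trans (W2_le_cost qc) _.
  rewrite -(@eq_ge0_integral R _ _ _ _ Pi q ends
    (fun v => ((mdist (v.1 : X) (v.2 : X) ^+ 2)%R)%:E))//.
  - by move=> E mE; apply/esym; exact: qE.
  - by apply/measurable_EFinP; exact: msq.
  - by move=> v; rewrite lee_fin sqr_ge0.
have AE : \int[Pi]_u (A2 u)%:E <= ((t * W) ^+ 2 + e)%R%:E.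
  rewrite -W0; apply: le_trans q0W.
  rewrite -(@eq_ge0_integral R _ _ _ _ Pi q0 fst
    (fun v => ((mdist (v.1 : X) (v.2 : X) ^+ 2)%R)%:E))//.
  - move=> E mE; rewrite (_ : fst @^-1` E = E `*` setT); first exact: Pi0.
    by apply/seteqP; split => -[u v]//= [].
  - by apply/measurable_EFinP; exact: msq.
  - by move=> v; rewrite lee_fin sqr_ge0.
have BE : \int[Pi]_u (B2 u)%:E <= (((1 - t) * W) ^+ 2 + e)%R%:E.
  rewrite -W1; apply: le_trans q1W.
  rewrite -(@eq_ge0_integral R _ _ _ _ Pi q1 snd
    (fun v => ((mdist (v.1 : X) (v.2 : X) ^+ 2)%R)%:E))//.
  - move=> E mE; rewrite (_ : snd @^-1` E = setT `*` E); first exact: Pi1.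
    by apply/seteqP; split => -[u v]//= [].
  - by apply/measurable_EFinP; exact: msq.
  - by move=> v; rewrite lee_fin sqr_ge0.
(* The two middle coordinates z and z' agree only up to [e], so b = d(z, y) is at most b' + e with
   b' = d(z', y); from 2 b' <= b'^2 + 1 follows (b' + e)^2 <= (1 + e) b'^2 + e^2 + e. *)
pose k := ((e ^+ 2 + e) / (1 - t))%R.
have k0 : (0 <= k)%R by rewrite /k divr_ge0 ?(ltW t1')// addr_ge0 ?sqr_ge0// ltW.
have b0 : (0 <= (1 + e) / (1 - t))%R by rewrite divr_ge0 ?(ltW t1')// addr_ge0// ltW.
have tV0 : (0 <= t^-1)%R by rewrite invr_ge0 ltW.
have A20 u : (0 <= A2 u)%R by exact: sqr_ge0.
have B20 u : (0 <= B2 u)%R by exact: sqr_ge0.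
have aeS : {ae Pi, forall u, [/\ A u.1.1, B u.2.2 & (mdist (u.1.2 : X) (u.2.1 : X) < e)%R]}.
  have h0 : {ae Pi, forall u, ((A `*` setT) `*` setT) u}.
    apply: probability1_ae.
      by apply: measurableX => //; exact: measurableX.
    rewrite Pi0; last exact: measurableX.
    by have [-> _] := q0c A mA.
  have h1 : {ae Pi, forall u, (setT `*` (setT `*` B)) u}.
    apply: probability1_ae.
      by apply: measurableX => //; exact: measurableX.
    rewrite Pi1; last exact: measurableX.
    by have [_ ->] := q1c B mB.
  have h2 : {ae Pi, forall u,
      (\bigcup_i ((setT `*` C i) `*` (C i `*` setT))) u}.
    apply: probability1_ae => //; apply: bigcupT_measurable => i.
    by apply: measurableX; exact: measurableX.
  apply: (ae_sub (ae_setI h0 (ae_setI h1 h2))) => -[[x z] [z' y]]/=.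
  move=> [[[Ax _] _] [[_ [_ By]] [i _ [[_ Cz] [Cz' _]]]]]; split => //.
  exact: dC Cz Cz'.
have muSC : \int[Pi]_u ((d ^+ 2 / 4) * \1_(~` S) u.1.2)%R%:E =
    (d ^+ 2 / 4)%R%:E * mut (~` S).
  rewrite (@eq_ge0_integral R _ _ _ _ Pi mut (fun u => u.1.2)
    (fun z => ((d ^+ 2 / 4) * \1_(~` S) z)%R%:E)).
  - under eq_integral do rewrite EFinM.
    rewrite ge0_integralZl//; first by rewrite integral_indic// setIT.
      exact/measurable_EFinP.
    by rewrite lee_fin divr_ge0// sqr_ge0.
  - exact: measurableT_comp.
  - move=> E mE; rewrite (_ : _ @^-1` E = (setT `*` E) `*` setT).
      by have [_ h] := q0c _ mE; apply: etrans (Pi0 _ _) h; exact: measurableX.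
    by apply/seteqP; split => -[[x z] v]//= [[]].
  - by apply/measurable_EFinP; exact: measurable_funM.
  - by move=> z; rewrite lee_fin mulr_ge0// divr_ge0// sqr_ge0.
have mi : measurable_fun setT (fun u : (borel X * borel X) * (borel X * borel X) =>
    ((d ^+ 2 / 4) * \1_(~` S) u.1.2)%R : R).
  apply: measurable_funM => //.
  apply: (measurableT_comp (f := \1_(~` S) : borel X -> R)) => //.
  exact: measurableT_comp.
have i0 u : (0 <= (d ^+ 2 / 4) * (\1_(~` S) u : R))%R.
  by rewrite mulr_ge0// divr_ge0// sqr_ge0.
apply: (@le_trans _ _ (\int[Pi]_u ((D2 u)%:E +
    ((d ^+ 2 / 4) * \1_(~` S) u.1.2)%R%:E))).
  rewrite ge0_integralD//; last 4 first.
  - by move=> u _; rewrite lee_fin sqr_ge0.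
  - exact/measurable_EFinP.
  - by move=> u _; rewrite lee_fin.
  - exact/measurable_EFinP.
  by rewrite muSC leeD2r.
apply: (@le_trans _ _ (\int[Pi]_u ((t^-1 * A2 u)%:E +
   (((1 + e) / (1 - t) * B2 u)%:E + k%:E)))).
  apply: (ae_le_integral aeS).
  - by move=> u; rewrite adde_ge0// lee_fin// sqr_ge0.
  - by apply: emeasurable_funD; exact/measurable_EFinP.
  - move=> u; rewrite -!EFinD lee_fin; apply: addr_ge0; first exact: mulr_ge0.
    by apply: addr_ge0 => //; exact: mulr_ge0.
  - apply: emeasurable_funD.
      by apply/measurable_EFinP; exact: measurable_funM.
    apply: emeasurable_funD; last exact: measurable_cst.
    by apply/measurable_EFinP; exact: measurable_funM.
  move=> [[x z] [z' y]] [/= Ax By zz'].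
  rewrite -!EFinD lee_fin /D2 /A2 /B2 /=.
  set D := mdist x y; set a := mdist x z; set b' := mdist z' y.
  pose b := mdist z y.
  have bb' : (b <= b' + e)%R.
    rewrite /b /b' addrC; apply: le_trans (metric_triangle _ z' _) _.
    by rewrite lerD2r ltW.
  have b'0 : (0 <= b')%R by exact: mdist_ge0.
  have bsq : (b ^+ 2 / (1 - t) <= (1 + e) / (1 - t) * b' ^+ 2 + k)%R.
    have -> : ((1 + e) / (1 - t) * b' ^+ 2 + k =
        ((1 + e) * b' ^+ 2 + (e ^+ 2 + e)) / (1 - t))%R.
      by rewrite /k [RHS]mulrDl; congr (_ + _)%R; rewrite mulrAC.
    rewrite ler_pM2r ?invr_gt0//.
    apply: (@le_trans _ _ ((b' + e) ^+ 2)%R).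
      by rewrite ler_sqr ?nnegrE ?mdist_ge0// addr_ge0// ltW.
    have := sqr_ge0 (b' - 1); rewrite !expr2.
    by move=> h; have : (0 <= e * ((b' - 1) * (b' - 1)))%R; [rewrite mulr_ge0// ltW|nra].
  have Dab : (D <= a + b)%R by exact: metric_triangle.
  have D0 : (0 <= D)%R by exact: mdist_ge0.
  suff : (D ^+ 2 + d ^+ 2 / 4 * \1_(~` S) z <= a ^+ 2 / t + b ^+ 2 / (1 - t))%R.
    by rewrite [(t^-1 * _)%R]mulrC; lra.
  rewrite indicE; case: (boolP (z \in ~` S)) => [/set_mem zS|_].
    rewrite mulr1; apply: split_defect => //.
    have [h|h] := leP (t * D + d)%R a; [by left|right].
    rewrite leNgt; apply/negP => h'; apply: zS.
    by exists x, y; split.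
  by rewrite mulr0 addr0 split_defect0.
rewrite ge0_integralD//; last 4 first.
- by move=> u _; rewrite lee_fin mulr_ge0.
- by apply/measurable_EFinP; exact: measurable_funM.
- move=> u _; rewrite -EFinD lee_fin; apply: addr_ge0 => //.
  exact: mulr_ge0.
- apply: emeasurable_funD; last exact: measurable_cst.
  by apply/measurable_EFinP; exact: measurable_funM.
rewrite [X in _ + X <= _]ge0_integralD//; last 2 first.
- by move=> u _; rewrite lee_fin mulr_ge0.
- by apply/measurable_EFinP; exact: measurable_funM.
rewrite [X in _ + (_ + X) <= _]integral_cst//.
rewrite [X in _ + (_ + _ * X) <= _](@probability_setT _ _ _ Pi) mule1.
under eq_integral do rewrite EFinM.
rewrite ge0_integralZl//; last 2 first.
- exact/measurable_EFinP.
- by move=> u _; rewrite lee_fin.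
under [X in _ + (X + _) <= _]eq_integral do rewrite EFinM.
rewrite ge0_integralZl//; last 2 first.
- exact/measurable_EFinP.
- by move=> u _; rewrite lee_fin.
apply: (@le_trans _ _ ((t^-1)%:E * ((t * W) ^+ 2 + e)%R%:E +
  (((1 + e) / (1 - t))%:E * (((1 - t) * W) ^+ 2 + e)%R%:E + k%:E))).
  apply: leeD; first by apply: lee_wpmul2l => //; rewrite lee_fin.
  by apply: leeD2r; apply: lee_wpmul2l => //; rewrite lee_fin.
rewrite -!EFinM -!EFinD lee_fin.
(* The accumulated error is linear in [e]; [e < 1] bounds 2 + 2 e by the 4 of the announced
   constant. *)
have -> : (t^-1 * ((t * W) ^+ 2 + e) + ((1 + e) / (1 - t) *
    (((1 - t) * W) ^+ 2 + e) + k) =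
  W ^+ 2 + e * (t^-1 + (1 - t) * W ^+ 2 + (2 + 2 * e) / (1 - t)))%R.
  by rewrite /k; field; rewrite !gt_eqF.
rewrite lerD2l ler_pM2l// lerD//; last by rewrite ler_pM2r ?invr_gt0//; lra.
by rewrite lerD2l ler_piMl ?sqr_ge0//; lra.
Qed.

End intermediate_points.

(** * Brunn-Minkowski, contraction towards a point and doubling *)

Section brunn_minkowski.
Context {R : realType} {X : completeMetricType R}.
Variables (m : {measure set (borel X) -> \bar R}) (K N : R).
Hypotheses (N1 : 1 <= N) (mmsX : is_mms m) (cdX : CDe m K N).
Local Open Scope ereal_scope.

Let sX : separable_space X. Proof. by have [] := mmsX. Qed.

Lemma bounded_second_moment (mu : probability (borel X) R) (A : set (borel X))
    (x0 : X) (D : R) : measurable A -> mu A = 1 -> (0 <= D)%R ->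
  (forall x, A x -> (mdist x0 (x : X) <= D)%R) -> finite_second_moment mu.
Proof.
move=> mA muA D0 AD; exists x0.
apply: (@le_lt_trans _ _ (\int[mu]_x (cst (D ^+ 2)%R%:E x))); last first.
  by rewrite integral_cst// [X in _ * X](@probability_setT _ _ _ mu) mule1 ltry.
apply: (ae_le_integral (probability1_ae mA muA)) => //.
- by move=> x; rewrite lee_fin sqr_ge0.
- by apply/measurable_EFinP; exact: measurable_sqr_mdist.
- by move=> x; rewrite lee_fin sqr_ge0.
- by move=> x Ax; rewrite lee_fin ler_sqr ?nnegrE ?mdist_ge0// AD.
Qed.

(** For uniform measures [U_N] at the start is at least m(A)^(1/N), and at time [t] it is at most
    m(S)^(1/N), because the geodesic is carried by the intermediate set S. Thus [CDe] becomes an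
    inequality between N-th roots of volumes. *)
Lemma brunn_minkowski_finite (e : R) : (0 < e < 1)%R -> exists2 d0 : R, (0 < d0)%R &
  forall (A B : set X) (t d : R),
    measurable (A : set (borel X)) -> measurable (B : set (borel X)) ->
    0 < m A < +oo -> 0 < m B < +oo -> (0 < t < 1)%R -> (0 < d)%R ->
    (forall x y, A x -> B y -> (mdist x y <= d0)%R) ->
    ((((1 - e) * (1 - t)) `^ N)%R)%:E * m A <= m (near_intermediate t d A B).
Proof.
move=> e01; have N0 : (0 < N)%R by apply: lt_le_trans N1.
have [d0 d00 sigmaE] := @sigma_ge _ K N e N0 e01; exists d0 => //.
move=> A B t d mA mB mA0 mB0 t01 d_gt0 AB.
have /andP[e0 e1] := e01; have /andP[t0 t1] := t01.
set S := near_intermediate t d A B.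
have mS : measurable (S : set (borel X)).
  by apply: open_borel; exact: open_near_intermediate.
have [mSy|] := ltP (m S) +oo; last by rewrite leye_eq => /eqP ->; exact: leey.
have [mu0 mu0E] := uniform_probability mA mA0.
have [mu1 mu1E] := uniform_probability mB mB0.
have unif (C : set (borel X)) : 0 < m C < +oo -> ((fine (m C))^-1)%:E * m C = 1.
  move=> /andP[C0 Cy]; rewrite -[X in _ * X]fineK ?ge0_fin_numE ?measure_ge0//.
  by rewrite -EFinM mulVf// gt_eqF// fine_gt0// C0.
have mu0A : mu0 A = 1 by rewrite mu0E// setIid unif.
have mu1B : mu1 B = 1 by rewrite mu1E// setIid unif.
have nonempty (C : set (borel X)) : 0 < m C < +oo -> exists x, C x.
  move=> /andP[C0 _]; apply/set0P; apply: contraTneq C0 => ->.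
  by rewrite measure0 ltxx.
have [a Aa] := nonempty A mA0; have [b Bb] := nonempty B mB0.
have ent C (mu : probability (borel X) R) : measurable C -> 0 < m C < +oo ->
    (forall D, measurable D -> mu D = ((fine (m C))^-1)%:E * m (D `&` C)) ->
    entropy m mu < +oo.
  by move=> mC mC0 muE; rewrite (le_lt_trans (uniform_entropy_le mC mC0 muE))// ltry.
have f0 : finite_second_moment mu0.
  apply: (@bounded_second_moment _ A b d0) => // [|x Ax]; first exact: ltW.
  by rewrite metric_sym AB.
have f1 : finite_second_moment mu1.
  by apply: (@bounded_second_moment _ B a d0) => // [|x Bx]; [exact: ltW|rewrite AB].
have [mu_ [mu_0 mu_1 geo cd]] := cdX (conj f0 (ent A mu0 mA mA0 mu0E))
  (conj f1 (ent B mu1 mB mB0 mu1E)).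
have tle : (0 <= t <= 1)%R by rewrite !ltW.
have [[ft entt] UN] := cd t tle.
have muS : mu_ t S = 1.
  apply: (geodesic_concentrated sX mA mB mu0A mu1B f0 ft f1 t01 d_gt0).
  - rewrite -{1}mu_0 geo ?lexx ?ler01// sub0r normrN gtr0_norm//.
    by rewrite mu_0 mu_1.
  - rewrite -{1}mu_1 geo ?lexx ?ler01// ltr0_norm ?subr_lt0// opprB.
    by rewrite mu_0 mu_1.
have [mS0 entS] := entropy_ge mS muS mSy entt.
set v := fine (m S); set w := fine (m A).
have v0 : (0 < v)%R by rewrite fine_gt0// mS0.
have w0 : (0 < w)%R by rewrite fine_gt0.
have W01 : (0 <= W2 mu0 mu1 <= d0)%R.
  by rewrite W2_ge0/=; apply: (W2_le sX mA mB) => //; exact: ltW.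
have U0 : (expR (N^-1 * ln w))%:E <= U_N m N mu0.
  rewrite /U_N -[leLHS]/(expeR (N^-1 * ln w)%:E) lee_expeR leeNr -EFinN.
  rewrite -mulrN EFinM; apply: lee_wpmul2l; first by rewrite lee_fin invr_ge0 ltW.
  exact: uniform_entropy_le.
have Ut : U_N m N (mu_ t) <= (expR (N^-1 * ln v))%:E.
  rewrite /U_N -[leRHS]/(expeR (N^-1 * ln v)%:E) lee_expeR leeNl -EFinN.
  rewrite -mulrN EFinM; apply: lee_wpmul2l; first by rewrite lee_fin invr_ge0 ltW.
  exact: entS.
pose c : R := ((1 - e) * (1 - t))%R.
have c0 : (0 < c)%R by rewrite mulr_gt0// subr_gt0.
have cle : (c * expR (N^-1 * ln w) <= expR (N^-1 * ln v))%R.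
  rewrite -lee_fin EFinM; apply: le_trans Ut; apply: le_trans UN.
  have t'01 : (0 <= 1 - t <= 1)%R by rewrite subr_ge0 gerBl !ltW.
  have s0 : 0 <= sigma K N t (W2 mu0 mu1).
    apply: le_trans (sigmaE _ _ tle W01); rewrite lee_fin mulr_ge0 ?subr_ge0//;
      exact: ltW.
  (* The nonnegative term of [mu1] is dropped; the size of [B] therefore does not enter the bound,
     and [B] may later shrink to a point. *)
  apply: (@le_trans _ _ (sigma K N (1 - t) (W2 mu0 mu1) * U_N m N mu0)).
    apply: lee_pmul => //.
    - by rewrite lee_fin ltW.
    - exact: sigmaE.
  by rewrite leeDl// mule_ge0// expeR_ge0.
have Aw : m A = w%:E by rewrite fineK// ge0_fin_numE//; case/andP : mA0.
have Sv : m S = v%:E by rewrite fineK// ge0_fin_numE.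
rewrite Aw Sv -EFinM lee_fin.
rewrite -[X in (_ * X <= _)%R]lnK ?posrE// -[leRHS]lnK ?posrE//.
rewrite /powR gt_eqF// -expRD ler_expR.
move: cle; rewrite -[X in (X * _ <= _)%R]lnK ?posrE// -expRD ler_expR.
rewrite -(ler_pM2l N0) mulrDr !mulrA mulfV ?gt_eqF// !mul1r.
by [].
Qed.


Lemma mms_ball_gt0 (x : X) (r : R) : (0 < r)%R -> 0 < m (ball x r).
Proof.
move=> r0; have [_ _ _ supp] := mmsX.
have : [set: X] x by [].
by rewrite -supp; apply; split; [exact: mball_open|exact: ballxx].
Qed.

Lemma mms_small_ball (x : X) : exists2 r : R, (0 < r)%R & m (ball x r) < +oo.
Proof.
have [_ _ [lf _] _] := mmsX; have [U [oU Ux] mU] := lf x.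
have [r r0 rU] := open_sub_ball oU Ux; exists r => //.
apply: le_lt_trans mU; apply: le_measure; rewrite ?inE//; first exact: ball_borel.
exact: open_borel.
Qed.

Lemma le_ball_measure (x : X) (r s : R) : (r <= s)%R ->
  m (ball x r) <= m (ball x s).
Proof.
move=> rs; apply: le_measure; rewrite ?inE//; try exact: ball_borel.
exact: le_ball.
Qed.

Lemma mms_sigma_finite : sigma_finite setT m.
Proof.
have [f hf] := dense_sequence sX.
pose B (k : nat * nat) : set (borel X) :=
  if `[< m (ball (f k.1) k.2.+1%:R^-1) < +oo >]
  then ball (f k.1) k.2.+1%:R^-1 else set0.
have mB k : measurable (B k) /\ m (B k) < +oo.
  rewrite /B; case: ifPn => [/asboolP ?|_]; first by split => //; exact: ball_borel.
  by rewrite measure0.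
exists (fun n => if unpickle n is Some k then B k else set0); last first.
  by move=> n; case: unpickle => // ; rewrite measure0.
apply/seteqP; split => // x _; have [r r0 xr] := mms_small_ball x.
have [n nr] : exists n : nat, (n.+1%:R^-1 < r / 2)%R.
  by apply: inv_nat_lt; rewrite divr_gt0.
have n0 : (0 < n.+1%:R^-1 :> R)%R by rewrite invr_gt0.
have [a ha] := hf x _ n0.
exists (pickle (a, n)) => //=; rewrite pickleK /B/= ifT; first by rewrite ballEmdist.
apply/asboolP; apply: le_lt_trans xr; apply: le_measure; rewrite ?inE//.
- exact: ball_borel.
- exact: ball_borel.
move=> y; rewrite !ballEmdist/= => ay; rewrite (splitr r).
apply: le_lt_trans (metric_triangle _ (f a) _) _.
by rewrite ltrD// ?(metric_sym x); apply: lt_trans nr.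
Qed.

(* A target set of small positive measure stands in for the point y. *)
Lemma measure_contraction (e : R) : (0 < e < 1)%R -> exists2 d0 : R, (0 < d0)%R &
  forall (A : set X) (y : X) (t d : R), measurable (A : set (borel X)) ->
    (0 < t < 1)%R -> (0 < d)%R -> (forall x, A x -> (mdist x y <= d0)%R) ->
    ((((1 - e) * (1 - t)) `^ N)%R)%:E * m A <= m (near_intermediate t d A [set y]).
Proof.
move=> e01; have [d0 d00 BM] := brunn_minkowski_finite e01.
exists (d0 / 2)%R; first by rewrite divr_gt0.
move=> A y t d mA t01 d_gt0 Ay.
have [s s0 ys] := mms_small_ball y.
(* The three bounds serve finite measure of the target ball, a loss of at most 2 r <= d / 2 in the
   triangle inequalities that replace a point of the ball by [y], and diameter at most [d0]. *)
pose r : R := Num.min s (Num.min (d / 4) (d0 / 2))%R.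
have r0 : (0 < r)%R by rewrite !lt_min s0 !divr_gt0.
have [rs [rd rd0]] : (r <= s /\ r <= d / 4 /\ r <= d0 / 2)%R.
  by rewrite /r !ge_min !lexx !orbT.
have mSS : measurable (near_intermediate t d A [set y] : set (borel X)).
  by apply: open_borel; exact: open_near_intermediate.
have fin A' : measurable (A' : set (borel X)) -> m A' < +oo -> A' `<=` A ->
    ((((1 - e) * (1 - t)) `^ N)%R)%:E * m A' <= m (near_intermediate t d A [set y]).
  move=> mA' A'y A'A; have [->|A'0] := eqVneq (m A') 0; first by rewrite mule0.
  apply: (@le_trans _ _ (m (near_intermediate t (d / 2) A' (ball y r)))).
    apply: BM => //; first exact: ball_borel.
    - by rewrite lt0e A'0 measure_ge0.
    - by rewrite mms_ball_gt0//= (le_lt_trans (le_ball_measure _ rs)).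
    - by rewrite divr_gt0.
    - move=> x z /A'A/Ay xy; rewrite ballEmdist/= => yz.
      by have := metric_triangle x y z; lra.
  apply: le_measure; rewrite ?inE//.
    by apply: open_borel; exact: open_near_intermediate.
  move=> z [x [y' [A'x]]]; rewrite ballEmdist/= => yy' xz zy'.
  exists x, y; split => //; first exact: A'A.
    have := metric_triangle x y y'; case/andP : t01 => t0 t1 h.
    have : (t * mdist x y' <= t * (mdist x y + mdist y y'))%R by rewrite ler_pM2l.
    have : (t * mdist y y' <= mdist y y')%R.
      by rewrite ler_piMl ?mdist_ge0// ltW.
    by lra.
  have := metric_triangle z y' y; rewrite (metric_sym y' y).
  have := metric_triangle x y y'; case/andP : t01 => t0 t1 h.
  have : ((1 - t) * mdist x y' <= (1 - t) * (mdist x y + mdist y y'))%R.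
    by rewrite ler_pM2l// subr_gt0.
  have : (0 <= t * mdist y y')%R by rewrite mulr_ge0 ?mdist_ge0// ltW.
  by lra.
(* [A] may have infinite measure, so it is exhausted by pieces on which a uniform probability
   exists. *)
have /sigma_finiteP[F [TF ndF mF]] := mms_sigma_finite.
have AF : A = \bigcup_n (A `&` F n) by rewrite -setI_bigcupr -TF setIT.
have cvA : (m \o (fun n => A `&` F n)) x @[x --> \oo] --> m A.
  rewrite [in m A]AF; apply: nondecreasing_cvg_mu.
  - by move=> n; apply: measurableI => //; have [] := mF n.
  - by rewrite -AF.
  - by move=> n k /ndF/subsetPset nk; apply/subsetPset; exact: setIS.
have cfin : ((((1 - e) * (1 - t)) `^ N)%R)%:E \is a fin_num by [].
apply: (cvge_to_le (cvgeZl cfin cvA)).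
apply: nearW => n /=; apply: fin.
- by apply: measurableI => //; have [] := mF n.
- have [mFn mFy] := mF n; apply: le_lt_trans mFy.
  by apply: le_measure; rewrite ?inE//; exact: measurableI.
- exact: subIsetl.
Qed.

(** Contract the ball towards its own centre with t = 1 - k/2 and slack k r / 2: the image lies
    within k r / 2 + k r / 2 of the centre. *)
Lemma ball_doubling : exists2 r0 : R, (0 < r0)%R &
  (forall (x : X) (r : R), (r <= r0)%R -> m (ball x r) < +oo) /\
  forall k : R, (0 < k < 1)%R -> exists2 c : R, (0 < c)%R &
    forall (x : X) (r : R), (0 < r <= r0)%R ->
      c%:E * m (ball x r) <= m (ball x (k * r)%R).
Proof.
have e01 : (0 < (2^-1 : R) < 1)%R by apply/andP; split; lra.
have [r0 r00 con] := measure_contraction e01.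
have doub (k : R) : (0 < k < 1)%R -> exists2 c : R, (0 < c)%R &
    forall (x : X) (r : R), (0 < r <= r0)%R ->
      c%:E * m (ball x r) <= m (ball x (k * r)%R).
  move=> /andP[k0 k1].
  exists (((1 - 2^-1) * (1 - (1 - k / 2))) `^ N)%R.
    by rewrite powR_gt0// mulr_gt0//; lra.
  move=> x r /andP[r_gt0 rr0].
  apply: (@le_trans _ _ (m (near_intermediate (1 - k / 2) (k * r / 2)
      (ball x r) [set x]))).
    apply: con; first exact: ball_borel.
    - by apply/andP; split; lra.
    - by rewrite divr_gt0// mulr_gt0.
    - by move=> y; rewrite ballEmdist/= metric_sym => /ltW xy; exact: le_trans rr0.
  apply: le_measure; rewrite ?inE; [|exact: ball_borel|].
    by apply: open_borel; exact: open_near_intermediate.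
  move=> z [y [_ [+ -> _]]]; rewrite !ballEmdist/= => xy.
  rewrite metric_sym (metric_sym y).
  have : (k / 2 * mdist x y < k / 2 * r)%R by rewrite ltr_pM2l// divr_gt0.
  by lra.
exists r0 => //; split => // x r rr0.
(* A ball of infinite measure would, by doubling, make the ball of radius [s] infinite too. *)
have [s s0 xs] := mms_small_ball x.
have [rs|sr] := leP r s; first exact: le_lt_trans (le_ball_measure _ rs) xs.
have r_gt0 : (0 < r)%R by exact: lt_trans sr.
have k01 : (0 < s / r < 1)%R by rewrite divr_gt0//= ltr_pdivrMr// mul1r.
have [c c0 /(_ x r)] := doub _ k01; rewrite r_gt0 rr0 divfK ?gt_eqF//.
move=> /(_ isT) H; rewrite ltNge leye_eq; apply/negP => /eqP xr.
by move: H; rewrite xr gt0_muley ?lte_fin// leye_eq => /eqP h; rewrite h in xs.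
Qed.

End brunn_minkowski.

(** * The Borel measure induced by a content on compact sets *)

Section content_measure.
Context {R : realType} {T : completeMetricType R}.
Variable kap : set T -> \bar R.
Local Open Scope ereal_scope.
Hypotheses (kap_ge0 : forall C, 0 <= kap C) (kap0 : kap set0 = 0)
  (kapU : forall C D, compact C -> compact D -> kap (C `|` D) <= kap C + kap D)
  (kap_disjoint : forall C D, compact C -> compact D -> C `&` D = set0 ->
    kap C + kap D <= kap (C `|` D)).

Definition inner_content (U : set T) : \bar R :=
  ereal_sup [set kap C | C in [set C | compact C /\ C `<=` U]].

(** The classical passage from a content to an outer measure: inner approximation by compact sets on
    open sets, then outer approximation by open sets. *)
Definition content_outer (A : set T) : \bar R :=
  ereal_inf [set inner_content U | U in [set U | open U /\ A `<=` U]].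

Local Notation lam := inner_content.
Local Notation mu := content_outer.

Let lam_ub (C U : set T) : compact C -> C `<=` U -> kap C <= lam U.
Proof. by move=> cC CU; apply: ereal_sup_ubound; exists C. Qed.

Let lam_ge0 U : 0 <= lam U.
Proof. by apply: le_trans (lam_ub compact0 _); rewrite ?kap0. Qed.

Let lam_le U V : U `<=` V -> lam U <= lam V.
Proof.
move=> UV; apply: ge_ereal_sup => _ [C [cC CU] <-].
by apply: lam_ub => //; exact: subset_trans UV.
Qed.

Let mu_lb (A U : set T) : open U -> A `<=` U -> mu A <= lam U.
Proof. by move=> oU AU; apply: ereal_inf_lbound; exists U. Qed.

Let mu_open U : open U -> mu U = lam U.
Proof.
move=> oU; apply/eqP; rewrite eq_le mu_lb//=.
by apply: le_ereal_inf_tmp => _ [V [oV UV] <-]; exact: lam_le.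
Qed.

Let mu_ge0 A : 0 <= mu A.
Proof. by apply: le_ereal_inf_tmp => _ [U _ <-]. Qed.

Let mu0 : mu set0 = 0.
Proof.
rewrite mu_open; last exact: open0.
apply/eqP; rewrite eq_le lam_ge0 andbT.
by apply: ge_ereal_sup => _ [C [_ C0] <-]; move: C0; rewrite subset0 => ->; rewrite kap0.
Qed.

Let compactD (C U : set T) : compact C -> open U -> compact (C `\` U).
Proof.
move=> cC oU; apply: (subclosed_compact _ cC) => //.
rewrite setDE; apply: closedI; last exact: open_closedC.
by apply: compact_closed => //; exact: metric_hausdorff.
Qed.

Let closed_compact (C : set T) : compact C -> closed C.
Proof. by apply: compact_closed; exact: metric_hausdorff. Qed.

(** Induction on [n]. The parts of [C] outside the last open set and outside the union of the others
    are disjoint compact sets; removing disjoint open neighbourhoods of them splits [C] into two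
    compact pieces, one in each. *)
Let kap_cover n (U : (set T)^nat) C : (forall i, open (U i)) -> compact C ->
  C `<=` [set x | exists2 i, (i < n)%N & U i x] ->
  kap C <= \sum_(0 <= i < n) lam (U i).
Proof.
move=> oU; elim: n C => [|n ih] C cC CU.
  by rewrite big_nil (_ : C = set0) ?kap0// -subset0 => x /CU[].
rewrite big_nat_recr//=.
pose W : set T := [set x | exists2 i, (i < n)%N & U i x].
have oW : open W.
  rewrite (_ : W = \bigcup_(i in `I_n) U i); first exact: bigcup_open.
  by apply/seteqP; split => x [i ? ?]; exists i.
have CUW : (C `\` U n) `&` (C `\` W) = set0.
  rewrite -subset0 => x [[Cx nUx] [_ nWx]]; have [i] := CU x Cx.
  rewrite ltnS leq_eqVlt => /orP[/eqP-> //|ni Uix].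
  by apply: nWx; exists i.
have [V [V' [oV oV' CUV CWV VV']]] := (@normal_openP R T).1
  (@pseudometric_normal R T) _ _ (closed_compact (compactD cC (oU n)))
  (closed_compact (compactD cC oW)) CUW.
have -> : C = (C `\` V) `|` (C `\` V').
  by rewrite -setDIr VV' setD0.
apply: le_trans (kapU (compactD cC oV) (compactD cC oV')) _.
rewrite addeC; apply: leeD.
  apply: ih => [|x [Cx nV'x]]; first exact: compactD.
  by apply: contrapT => nW; apply: nV'x; exact: CWV.
apply: lam_ub => [|x [Cx nVx]]; first exact: compactD.
by apply: contrapT => nU; apply: nVx; exact: CUV.
Qed.

Let lam_bigcup (U : (set T)^nat) : (forall i, open (U i)) ->
  lam (\bigcup_i U i) <= \sum_(i <oo) lam (U i).
Proof.
move=> oU; apply: ge_ereal_sup => _ [C [cC CU] <-].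
have := cC; rewrite compact_cover => /(_ _ setT U (fun i _ => oU i) CU)[D' _ CD'].
pose n := (\max_(i <- finmap.enum_fset D') i).+1.
apply: (@le_trans _ _ (\sum_(0 <= i < n) lam (U i))).
  apply: kap_cover => // x /CD'[i /= iD' Uix]; exists i => //.
  by rewrite /n ltnS; exact: (@leq_bigmax_seq _ _ xpredT (fun j => j) i iD' isT).
exact: nneseries_lim_ge.
Qed.

Let mu_sigma_subadditive : sigma_subadditive mu.
Proof.
move=> A; have [|Ay] := leP +oo (\sum_(i <oo) mu (A i)).
  by rewrite leye_eq => /eqP ->; exact: leey.
apply/lee_addgt0Pr => e e0.
have Afin i : mu (A i) \is a fin_num.
  rewrite ge0_fin_numE//; apply: le_lt_trans Ay.
  by rewrite (@nneseriesD1 _ _ i)// leeDl// nneseries_ge0.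
have ei i : (0 < e / (2 ^ i.+1)%:R)%R by rewrite divr_gt0// ltr0n expn_gt0.
have /choice[U HU] : forall i, exists U, [/\ open U, A i `<=` U &
    lam U <= mu (A i) + (e / (2 ^ i.+1)%:R)%:E].
  move=> i; have [_ [U [oU AU] <-] /ltW] := lb_ereal_inf_adherent (ei i) (Afin i).
  by exists U.
have oU i : open (U i) by have [] := HU i.
apply: (@le_trans _ _ (\sum_(i <oo) lam (U i))).
  apply: le_trans (lam_bigcup oU); apply: mu_lb.
    exact: bigcup_open.
  by apply: subset_bigcup => i _; have [] := HU i.
apply: (@le_trans _ _ (\sum_(i <oo) (mu (A i) + (e / (2 ^ i.+1)%:R)%:E))).
  by apply: lee_nneseries => // i _; have [] := HU i.
exact: epsilon_trick (ltW e0).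
Qed.

Let mu_le : {homo mu : A B / A `<=` B >-> A <= B}.
Proof.
move=> A B AB; apply: le_ereal_inf_tmp => _ [U [oU BU] <-].
by apply: mu_lb => //; exact: subset_trans BU.
Qed.

Let om : {outer_measure set T -> \bar R} := HB.pack content_outer
  (isOuterMeasure.Build R T content_outer mu0 mu_ge0 mu_le mu_sigma_subadditive).

(** For open [V], take a compact C in V [&] U almost exhausting its content. Any compact subset of
    the complement of C in V is disjoint from C, so superadditivity of [kap] on disjoint compact
    sets gives the splitting. *)
Let open_caratheodory (U : set T) : open U -> om.-caratheodory U.
Proof.
move=> oU; apply: le_caratheodory_measurable => A.
rewrite -[leLHS]/(mu (A `&` U) + mu (A `&` ~` U)) -[leRHS]/(mu A).
apply: le_ereal_inf_tmp => _ [V [oV AV] <-].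
apply: (@le_trans _ _ (lam (V `&` U) + mu (V `&` ~` U))).
  apply: leeD; last by apply: mu_le; exact: setSI.
  by apply: mu_lb; [exact: openI|exact: setSI].
have [|Vy] := leP +oo (lam V); first by rewrite leye_eq => /eqP ->; exact: leey.
have VUf : lam (V `&` U) \is a fin_num.
  rewrite ge0_fin_numE//; apply: le_lt_trans Vy; apply: lam_le; exact: subIsetl.
apply/lee_addgt0Pr => e e0.
have [_ [C [cC CVU] <-] /ltW hC] := ub_ereal_sup_adherent e0 VUf.
rewrite leeBlDr// in hC.
apply: (@le_trans _ _ (kap C + e%:E + mu (V `&` ~` U))); first exact: leeD2r.
rewrite addeAC; apply: leeD2r.
have cCf : kap C \is a fin_num.
  rewrite ge0_fin_numE//; apply: le_lt_trans Vy; apply: lam_ub => //.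
  by apply: subset_trans CVU _; exact: subIsetl.
have oVC : open (V `\` C).
  by rewrite setDE; apply: openI => //; apply: closed_openC; exact: closed_compact.
apply: (@le_trans _ _ (kap C + lam (V `\` C))).
  apply: leeD2l; apply: mu_lb => // x [Vx nUx]; split => // Cx.
  by have [] := CVU x Cx.
rewrite addeC -leeBrDr//; apply: ge_ereal_sup => _ [D [cD DVC] <-].
rewrite leeBrDr// addeC; apply: le_trans (kap_disjoint cC cD _) _.
  by rewrite -subset0 => x [Cx /DVC[]].
apply: lam_ub; first exact: compactU.
by move=> x [/CVU[]//|/DVC[]].
Qed.

(** On compact sets only an inequality is available, since a content may fail to be outer regular
    there. *)
Lemma content_measure_exists : exists m : {measure set (borel T) -> \bar R},
  [/\ forall U, open U -> m U = inner_content U,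
      forall A, m A = ereal_inf [set m U | U in [set U | open U /\ A `<=` U]] &
      forall C, compact C -> kap C <= m C].
Proof.
have mid : measurable_fun setT (id : caratheodory_type om -> borel T).
  refine (@measurability _ _ (caratheodory_type om) (borel T) setT id (@open T) erefl _).
  by move=> _ [V oV <-]; rewrite setTI; exact: open_caratheodory.
pose m : {measure set (borel T) -> \bar R} :=
  image_measure (om : {measure set (caratheodory_type om) -> \bar R}) mid.
have mE A : m A = mu A by [].
exists m; split => [U oU|A|C cC]; first by rewrite mE mu_open.
- rewrite mE /content_outer; congr ereal_inf.
  by apply/seteqP; split => _ [U [oU AU] <-]; exists U => //; rewrite mE mu_open.
- rewrite mE; apply: le_ereal_inf_tmp => _ [U [oU CU] <-]; exact: lam_ub.
Qed.

End content_measure.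

(** * Diagonal extraction *)

Section extraction.
Context {R : realType}.

(** Limits along an ultrafilter finer than [\oo] treat all indices at once. Finitely many
    approximations hold on a member of the ultrafilter, which meets every tail; so [phi K] can be
    taken beyond K and accurate to 1/(K + 1) at the indices of code below K. [phi] need not
    increase: [n <= phi n] is what [near_subseq] uses. *)
Lemma diagonal_extraction (I : countType) (a : nat -> I -> R) :
  (forall t, exists M, forall n, `|a n t| <= M) ->
  exists phi : nat -> nat, exists L : I -> R, (forall n, (n <= phi n)%N) /\
    forall t, a (phi n) t @[n --> \oo] --> L t.
Proof.
move=> abd.
have [U [UU oU]] := @ultraFilterLemma _ (nbhs (\oo : set_system nat)) _.
have lim_a t : exists l : R, forall e : R, 0 < e -> U [set n | `|l - a n t| < e].
  have [M aM] := abd t.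
  have aF : ProperFilter (a^~ t @ U) by exact: fmap_proper_filter.
  have [|l [_ lc]] := @segment_compact R (- M) M _ aF.
    apply: (@filterS _ U _ setT); last exact: filterT.
    by move=> n _ /=; rewrite in_itv/= -ler_norml.
  exists l => e e0.
  have [//|Ue] := in_ultra_setVsetC [set n | `|l - a n t| < e] UU.
  have [x [] ] := lc (~` [set x | `|l - x| < e]) (ball l e) Ue (nbhsx_ballx l e e0).
  by move=> h1 h2; exfalso; exact: h1 h2.
have /choice[L hL] := lim_a.
have key K : exists n, (K <= n)%N /\
    forall j t, (j < K)%N -> unpickle j = Some t -> `|L t - a n t| < K.+1%:R^-1.
  have e0 : (0 : R) < K.+1%:R^-1 by rewrite invr_gt0.
  have UK : U [set n | (K <= n)%N] by apply: oU; exists K.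
  have UJ J : U [set n | forall j t, (j < J)%N -> unpickle j = Some t ->
      `|L t - a n t| < K.+1%:R^-1].
    elim: J => [|J ih]; first by apply: filterS filterT => n _ j t.
    case E : (unpickle J : option I) => [t|].
      apply: filterS2 ih (hL t _ e0) => n H H' j s.
      rewrite ltnS leq_eqVlt => /orP[/eqP -> |]; last exact: H.
      by rewrite E => -[<-].
    apply: filterS ih => n H j s.
    rewrite ltnS leq_eqVlt => /orP[/eqP -> |]; last exact: H.
    by rewrite E.
  have [n [h1 h2]] := filter_ex (filterI UK (UJ K)).
  by exists n.
have /choice[phi hphi] := key; exists phi, L; split => [n|t].
  by have [] := hphi n.
apply/cvgrPdist_lt => e e0; have [k ke] := inv_nat_lt e0.
exists (maxn k (pickle t).+1) => // n /=; rewrite geq_max => /andP[kn tn].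
have [_ /(_ (pickle t) t tn (pickleK t)) H] := hphi n.
apply: lt_trans H _; apply: le_lt_trans ke.
by rewrite lef_pV2 ?posrE// ler_nat.
Qed.

Lemma near_subseq (P : nat -> Prop) (phi : nat -> nat) :
  (forall n, (n <= phi n)%N) -> (\forall n \near \oo, P n) ->
  \forall n \near \oo, P (phi n).
Proof.
move=> phin [n _ nP]; exists n => // k nk; apply: nP => /=.
exact: leq_trans (phin k).
Qed.

End extraction.

(** * Uniform mass bounds for the blow-ups *)

Section blowup_estimates.
Context {R : realType} {X : completeMetricType R}.
Variables (m : {measure set (borel X) -> \bar R}) (K N : R).
Hypotheses (N1 : 1 <= N) (mmsX : is_mms m) (cdX : CDe m K N).
Variable P : X.
Local Open Scope ereal_scope.
Implicit Type l : {posnum R}.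

Lemma blowup_measurable (Z : completeMetricType R) (l : R) (f : X -> Z) :
  (forall x y, mdist (f x) (f y) = l * mdist x y)%R ->
  measurable_fun setT (f : borel X -> borel Z).
Proof.
move=> fl; apply: continuous_borel => x.
apply/metricType_numDomainType.cvgrPdist_lt => e e0.
apply/(@metricType_numDomainType.nbhs_mdistP R X).
exists (e / (`|l| + 1))%R => /=; first by rewrite divr_gt0// ltr_wpDl.
move=> y /=; rewrite ltr_pdivlMr ?ltr_wpDl// => xy; rewrite fl.
apply: le_lt_trans xy; rewrite mulrC ler_wpM2l ?mdist_ge0//.
by apply: le_trans (ler_norm l) _; rewrite lerDl.
Qed.

Let tent l (x : borel X) : R := (1 - l%:num * mdist P (x : X))%R.

Let mtent l : measurable_fun setT (tent l).
Proof.
apply: measurable_funB => //; apply: measurable_funM => //.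
by apply: continuous_borel_real; exact: mdist_continuous.
Qed.

Let tent_ge0 l x : ball P (l%:num^-1) x -> (0 <= tent l x)%R.
Proof.
rewrite ballEmdist/= => xP; rewrite subr_ge0 mulrC -ler_pdivlMr//.
by rewrite mul1r ltW.
Qed.

(** The normalizing tent is at most 1 on its ball and at least 1/2 on the concentric ball of half
    the radius. These two bounds are the anchors from which doubling propagates. *)
Lemma normalization_tent l : m (ball P (l%:num^-1)) < +oo ->
  [/\ 1 <= normalized_measure m P l (ball P l%:num^-1),
      normalized_measure m P l (ball P (2^-1 / l%:num)) <= 2%R%:E &
      \int[normalized_measure m P l]_(x in ball P l%:num^-1)
         (1 - l%:num * mdist P (x : X))%:E = 1].
Proof.
move=> mB; have l0 : (0 < l%:num)%R by [].
set B := ball P l%:num^-1 in mB *.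
have mBB : measurable (B : set (borel X)) by exact: ball_borel.
pose I := \int[m]_(x in B) (tent l x)%:E.
have mtB : measurable_fun (B : set (borel X)) (fun x => (tent l x)%:E).
  by apply/measurable_EFinP; exact: measurable_funTS.
have I0 : 0 <= I by apply: integral_ge0 => x /tent_ge0; rewrite lee_fin.
have IB : I <= m B.
  rewrite -[leRHS]mul1e -integral_cst//; apply: ge0_le_integral => //.
  - by move=> x /tent_ge0; rewrite lee_fin.
  - by move=> x _; rewrite lee_fin /tent gerBl mulr_ge0// mdist_ge0.
set B2 := ball P (2^-1 / l%:num).
have mB2 : measurable (B2 : set (borel X)) by exact: ball_borel.
have B2B : B2 `<=` B.
  by apply: le_ball; rewrite ler_piMl ?invr_ge0 ?ltW// invf_lt1 ?ltr1n.
have IB2 : (2^-1)%:E * m B2 <= I.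
  apply: (@le_trans _ _ (\int[m]_(x in B2) (tent l x)%:E)).
    rewrite -integral_cst//; apply: ge0_le_integral => //.
    - by move=> x /B2B/tent_ge0; rewrite lee_fin.
    - exact: measurable_funS mtB.
    - move=> x; rewrite /B2 ballEmdist/= ltr_pdivlMr// => xP.
      by rewrite lee_fin /tent mulrC; lra.
  by apply: ge0_subset_integral => // x /tent_ge0; rewrite lee_fin.
have If : I \is a fin_num by rewrite ge0_fin_numE// (le_lt_trans IB).
have Ip : (0 < fine I)%R.
  rewrite fine_gt0// (le_lt_trans IB)// andbT; apply: lt_le_trans IB2.
  apply: mule_gt0; first by rewrite lte_fin invr_gt0.
  by apply: (mms_ball_gt0 mmsX); rewrite divr_gt0.
have nE (A : set (borel X)) : normalized_measure m P l A = ((fine I)^-1)%:E * m A.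
  by [].
split.
- rewrite nE -(@lee_pmul2l _ (fine I)%:E) ?lte_fin//.
  by rewrite mule1 muleA -EFinM mulfV ?gt_eqF// mul1e fineK.
- rewrite nE -(@lee_pmul2l _ (fine I)%:E) ?lte_fin//.
  rewrite muleA -EFinM mulfV ?gt_eqF// mul1e -(@lee_pmul2l _ (2^-1)%:E) ?lte_fin ?invr_gt0//.
  apply: le_trans IB2 _; rewrite -[leRHS]/((2^-1 * (fine I * 2))%R%:E).
  by rewrite mulrCA mulVf// mulr1 fineK.
- rewrite ge0_integral_mscale//; last by move=> x /tent_ge0; rewrite lee_fin.
  rewrite -[X in _ * X]/I -[X in _ * X]fineK// -EFinM mulVf//.
  by rewrite gt_eqF.
Qed.

Lemma blowup_upper (rho : R) : exists C : R, exists2 l0 : R, (0 < l0)%R &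
  forall l, (l0 <= l%:num)%R ->
    normalized_measure m P l (ball P (rho / l%:num)) <= C%:E.
Proof.
have [r0 r00 [fin doub]] := ball_doubling N1 mmsX cdX.
(* Doubling goes from radius r/l down to 1/(2 l), where the mass is at most 2; the maximum keeps the
   ratio 1/(2 r) below 1. *)
pose r := Num.max rho 1%R.
have r1 : (1 <= r)%R by rewrite le_max lexx orbT.
have rr : (rho <= r)%R by rewrite le_max lexx.
have rp : (0 < r)%R by apply: lt_le_trans r1.
have [c c0 hc] := doub ((2 * r)^-1)%R ltac:(
  by rewrite invr_gt0 mulr_gt0// invf_lt1 ?mulr_gt0//; lra).
exists (2 / c)%R, (r / r0)%R; first by rewrite divr_gt0.
move=> l; rewrite ler_pdivrMr// mulrC -ler_pdivrMr// => rl.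
have rl0 : (0 < r / l%:num)%R by rewrite divr_gt0.
have [|_ h _] := @normalization_tent l.
  by apply: fin; apply: le_trans rl; rewrite ler_peMl// invr_ge0.
have := hc P (r / l%:num)%R; rewrite rl0 rl => /(_ isT).
have -> : ((2 * r)^-1 * (r / l%:num) = 2^-1 / l%:num)%R.
  by field; rewrite !gt_eqF.
move=> H; have cV0 : (0 < c^-1)%R by rewrite invr_gt0.
have nf0 := normalization_factor_ge0 m P l.
apply: (@le_trans _ _ ((c^-1)%:E * (normalized_measure m P l (ball P (2^-1 / l%:num))))).
  rewrite -[X in _ <= _ * X]/((normalization_factor m P l)%:E * m _).
  rewrite -[leLHS]/((normalization_factor m P l)%:E * m _).
  rewrite muleCA; apply: lee_wpmul2l; first by rewrite lee_fin.
  rewrite -(@lee_pmul2l _ c%:E) ?lte_fin// muleA -EFinM mulfV ?gt_eqF// mul1e.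
  apply: le_trans H; apply: lee_wpmul2l; first by rewrite lee_fin ltW.
  by apply: le_ball_measure; rewrite ler_wpM2r// invr_ge0.
rewrite [(2 / c)%R]mulrC -[leRHS]/((c^-1)%:E * 2%R%:E).
by apply: lee_wpmul2l => //; rewrite lee_fin ltW.
Qed.

Lemma blowup_lower (rho s : R) : (0 <= rho)%R -> (0 < s)%R ->
  exists2 c : R, (0 < c)%R & exists2 l0 : R, (0 < l0)%R &
  forall l x, (l0 <= l%:num)%R -> (mdist P x <= rho / l%:num)%R ->
    c%:E <= normalized_measure m P l (ball x (s / l%:num)).
Proof.
move=> rho0 s0; have [r0 r00 [fin doub]] := ball_doubling N1 mmsX cdX.
(* The ball of radius r/l about [x] contains the one of radius 1/l about [P], of mass at least 1;
   the summand [s] makes the ratio s/r smaller than 1. *)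
pose r := (rho + 1 + s)%R; have rp : (0 < r)%R by rewrite /r; lra.
have [c c0 hc] := doub (s / r)%R ltac:(
  by rewrite divr_gt0//= ltr_pdivrMr// mul1r /r; lra).
exists c => //; exists (r / r0)%R; first by rewrite divr_gt0.
move=> l x; rewrite ler_pdivrMr// mulrC -ler_pdivrMr// => rl Px.
have rl0 : (0 < r / l%:num)%R by rewrite divr_gt0.
have lV : (0 < l%:num^-1)%R by rewrite invr_gt0.
have [|h _ _] := @normalization_tent l.
  apply: fin; apply: le_trans rl; rewrite ler_peMl// /r; lra.
have := hc x (r / l%:num)%R; rewrite rl0 rl => /(_ isT).
have -> : (s / r * (r / l%:num) = s / l%:num)%R by field; rewrite !gt_eqF.
move=> H; have nf0 := normalization_factor_ge0 m P l.
apply: (@le_trans _ _ (c%:E * normalized_measure m P l (ball x (r / l%:num)))).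
  rewrite -[leLHS]mule1; apply: lee_wpmul2l; first by rewrite lee_fin ltW.
  apply: le_trans h _; apply: le_measure; rewrite ?inE; try exact: ball_borel.
  move=> y; rewrite !ballEmdist/= => Py.
  apply: le_lt_trans (metric_triangle _ P _) _; rewrite (metric_sym x).
  have : (0 < s / l%:num)%R by rewrite divr_gt0.
  by rewrite /r !mulrDl mul1r; lra.
rewrite -[leRHS]/((normalization_factor m P l)%:E * m _).
rewrite -[X in _ * X <= _]/((normalization_factor m P l)%:E * m _).
by rewrite muleCA; apply: lee_wpmul2l => //; rewrite lee_fin.
Qed.

End blowup_estimates.

(** * Weak convergence from bounds on open and closed sets *)

Section portmanteau.
Context {R : realType} {Z : completeMetricType R}.
Variables (nu : nat -> {measure set (borel Z) -> \bar R})
  (mu : {measure set (borel Z) -> \bar R}).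

Lemma cvg_ereal_approx (u : nat -> \bar R) (x : R) :
  (forall e : R, 0 < e ->
    \forall n \near \oo, ((x - e)%:E <= u n)%E /\ (u n <= (x + e)%:E)%E) ->
  u n @[n --> \oo] --> x%:E.
Proof.
move=> H; apply/fine_cvgP; split.
  have := H 1 ltr01; apply: filterS => n [h1 h2].
  by rewrite fin_numElt (lt_le_trans _ h1) ?ltNyr//= (le_lt_trans h2)// ltry.
apply/cvgrPdist_le => e e0; have := H e e0; apply: filterS => n /=.
case: (u n) => [r||] [] //=; rewrite ?lee_fin// => h1 h2.
by rewrite ler_distl; apply/andP; split; lra.
Qed.

(* A step function with values in h * nat below v, at distance at most h. *)
Lemma staircase_bounds (h v : R) (b : nat -> bool) (n : nat) : 0 < h -> 0 <= v ->
  (forall k, k.+1%:R * h < v -> b k) -> (forall k, b k -> k.+1%:R * h <= v) ->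
  \sum_(0 <= k < n) h * (b k)%:R <= v /\
  Num.min (v - h) (n%:R * h) <= \sum_(0 <= k < n) h * (b k)%:R.
Proof.
move=> h0 v0 b1 b2.
suff [H1 [H2 H3]] : \sum_(0 <= k < n) h * (b k)%:R <= v /\
   \sum_(0 <= k < n) h * (b k)%:R <= n%:R * h /\
   Num.min (v - h) (n%:R * h) <= \sum_(0 <= k < n) h * (b k)%:R by [].
elim: n => [|n [ih1 [ih2 ih3]]].
  by rewrite big_nil mul0r; split => //; split => //; rewrite ge_min lexx orbT.
rewrite big_nat_recr//=; have nE : n.+1%:R * h = n%:R * h + h.
  by rewrite -addn1 natrD mulrDl mul1r.
move: ih3; case E : (b n).
  have := b2 _ E; rewrite nE mulr1 => h1 h2.
  have : n%:R * h <= \sum_(0 <= k < n) h * (b k)%:R.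
    by apply: le_trans h2; rewrite le_min lexx andbT; lra.
  move=> h3; split; [by lra|split; first by lra].
  by rewrite ge_min; apply/orP; right; lra.
have /negP := E; rewrite mulr0 addr0 => nb h2.
have vn : v <= n.+1%:R * h by rewrite leNgt; apply/negP => /b1; rewrite E.
split => //; split; first by rewrite nE; lra.
move: h2; rewrite ge_min => /orP[h2|h2]; rewrite ge_min; apply/orP; left => //.
by rewrite nE in vn; lra.
Qed.

Hypothesis mu_fin : forall z r, (mu (ball z r) < +oo)%E.
Hypothesis mu_open : forall O (a : R), open O -> (a%:E < mu O)%E ->
  \forall n \near \oo, (a%:E < nu n O)%E.
Hypothesis mu_closed : forall F (a : R) z r, closed F -> F `<=` ball z r ->
  (mu F < a%:E)%E -> \forall n \near \oo, (nu n F < a%:E)%E.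

Lemma near_all_lt (P : nat -> nat -> Prop) (M : nat) :
  (forall k, \forall n \near \oo, P k n) ->
  \forall n \near \oo, forall k, (k < M)%N -> P k n.
Proof.
move=> H; elim: M => [|M ih]; first by near=> n.
apply: filterS2 ih (H M) => n h1 h2 k; rewrite ltnS leq_eqVlt.
by move=> /orP[/eqP -> //|]; exact: h1.
Unshelve. all: by end_near. Qed.

Lemma integral_staircase (rho : {measure set (borel Z) -> \bar R}) (h : R)
    (A : nat -> set Z) (M : nat) : 0 <= h ->
  (forall k, measurable (A k : set (borel Z))) ->
  (\int[rho]_z (\sum_(0 <= k < M) h * \1_(A k) z)%:E =
   \sum_(0 <= k < M) h%:E * rho (A k))%E.
Proof.
move=> h0 mA; under eq_integral do rewrite -sumEFin.
rewrite ge0_integral_sum//; last 2 first.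
- by move=> k; apply/measurable_EFinP; exact: measurable_funM.
- by move=> k z _; rewrite lee_fin mulr_ge0.
apply: eq_bigr => k _; under eq_integral do rewrite EFinM.
by rewrite ge0_integralZl//; [rewrite integral_indic// setIT|exact/measurable_EFinP].
Qed.

(** The function is squeezed between staircases over its superlevel sets: the open ones {phi > c}
    control the liminf, the closed ones {phi >= c} the limsup. *)
Lemma cvg_integral_ge0 (phi : Z -> R) (M : R) (z : Z) (r : R) : continuous phi ->
  (forall x, 0 <= phi x <= M) -> (forall x, phi x != 0 -> ball z r x) ->
  (\int[mu]_x (phi x)%:E)%E \is a fin_num /\
  (\int[nu n]_x (phi x)%:E @[n --> \oo] --> \int[mu]_x (phi x)%:E)%E.
Proof.
move=> cphi phi01 phiB; set I := (\int[mu]_x (phi x)%:E)%E.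
have phi0 x : 0 <= phi x by have /andP[] := phi01 x.
have phiM x : phi x <= M by have /andP[] := phi01 x.
have M0 : 0 <= M by apply: le_trans (phiM z).
have mphi : measurable_fun setT (phi : borel Z -> R) by exact: continuous_borel_real.
have mB : measurable (ball z r : set (borel Z)) by exact: ball_borel.
have Ile (rho : {measure set (borel Z) -> \bar R}) (f : borel Z -> R) :
    measurable_fun setT f -> (forall x, phi x <= f x) ->
    (\int[rho]_x (phi x)%:E <= \int[rho]_x (f x)%:E)%E.
  move=> mf pf; apply: ge0_le_integral => //.
  - by move=> x _; rewrite lee_fin.
  - exact/measurable_EFinP.
  - exact/measurable_EFinP.
  - by move=> x _; rewrite lee_fin.
have muBf : mu (ball z r) \is a fin_num by rewrite ge0_fin_numE.
have If : I \is a fin_num.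
  rewrite ge0_fin_numE; last by apply: integral_ge0 => x _; rewrite lee_fin.
  apply: le_lt_trans (_ : (\int[mu]_x (M * \1_(ball z r) x)%:E < +oo)%E).
    apply: Ile; first exact: measurable_funM.
    move=> x; rewrite indicE; have [->|xn0] := eqVneq (phi x) 0.
      by rewrite mulr_ge0.
    by rewrite mem_set ?mulr1//; exact: phiB.
  under eq_integral do rewrite EFinM.
  rewrite ge0_integralZl//; last exact/measurable_EFinP.
  by rewrite integral_indic// setIT lte_mul_pinfty.
split => //; rewrite -(fineK If); apply: cvg_ereal_approx => e e0.
pose c := fine (mu (ball z (r + 1))).
have muB1f : mu (ball z (r + 1)) \is a fin_num by rewrite ge0_fin_numE.
have c0 : 0 <= c by rewrite fine_ge0.
(* The total error is at most h (c + M + 2): [h] on each of n0 levels of height [h], where n0 h <= M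
   + 1, plus [h] times the mass of [B], which is at most c for [mu] and c + h <= c + 1 for
   [nu n]. *)
pose h := e / (c + M + 2 + e); have h0 : 0 < h by rewrite divr_gt0//; lra.
have h1 : h <= 1 by rewrite /h ler_pdivrMr; lra.
have hce : h * (c + M + 2) <= e.
  have -> : h * (c + M + 2) = e * ((c + M + 2) / (c + M + 2 + e)).
    by rewrite /h; field; rewrite gt_eqF//; lra.
  by rewrite ler_piMr ?(ltW e0)// ler_pdivrMr; lra.
pose n0 := (Num.trunc (M / h)).+1.
have Mn0 : M < n0%:R * h by rewrite -ltr_pdivrMr//; exact: truncnS_gt.
have n0M : n0%:R * h <= M + 1.
  rewrite /n0 -addn1 natrD mulrDl mul1r; apply: lerD => //.
  by rewrite -ler_pdivlMr// truncn_le// divr_ge0// ltW.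
pose O k : set Z := [set x | k.+1%:R * h < phi x].
pose F k : set Z := [set x | k.+1%:R * h <= phi x].
pose B : set Z := [set x | mdist z x <= r].
have oO k : open (O k).
  rewrite (_ : O k = phi @^-1` [set y | k.+1%:R * h < y])//.
  by move/continuousP : cphi; apply; exact: open_gt.
have cF k : closed (F k).
  rewrite (_ : F k = phi @^-1` [set y | k.+1%:R * h <= y])//.
  by move/continuous_closedP : cphi; apply; exact: closed_ge.
have cB : closed B.
  rewrite (_ : B = mdist z @^-1` [set y | y <= r])//.
  by have /continuous_closedP := @mdist_continuous R Z z; apply; exact: closed_le.
have mO k : measurable (O k : set (borel Z)) by exact: open_borel.
have mF k : measurable (F k : set (borel Z)) by exact: closed_borel.
have mBc : measurable (B : set (borel Z)) by exact: closed_borel.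
have FB k : F k `<=` ball z r.
  move=> x Fx; apply: phiB; rewrite gt_eqF//; apply: lt_le_trans Fx.
  by rewrite mulr_gt0.
have OF k : O k `<=` F k by move=> x /ltW.
have BB : B `<=` ball z (r + 1).
  by move=> x; rewrite /B ballEmdist/= => zx; rewrite ltr_pwDr.
have muBc : (mu B <= c%:E)%E.
  by rewrite fineK//; apply: le_measure; rewrite ?inE//; exact: ball_borel.
have muF k : mu (F k) \is a fin_num.
  rewrite ge0_fin_numE//; apply: le_lt_trans (mu_fin z r).
  by apply: le_measure; rewrite ?inE//; exact: FB.
have muO k : mu (O k) \is a fin_num.
  rewrite ge0_fin_numE//; apply: le_lt_trans (mu_fin z r).
  by apply: le_measure; rewrite ?inE//; apply: subset_trans (OF k) (FB k).
have phi_bounds (b : nat -> bool) x : (forall k, k.+1%:R * h < phi x -> b k) ->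
    (forall k, b k -> k.+1%:R * h <= phi x) ->
    \sum_(0 <= k < n0) h * (b k)%:R <= phi x /\
    phi x <= \sum_(0 <= k < n0) h * (b k)%:R + h * \1_B x.
  move=> b1 b2; have [H1 H2] := staircase_bounds n0 h0 (phi0 x) b1 b2.
  split => //; have [px0|pxn0] := eqVneq (phi x) 0.
    rewrite px0; apply: addr_ge0; last by rewrite mulr_ge0// ltW.
    by apply: sumr_ge0 => k _; rewrite mulr_ge0// ltW.
  have -> : \1_B x = 1 :> R.
    by rewrite indicE mem_set//; have := phiB x pxn0; rewrite ballEmdist => /ltW.
  rewrite mulr1 -lerBlDr; apply: le_trans H2; rewrite le_min lexx/=.
  by have := phiM x; lra.
(* Both families of superlevel sets satisfy the staircase conditions, which leave the value at
   equality free. *)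
have O_bounds x := phi_bounds (fun k => x \in O k) x
  (fun k H => mem_set H) (fun k H => ltW (set_mem H)).
have F_bounds x := phi_bounds (fun k => x \in F k) x
  (fun k H => mem_set (ltW H)) (fun k H => set_mem H).
have mS (A : nat -> set Z) : (forall k, measurable (A k : set (borel Z))) ->
    measurable_fun setT (fun x : borel Z => \sum_(0 <= k < n0) h * \1_(A k) x : R).
  by move=> mA; apply: measurable_sum => k; exact: measurable_funM.
have lowO (rho : {measure set (borel Z) -> \bar R}) :
    (\sum_(0 <= k < n0) h%:E * rho (O k) <= \int[rho]_x (phi x)%:E)%E.
  rewrite -integral_staircase ?(ltW h0)//; apply: ge0_le_integral => //.
  - by move=> x _; rewrite lee_fin sumr_ge0// => k _; rewrite mulr_ge0// ltW.
  - by apply/measurable_EFinP; exact: mS.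
  - exact/measurable_EFinP.
  - by move=> x _; rewrite lee_fin; have [] := O_bounds x.
have lowF (rho : {measure set (borel Z) -> \bar R}) :
    (\sum_(0 <= k < n0) h%:E * rho (F k) <= \int[rho]_x (phi x)%:E)%E.
  rewrite -integral_staircase ?(ltW h0)//; apply: ge0_le_integral => //.
  - by move=> x _; rewrite lee_fin sumr_ge0// => k _; rewrite mulr_ge0// ltW.
  - by apply/measurable_EFinP; exact: mS.
  - exact/measurable_EFinP.
  - by move=> x _; rewrite lee_fin; have [] := F_bounds x.
have up (A : nat -> set Z) (rho : {measure set (borel Z) -> \bar R}) :
    (forall k, measurable (A k : set (borel Z))) ->
    (forall x, phi x <= \sum_(0 <= k < n0) h * (x \in A k)%:R + h * \1_B x) ->
    (\int[rho]_x (phi x)%:E <= \sum_(0 <= k < n0) h%:E * rho (A k) + h%:E * rho B)%E.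
  move=> mA pA; have mhB : measurable_fun setT (fun x : borel Z => h * \1_B x : R).
    exact: measurable_funM.
  apply: (@le_trans _ _ (\int[rho]_x ((\sum_(0 <= k < n0) h * \1_(A k) x)%:E + (h * \1_B x)%:E))%E).
    under [leRHS]eq_integral do rewrite -EFinD.
    by apply: Ile => //; apply: measurable_funD => //; exact: mS.
  rewrite ge0_integralD//.
  - rewrite integral_staircase ?(ltW h0)// leeD2l//.
    under eq_integral do rewrite EFinM.
    rewrite ge0_integralZl//; first by rewrite integral_indic// setIT.
      exact/measurable_EFinP.
    by rewrite lee_fin ltW.
  - by move=> x _; rewrite lee_fin sumr_ge0// => k _; rewrite mulr_ge0// ltW.
  - by apply/measurable_EFinP; exact: mS.
  - by move=> x _; rewrite lee_fin mulr_ge0// ltW.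
  - exact/measurable_EFinP.
have nearO : \forall n \near \oo, forall k, (k < n0)%N ->
    ((fine (mu (O k)) - h)%:E < nu n (O k))%E.
  apply: near_all_lt => k; apply: mu_open => //.
  by rewrite EFinB fineK// lteBlDr// lteDl// lte_fin.
have nearF : \forall n \near \oo, forall k, (k < n0)%N ->
    (nu n (F k) < (fine (mu (F k)) + h)%:E)%E.
  apply: near_all_lt => k; apply: mu_closed => //.
  by rewrite EFinD fineK// lteDl// lte_fin.
have nearB : \forall n \near \oo, (nu n B < (c + h)%:E)%E.
  apply: (@mu_closed B _ z (r + 1)) => //; apply: le_lt_trans muBc _.
  by rewrite lte_fin ltrDl.
have sumE (a b : nat -> R) : \sum_(0 <= k < n0) h * (a k + b k) =
    \sum_(0 <= k < n0) h * a k + \sum_(0 <= k < n0) h * b k.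
  by rewrite -big_split/=; apply: eq_bigr => k _; rewrite mulrDr.
have sumc (a : R) : \sum_(0 <= k < n0) h * a = n0%:R * h * a.
  by rewrite sumr_const_nat subn0 -mulrA mulr_natl.
apply: filterS3 nearO nearF nearB => n hO hF hB; split.
  apply: le_trans (lowO (nu n)).
  apply: (@le_trans _ _ (\sum_(0 <= k < n0) h%:E * (fine (mu (O k)) - h)%:E)%E); last first.
    rewrite big_seq [leRHS]big_seq; apply: lee_sum => k.
    by rewrite mem_index_iota/= => kn; rewrite lee_pmul2l ?lte_fin// ltW// hO.
  under eq_bigr do rewrite -EFinM.
  rewrite sumEFin lee_fin (sumE (fun k => fine (mu (O k))) (fun=> - h)) sumc.
  have := up O mu mO (fun x => (O_bounds x).2).
  under eq_bigr do rewrite -(fineK (muO _)) -EFinM.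
  rewrite sumEFin -/I -(fineK If) => H.
  have {H} : (fine I <= \sum_(0 <= k < n0) h * fine (mu (O k)) + h * c).
    rewrite -lee_fin; apply: le_trans H _; rewrite EFinD leeD2l// (EFinM h c).
    by apply: lee_wpmul2l => //; rewrite lee_fin ltW.
  have : n0%:R * h * h <= (M + 1) * h by rewrite ler_pM2r.
  by lra.
apply: le_trans (up F (nu n) mF (fun x => (F_bounds x).2)) _.
apply: (@le_trans _ _ (\sum_(0 <= k < n0) h%:E * (fine (mu (F k)) + h)%:E + h%:E * (c + h)%:E)%E).
  apply: leeD; last by rewrite lee_pmul2l ?lte_fin// ltW.
  rewrite big_seq [leRHS]big_seq; apply: lee_sum => k.
  by rewrite mem_index_iota/= => kn; rewrite lee_pmul2l ?lte_fin// ltW// hF.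
under eq_bigr do rewrite -EFinM.
rewrite sumEFin -EFinM -EFinD lee_fin (sumE (fun k => fine (mu (F k))) (fun=> h)) sumc.
have := lowF mu; under eq_bigr do rewrite -(fineK (muF _)) -EFinM.
rewrite sumEFin -/I -(fineK If) lee_fin => H.
have : n0%:R * h * h <= (M + 1) * h by rewrite ler_pM2r.
have : h * h <= h by rewrite ler_piMr// ltW.
by lra.
Qed.

Lemma cvg_integral (phi : Z -> R) : continuous phi ->
  (exists M : R, forall x, `|phi x| <= M) ->
  (exists (z0 : Z) (r : R), forall x, phi x != 0 -> mdist z0 x <= r) ->
  (\int[nu n]_x (phi x)%:E @[n --> \oo] --> \int[mu]_x (phi x)%:E)%E.
Proof.
move=> cphi [M phiM] [z0 [r phir]].
have M0 : 0 <= M by apply: le_trans (phiM z0).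
pose p x := Num.max (phi x) 0; pose q x := Num.max (- phi x) 0.
have c0 : continuous (fun _ : Z => 0 : R^o) by move=> x; exact: cvg_cst.
have cp : continuous p.
  by move=> x; exact: (@continuous_max R Z phi (fun=> 0) x (cphi x) (c0 x)).
have cq : continuous q.
  move=> x; have cN : {for x, continuous (fun y => - phi y : R^o)}.
    by apply: continuousN; exact: cphi.
  exact: (@continuous_max R Z _ (fun=> 0) x cN (c0 x)).
have bp x : 0 <= p x <= M.
  rewrite le_max lexx orbT/= ge_max M0 andbT.
  by apply: le_trans (ler_norm _) (phiM x).
have bq x : 0 <= q x <= M.
  rewrite le_max lexx orbT/= ge_max M0 andbT.
  by apply: le_trans (ler_norm _) _; rewrite normrN.
have supp (f : Z -> R) : (forall x, f x != 0 -> phi x != 0) ->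
    forall x, f x != 0 -> ball z0 (r + 1) x.
  by move=> fp x /fp/phir xr; rewrite ballEmdist/=; lra.
have [|pf pc] := cvg_integral_ge0 cp bp (supp p _).
  by move=> x; rewrite /p; apply: contra_neq => ->; rewrite maxxx.
have [|qf qc] := cvg_integral_ge0 cq bq (supp q _).
  by move=> x; rewrite /q; apply: contra_neq => ->; rewrite oppr0 maxxx.
have intE (rho : {measure set (borel Z) -> \bar R}) :
    (\int[rho]_x (phi x)%:E = \int[rho]_x (p x)%:E - \int[rho]_x (q x)%:E)%E.
  rewrite integralE; congr (_ - _)%E; apply: eq_integral => x _.
    by rewrite funeposE -EFin_max.
  by rewrite funenegE -EFinN -EFin_max.
under eq_fun do rewrite intE.
rewrite intE; apply: cvgeB => //.
by rewrite fin_num_adde_defr// fin_numN.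
Qed.

End portmanteau.

(** * Inner regularity in proper spaces *)

Section regularity.
Context {R : realType} {Y : completeMetricType R}.
Local Open Scope ereal_scope.

(** Complementation in a compact ball K: an open [U] slightly larger than K minus the set leaves the
    compact set K minus [U] inside it, with small loss. *)
Lemma proper_inner_regular (mu : {measure set (borel Y) -> \bar R}) (y0 : Y) :
  (forall r : R, compact [set y : Y | (mdist y0 y <= r)%R]) ->
  (forall A, mu A = ereal_inf [set mu U | U in [set U : set Y | open U /\ A `<=` U]]) ->
  (forall r : R, mu (ball y0 r) < +oo) ->
  forall B : set (borel Y), measurable B ->
    mu B = ereal_sup [set mu C | C in [set C : set Y | compact C /\ C `<=` B]].
Proof.
move=> cK outer fin B mB; apply/eqP; rewrite eq_le; apply/andP; split; last first.
  apply: ge_ereal_sup => _ [C [cC CB] <-].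
  by apply: le_measure; rewrite ?inE//; exact: compact_borel.
set s := ereal_sup _.
pose Bn (n : nat) : set (borel Y) := B `&` ball y0 n%:R.
have mBn n : measurable (Bn n) by apply: measurableI => //; exact: ball_borel.
have BE : B = \bigcup_n Bn n.
  apply/seteqP; split => [y By|y [n _ []]//].
  exists (Num.trunc (mdist y0 y)).+1 => //; split => //.
  by rewrite ballEmdist/=; exact: truncnS_gt.
have cvB : (mu \o Bn) x @[x --> \oo] --> mu B.
  rewrite [in mu B]BE; apply: nondecreasing_cvg_mu => //; first by rewrite -BE.
  move=> n k nk; apply/subsetPset; apply: setIS; apply: le_ball.
  by rewrite ler_nat.
apply: (cvge_to_le cvB); apply: nearW => n /=; apply/lee_addgt0Pr => e e0.
pose K : set Y := [set y | (mdist y0 y <= n%:R)%R].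
have mK : measurable (K : set (borel Y)) by apply: compact_borel; exact: cK.
pose D : set (borel Y) := K `\` Bn n.
have mD : measurable D by exact: measurableD.
have Df : mu D \is a fin_num.
  rewrite ge0_fin_numE//; apply: le_lt_trans (fin (n%:R + 1)%R).
  apply: le_measure; rewrite ?inE//; first exact: ball_borel.
  by move=> y [Ky _]; rewrite ballEmdist/=; apply: le_lt_trans Ky _; rewrite ltrDl.
have [_ [U [oU DU] <-] /ltW Ue] : exists2 x,
    [set mu U | U in [set U : set Y | open U /\ D `<=` U]] x & x < mu D + e%:E.
  by apply: ereal_inf_lt; rewrite -outer lteDl// lte_fin.
have mU : measurable (U : set (borel Y)) by exact: open_borel.
pose C : set Y := K `\` U.
have cC : compact C.
  apply: (@subclosed_compact _ C K); [|exact: cK|exact: subDsetl].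
  rewrite /C setDE; apply: closedI; last exact: open_closedC.
  by apply: compact_closed; [exact: metric_hausdorff|exact: cK].
have CB : C `<=` Bn n.
  by move=> y [Ky nUy]; apply: contrapT => nB; apply: nUy; apply: DU.
apply: (@le_trans _ _ (mu (C `|` (U `\` D)))).
  apply: le_measure; rewrite ?inE//.
    by apply: measurableU; [exact: compact_borel|exact: measurableD].
  move=> y By; have [Uy|nUy] := pselect (U y); [right|left].
    by split => // -[].
  by split => //; case: By => _; rewrite ballEmdist => /ltW.
apply: le_trans (measureU2 _ _ _) _ => //; first exact: compact_borel.
  exact: measurableD.
apply: leeD.
  apply: ereal_sup_ubound; exists C => //; split => //.
  by apply: subset_trans CB _; exact: subIsetl.
rewrite [leLHS]measureD//.
  by rewrite setIidr// leeBlDr// addeC.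
by rewrite (le_lt_trans Ue)// lte_add_pinfty ?ltry// -ge0_fin_numE.
Qed.

End regularity.

Lemma isometric_continuous (R : realType) (X Y : completeMetricType R) (f : X -> Y) :
  isometric f -> continuous f.
Proof.
move=> fi y; apply/metricType_numDomainType.cvgrPdist_lt => e e0.
by apply/(@metricType_numDomainType.nbhs_mdistP R X); exists e => // y' /=; rewrite fi.
Qed.

(** * Compactness of the blow-up measures *)

Section realization.
Context {R : realType} {X Y Z : completeMetricType R}.

(* The metric part of pmGH_cvg for the blow-ups (X, l n d, P). *)
Definition GH_realization (P : X) (y0 : Y) (l : nat -> {posnum R})
    (j : nat -> X -> Z) (i : Y -> Z) : Prop :=
  [/\ forall n x y, mdist (j n x) (j n y) = (l n)%:num * mdist x y,
      isometric i &
      forall e r : R, 0 < e -> 0 < r -> \forall n \near \oo,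
        i @` ball y0 r `<=`
          neighborhood e (j n @` ball P ((r + e) / (l n)%:num)) /\
        j n @` ball P (r / (l n)%:num) `<=`
          neighborhood e (i @` ball y0 (r + e))].

Variables (m : {measure set (borel X) -> \bar R}) (K N : R).
Hypotheses (N1 : 1 <= N) (mmsX : is_mms m) (cdX : CDe m K N).
Variables (P : X) (y0 : Y) (l : nat -> {posnum R}) (j : nat -> X -> Z) (i : Y -> Z).
Hypotheses (cvl : (l n)%:num @[n --> \oo] --> +oo)
  (real : GH_realization P y0 l j i).

Let lj n x y : mdist (j n x) (j n y) = (l n)%:num * mdist x y.
Proof. by have [] := real. Qed.

Let ii y y' : mdist (i y) (i y') = mdist y y'.
Proof. by have [_ ->] := real. Qed.

Definition blowup_measure n : {measure set (borel Z) -> \bar R} :=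
  image_measure (normalized_measure m P (l n)) (blowup_measurable (lj n)).

Local Notation nu := blowup_measure.

Lemma near_l (a : R) : \forall n \near \oo, a <= (l n)%:num.
Proof. by move/cvgryPge : cvl; apply. Qed.

Lemma near_base (e : R) : 0 < e ->
  \forall n \near \oo, mdist (i y0) (j n P) < e.
Proof.
move=> e0; have e30 : 0 < e / 3 by rewrite divr_gt0.
have [_ _ H] := real; have := H _ _ e30 e30; apply: filterS => n [h _].
have [|_ [x + <-]] := h (i y0); first by exists y0 => //; exact: ballxx.
rewrite ballEmdist/= ltr_pdivlMr// => Px xy0.
apply: le_lt_trans (metric_triangle _ (j n x) _) _.
by rewrite (metric_sym (i y0)) lj (metric_sym x); lra.
Qed.

Lemma near_limit_points (e r : R) : 0 < e -> 0 < r ->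
  \forall n \near \oo, forall x, mdist (i y0) (j n x) < r ->
    exists2 y, mdist y0 y < r + 1 + e & mdist (i y) (j n x) < e.
Proof.
move=> e0 r0; have r10 : 0 < r + 1 by lra.
have [_ _ H] := real.
apply: filterS2 (near_base ltr01) (H _ _ e0 r10) => n h1 [_ h2] x yx.
have [|_ [y + <-] yxe] := h2 (j n x).
  exists x => //; rewrite ballEmdist/= ltr_pdivlMr// mulrC -lj.
  by apply: le_lt_trans (metric_triangle _ (i y0) _) _; rewrite metric_sym; lra.
by rewrite ballEmdist; exists y.
Qed.

Lemma near_approximants (e r : R) : 0 < e -> 0 < r ->
  \forall n \near \oo, forall y, mdist y0 y < r ->
    exists2 x, mdist P x < (r + e) / (l n)%:num & mdist (j n x) (i y) < e.
Proof.
move=> e0 r0; have [_ _ H] := real; have := H _ _ e0 r0.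
apply: filterS => n [h _] y yr.
have [|_ [x + <-] xy] := h (i y); first by exists y => //; rewrite ballEmdist.
by rewrite ballEmdist; exists x.
Qed.

Lemma blowup_measureE n A : nu n A = normalized_measure m P (l n) (j n @^-1` A).
Proof. by []. Qed.

Lemma blowup_measure_bounded (r : R) : exists C : R,
  \forall n \near \oo, (nu n (ball (i y0) r) <= C%:E)%E.
Proof.
have [C [l0 l00 H]] := blowup_upper N1 mmsX cdX P (r + 1); exists C.
apply: filterS2 (near_base ltr01) (near_l l0) => n h1 h2.
apply: le_trans (H _ h2); rewrite blowup_measureE; apply: le_measure; rewrite ?inE.
- have := blowup_measurable (lj n) measurableT (ball_borel (i y0) r).
  by rewrite setTI.
- exact: ball_borel.
move=> x /=; rewrite !ballEmdist/= ltr_pdivlMr// mulrC -lj => yx.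
by apply: le_lt_trans (metric_triangle _ (i y0) _) _; rewrite metric_sym; lra.
Qed.

Lemma blowup_measure_lower (r s : R) : 0 < r -> 0 < s -> exists2 c : R, 0 < c &
  \forall n \near \oo, forall y, mdist y0 y < r -> (c%:E <= nu n (ball (i y) s))%E.
Proof.
move=> r0 s0; have s20 : 0 < s / 2 by rewrite divr_gt0.
have rs0 : 0 <= r + s / 2 by lra.
have [c c0 [l0 l00 H]] := blowup_lower N1 mmsX cdX P rs0 s20; exists c => //.
apply: filterS2 (near_approximants s20 r0) (near_l l0) => n h1 h2 y yr.
have [x Px xy] := h1 y yr; apply: le_trans (H _ _ h2 (ltW Px)) _.
rewrite blowup_measureE; apply: le_measure; rewrite ?inE; first exact: ball_borel.
  have := blowup_measurable (lj n) measurableT (ball_borel (i y) s).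
  by rewrite setTI.
move=> z; rewrite /= !ballEmdist/= ltr_pdivlMr// mulrC -lj => xz.
apply: le_lt_trans (metric_triangle _ (j n x) _) _.
by rewrite (metric_sym (i y)); lra.
Qed.

(** Packing: balls of radius e/2 about separated points are disjoint, each has mass at least [c],
    and all lie in one ball of mass at most [C]. *)
Lemma separated_size (rho : {measure set (borel Z) -> \bar R}) (e r c C : R)
    (s : seq Y) : 0 < c ->
  (forall y, mdist y0 y < r -> (c%:E <= rho (ball (i y) (e / 2)))%E) ->
  (rho (ball (i y0) (r + e / 2)) <= C%:E)%E ->
  (forall y, y \in s -> mdist y0 y < r) ->
  pairwise (fun y y' => e <= mdist y y') s -> (size s)%:R * c <= C.
Proof.
move=> c0 lower upper sr se; rewrite -lee_fin; apply: le_trans upper.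
pose B (s : seq Y) : set (borel Z) := \big[setU/set0]_(y <- s) ball (i y) (e / 2).
have mB t : measurable (B t).
  by apply: bigsetU_measurable => y _; exact: ball_borel.
have memB t z : B t z -> exists2 y, y \in t & mdist (i y) z < e / 2.
  by rewrite /B -bigcup_seq => -[y /= ys]; rewrite ballEmdist; exists y.
apply: (@le_trans _ _ (rho (B s))); last first.
  apply: le_measure; rewrite ?inE//; first exact: ball_borel.
  move=> z /memB[y ys yz]; rewrite ballEmdist/=.
  apply: le_lt_trans (metric_triangle _ (i y) _) _.
  by rewrite ii; have := sr y ys; lra.
elim: s sr se => [|y s ih] sr /=; first by rewrite mul0r measure_ge0.
move=> /andP[ys ses]; rewrite -add1n natrD mulrDl mul1r EFinD /B big_cons -/(B s).
rewrite measureU//; [|exact: ball_borel|].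
  apply: leeD; first by apply: lower; apply: sr; rewrite mem_head.
  by apply: ih => // y' y's; apply: sr; rewrite inE y's orbT.
rewrite -subset0 => z; rewrite ballEmdist => -[/= yz /memB[y' y's y'z]].
have := allP ys _ y's; have := metric_triangle (i y) z (i y').
by rewrite ii (metric_sym z); lra.
Qed.

Lemma totally_bounded_ball (e r : R) : 0 < e -> 0 < r -> exists s : seq Y,
  forall y, mdist y0 y < r -> exists2 y', y' \in s & mdist y' y < e.
Proof.
move=> e0 r0; have e20 : 0 < e / 2 by rewrite divr_gt0.
have [c c0 lower] := blowup_measure_lower r0 e20.
have [C upper] := blowup_measure_bounded (r + e / 2).
have [n [h1 h2]] := filter_ex (filterI lower upper).
pose sep (s : seq Y) := (forall y, y \in s -> mdist y0 y < r) /\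
  pairwise (fun y y' => e <= mdist y y') s.
pose Q k := `[< exists2 s, sep s & size s = k >].
have exQ : exists k, Q k by exists 0%N; apply/asboolP; exists [::].
have ubQ k : Q k -> (k <= Num.trunc (C / c))%N.
  move=> /asboolP[s [s1 s2] <-].
  have := separated_size c0 h1 h2 s1 s2; rewrite -ler_pdivlMr// => sC.
  by rewrite truncn_ge_nat// (le_trans _ sC).
case: (ex_maxnP exQ ubQ) => k /asboolP[s [s1 s2] sk] kmax.
exists s => y yr; apply: contrapT => ny.
have : Q k.+1.
  apply/asboolP; exists (y :: s); last by rewrite /= sk.
  split=> [y'|/=]; first by rewrite inE => /orP[/eqP->|/s1].
  rewrite s2 andbT; apply/allP => y' y's; rewrite leNgt; apply/negP => h.
  by apply: ny; exists y' => //; rewrite metric_sym.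
by move=> /kmax; rewrite ltnn.
Qed.

(** Properness of [Y] is a consequence of the mass bounds: balls are totally bounded, so an
    ultrafilter on the closed ball contains balls of every radius, hence is Cauchy. *)
Lemma proper_limit (r : R) : compact [set y : Y | mdist y0 y <= r].
Proof.
set B := [set y | _].
have cB : closed B.
  rewrite (_ : B = mdist y0 @^-1` [set t | t <= r])//.
  by have /continuous_closedP := @mdist_continuous R Y y0; apply; exact: closed_le.
rewrite compact_ultra => F UF FB.
have Fball (e : R) : 0 < e -> exists y, F (ball y e).
  move=> e0; have r10 : 0 < `|r| + 1 by rewrite ltr_wpDl.
  have [s hs] := totally_bounded_ball e0 r10.
  apply: contrapT => /forallNP nF.
  have : F (fun z => forall y, y \in s -> ~ ball y e z).
    elim: s {hs} => [|y s ih]; first by apply: filterS FB => z _ y.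
    have [//|h] := in_ultra_setVsetC (ball y e) UF; first by have := nF y.
    apply: filterS2 ih h => z h1 h2 y'; rewrite inE => /orP[/eqP->//|]; exact: h1.
  move=> h; have [z [Bz nz]] := filter_ex (filterI FB h).
  have [|y ys yz] := hs z; last by apply: (nz y ys); rewrite ballEmdist.
  by apply: le_lt_trans Bz _; rewrite (le_lt_trans (ler_norm r))// ltrDl.
have Fcvg : F --> lim F by apply: cauchy_cvg; exact: cauchy_exP.
exists (lim F); split => //; apply: cB => U /Fcvg FU.
by have [z [Bz Uz]] := filter_ex (filterI FB FU); exists z.
Qed.


Hypothesis sZ : separable_space Z.

Lemma isometry_borel : measurable_fun setT (i : borel Y -> borel Z).
Proof. by apply: (@blowup_measurable _ _ _ 1) => y y'; rewrite ii mul1r. Qed.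

(** Finite unions of balls with centres in a dense sequence and radii 1/(n + 1). Countability allows
    diagonal extraction, and closure under union lets limits of their masses be subadditive. *)
Lemma countable_ring_base : exists V : seq (nat * nat) -> set Z,
  [/\ V [::] = set0, forall s t, V (s ++ t) = V s `|` V t,
      forall s, open (V s), forall s, exists r, V s `<=` ball (i y0) r &
      forall C O : set Z, compact C -> open O -> C `<=` O ->
        exists2 s, C `<=` V s & V s `<=` O].
Proof.
have [f hf] := dense_sequence sZ.
pose B (k : nat * nat) : set Z := ball (f k.1) k.2.+1%:R^-1.
pose V (s : seq (nat * nat)) : set Z := [set z | exists2 k, k \in s & B k z].
exists V; split.
- by rewrite -subset0 => z [k].
- move=> s t; apply/seteqP; split => z.
    by move=> [k]; rewrite mem_cat => /orP[ks|kt] Bz; [left|right]; exists k.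
  by move=> [|] [k ks Bz]; exists k => //; rewrite mem_cat ks ?orbT.
- move=> s; rewrite (_ : V s = \bigcup_(k in [set` s]) B k).
    by apply: bigcup_open => k _; exact: mball_open.
  by apply/seteqP; split => z [k ks Bz]; exists k.
- elim=> [|k s [r sr]]; first by exists 0 => z [].
  exists (Num.max r (mdist (i y0) (f k.1) + 1)) => z [k'].
  rewrite inE => /orP[/eqP -> |k's] Bz; rewrite ballEmdist/= lt_max.
    move: Bz; rewrite /B ballEmdist/= => Bz; apply/orP; right.
    apply: le_lt_trans (metric_triangle _ (f k.1) _) _; rewrite ltrD2l.
    apply: lt_le_trans Bz _; rewrite invf_le1//.
    by rewrite ler1n.
  have /sr : V s z by exists k'.
  by rewrite ballEmdist/= => ->.
- move=> C O cC oO CO; move: cC; rewrite compact_cover.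
  move=> /(_ _ [set k | B k `<=` O] B (fun k _ => @mball_open _ _ _ _)).
  case=> [z Cz|D sD CD].
    have [r r0 rO] := open_sub_ball oO (CO z Cz).
    have r20 : 0 < r / 2 by rewrite divr_gt0.
    have [b br] := inv_nat_lt r20.
    have b0 : 0 < b.+1%:R^-1 :> R by rewrite invr_gt0.
    have [a az] := hf z _ b0.
    exists (a, b); last by rewrite /B ballEmdist.
    move=> z'; rewrite /B ballEmdist/= => az'; apply: rO; rewrite ballEmdist/=.
    rewrite (splitr r); apply: le_lt_trans (metric_triangle _ (f a) _) _.
    by rewrite (metric_sym z) ltrD//; apply: lt_trans br.
  exists (finmap.enum_fset D) => z; first by move=> /CD[k kD Bz]; exists k.
  by move=> [k kD Bz]; have := sD k kD; rewrite inE; apply.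
Qed.

Lemma basic_sets_converge (V : seq (nat * nat) -> set Z) :
  (forall s, open (V s)) -> (forall s, exists r, V s `<=` ball (i y0) r) ->
  exists phi : nat -> nat, exists L : seq (nat * nat) -> R,
    (forall n, (n <= phi n)%N) /\
    forall s, (nu (phi n) (V s) @[n --> \oo] --> (L s)%:E)%E.
Proof.
move=> oV bV.
have mV s : measurable (V s : set (borel Z)) by exact: open_borel.
have /choice[M hM] : forall s, exists C : R, \forall n \near \oo,
    (nu n (V s) <= C%:E)%E.
  move=> s; have [r Vr] := bV s; have [C HC] := blowup_measure_bounded r.
  exists C; apply: filterS HC => n; apply: le_trans.
  by apply: le_measure; rewrite ?inE//; exact: ball_borel.
(* The mass bounds hold only for large n, whereas extraction wants bounded sequences; the truncation
   is eventually inactive. *)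
pose a n s := Num.min (fine (nu n (V s))) `|M s|.
have [s|phi [L [phin aL]]] := @diagonal_extraction _ _ a.
  exists `|M s| => n; rewrite ger0_norm ?ge_min ?lexx ?orbT//.
  by rewrite le_min normr_ge0 fine_ge0.
exists phi, L; split => // s; apply: cvg_ereal_approx => e e0.
have /cvgrPdist_lt/(_ e e0) aLe := aL s.
apply: filterS2 aLe (near_subseq phin (hM s)) => n aLe nM.
have nf : nu (phi n) (V s) \is a fin_num.
  by rewrite ge0_fin_numE ?measure_ge0// (le_lt_trans nM) ?ltry.
have aE : a (phi n) s = fine (nu (phi n) (V s)).
  rewrite /a min_l// -lee_fin fineK//; apply: le_trans nM _.
  by rewrite lee_fin ler_norm.
rewrite -(fineK nf) -aE !lee_fin; move: aLe; rewrite ltr_norml => /andP[h1 h2].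
by split; lra.
Qed.

Lemma image_compact (C : set Y) : compact C -> compact (i @` C).
Proof.
by apply: continuous_compact; apply: continuous_subspaceT; exact: (isometric_continuous ii).
Qed.

(** Limits [L] of the masses of the basic open sets of [Z] define a content on the compact sets of
    [Y], which induces [mu]. Open sets are approximated from inside by compact ones; closed bounded
    sets are handled through the properness of [Y]; portmanteau then gives weak convergence. *)
Theorem blowup_compactness : exists phi : nat -> nat,
  exists mu : {measure set (borel Y) -> \bar R},
  [/\ forall n, (n <= phi n)%N, radon mu, Defs.support mu = setT &
    forall f : Z -> R, continuous f -> (exists M : R, forall z, `|f z| <= M) ->
      (exists (z0 : Z) (r : R), forall z, f z != 0 -> mdist z0 z <= r) ->
      (\int[nu (phi n)]_z (f z)%:E @[n --> \oo] -->
       \int[image_measure mu isometry_borel]_z (f z)%:E)%E].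
Proof.
have [V [V0 VU oV bV coverV]] := countable_ring_base.
have [phi [L [phin cvL]]] := basic_sets_converge oV bV.
have mV s : measurable (V s : set (borel Z)) by exact: open_borel.
have L_ge0 s : 0 <= L s.
  by rewrite -lee_fin; apply: (cvge_to_ge (cvL s)); apply: nearW => n.
have L_le s t : V s `<=` V t -> L s <= L t.
  move=> Vst; rewrite -lee_fin; apply: (lee_cvg_to (cvL s) (cvL t)).
  by apply: nearW => n; apply: le_measure; rewrite ?inE.
have cvD s t : (nu (phi n) (V s) + nu (phi n) (V t) @[n --> \oo] -->
    (L s + L t)%:E)%E.
  by rewrite EFinD; apply: cvgeD.
have L_cat s t : L (s ++ t) <= L s + L t.
  rewrite -lee_fin; apply: (lee_cvg_to (cvL _) (cvD s t)).
  by apply: nearW => n; rewrite VU; exact: measureU2.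
have L_disjoint s t u : V s `&` V t = set0 -> V s `<=` V u -> V t `<=` V u ->
    L s + L t <= L u.
  move=> st su tu; rewrite -lee_fin; apply: (lee_cvg_to (cvD s t) (cvL u)).
  apply: nearW => n; have muU := @measureU _ _ _ (nu (phi n)) _ _ (mV s) (mV t) st.
  rewrite -[leLHS]muU; apply: le_measure; rewrite ?inE//.
    by rewrite -VU.
  by rewrite subUset.
pose kap (C : set Y) : \bar R := ereal_inf [set (L s)%:E | s in [set s | i @` C `<=` V s]].
have kap_lb (C : set Y) s : i @` C `<=` V s -> (kap C <= (L s)%:E)%E.
  by move=> Cs; apply: ereal_inf_lbound; exists s.
have kap_ge0 C : (0 <= kap C)%E.
  by apply: le_ereal_inf_tmp => _ [s _ <-]; rewrite lee_fin.
have kap0 : kap set0 = 0%E.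
  apply/eqP; rewrite eq_le kap_ge0 andbT.
  apply: le_trans (kap_lb _ [::] _) _; first by rewrite image_set0.
  rewrite lee_fin -lee_fin; apply: (cvge_to_le (cvL [::])); apply: nearW => n.
  by rewrite V0 measure0.
have kapU C D : compact C -> compact D -> (kap (C `|` D) <= kap C + kap D)%E.
  move=> _ _.
  have H s t : i @` C `<=` V s -> i @` D `<=` V t ->
      (kap (C `|` D) <= (L s)%:E + (L t)%:E)%E.
    move=> Cs Dt; apply: le_trans (kap_lb _ (s ++ t) _) _; last first.
      by rewrite -EFinD lee_fin.
    by rewrite image_setU VU; exact: setUSS.
  have H2 s : i @` C `<=` V s -> (kap (C `|` D) <= (L s)%:E + kap D)%E.
    move=> Cs; rewrite addeC -leeBlDr//; apply: le_ereal_inf_tmp => _ [t Dt <-].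
    by rewrite leeBlDr// addeC; exact: H.
  have [|Dy] := leP +oo%E (kap D).
    by rewrite leye_eq => /eqP ->; rewrite addey ?leey// gt_eqF// (lt_le_trans _ (kap_ge0 C)).
  have Df : kap D \is a fin_num by rewrite ge0_fin_numE.
  rewrite -leeBlDr//; apply: le_ereal_inf_tmp => _ [s Cs <-].
  by rewrite leeBlDr//; exact: H2.
have hausZ := @metric_hausdorff R Z.
(* Disjoint open neighbourhoods of the two images, cut down to a basic set containing both, contain
   basic sets to which [L_disjoint] applies. *)
have kap_disjoint C D : compact C -> compact D -> C `&` D = set0 ->
    (kap C + kap D <= kap (C `|` D))%E.
  move=> cC cD CD; apply: le_ereal_inf_tmp => _ [u CDu <-].
  have ciC := image_compact cC; have ciD := image_compact cD.
  have iCD : i @` C `&` i @` D = set0.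
    rewrite -subset0 => z [[y Cy <-] [y' Dy']] yy'.
    have : y = y' by apply: (@mdist_positivity R Y); rewrite -ii yy' mdistxx.
    by move=> E; rewrite -E in Dy'; have : (C `&` D) y by []; rewrite CD.
  have [G1 [G2 [oG1 oG2 CO1 DO2 G12]]] := (@normal_openP R Z).1
    (@pseudometric_normal R Z) _ _ (compact_closed hausZ ciC)
    (compact_closed hausZ ciD) iCD.
  have Cu : i @` C `<=` V u by apply: subset_trans CDu; apply: image_subset => y; left.
  have Du : i @` D `<=` V u by apply: subset_trans CDu; apply: image_subset => y; right.
  have [s Cs sO] := coverV _ (G1 `&` V u) ciC (openI oG1 (oV u))
    (fun z h => conj (CO1 z h) (Cu z h)).
  have [t Dt tO] := coverV _ (G2 `&` V u) ciD (openI oG2 (oV u))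
    (fun z h => conj (DO2 z h) (Du z h)).
  apply: le_trans (leeD (kap_lb _ _ Cs) (kap_lb _ _ Dt)) _.
  rewrite -EFinD lee_fin; apply: L_disjoint.
  - rewrite -subset0 => z [/sO[z1 _] /tO[z2 _]].
    by have : (G1 `&` G2) z by []; rewrite G12.
  - by move=> z /sO[].
  - by move=> z /tO[].
have [mu [mu_open mu_outer kap_mu]] := content_measure_exists kap_ge0 kap0
  kapU kap_disjoint.
have mi := isometry_borel.
pose muZ : {measure set (borel Z) -> \bar R} := image_measure mu mi.
have muZE A : muZ A = mu (i @^-1` A) by [].
have near_open (O : set Z) (a : R) : open O -> (a%:E < muZ O)%E ->
    \forall n \near \oo, (a%:E < nu (phi n) O)%E.
  move=> oO; rewrite muZE mu_open; last first.
    by move/continuousP : (isometric_continuous ii); apply.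
  move=> /ereal_sup_gt[_ [C [cC CO] <-] aC].
  have [s Cs sO] := coverV _ O (image_compact cC) oO ltac:(by move=> _ [y /CO ? <-]).
  have : (a%:E < (L s)%:E)%E by apply: lt_le_trans aC (kap_lb _ _ Cs).
  rewrite lte_fin => aL; have e0 : 0 < L s - a by rewrite subr_gt0.
  have /fine_cvgP[Lf /cvgrPdist_lt/(_ _ e0)] := cvL s.
  move: Lf; apply: filterS2 => n Lf; rewrite distrC ltr_norml => /andP[h _].
  apply: (@lt_le_trans _ _ (nu (phi n) (V s))); last first.
    by apply: le_measure; rewrite ?inE//; exact: open_borel.
  by rewrite -(fineK Lf) lte_fin; move: h; rewrite /comp; lra.
have near_basic s (a : R) : L s < a -> \forall n \near \oo, (nu (phi n) (V s) < a%:E)%E.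
  move=> La; have e0 : 0 < a - L s by rewrite subr_gt0.
  have /fine_cvgP[Lf /cvgrPdist_lt/(_ _ e0)] := cvL s.
  move: Lf; apply: filterS2 => n Lf; rewrite distrC ltr_norml => /andP[_ h].
  by rewrite -(fineK Lf) lte_fin; move: h; rewrite /comp; lra.
have preim_closed (F : set Z) : closed F -> closed (i @^-1` F).
  by move: F; apply/continuous_closedP; exact: (isometric_continuous ii).
have near_closed (F : set Z) (a : R) z r : closed F -> F `<=` ball z r ->
    (muZ F < a%:E)%E -> \forall n \near \oo, (nu (phi n) F < a%:E)%E.
  move=> cF Fr Fa.
  pose r' := `|mdist (i y0) z + r| + 1.
  have r'0 : 0 < r' by rewrite ltr_wpDl.
  have Fr' z' : F z' -> mdist (i y0) z' < r'.
    move=> /Fr; rewrite ballEmdist/= => zz'.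
    apply: le_lt_trans (metric_triangle _ z _) _.
    by have := ler_norm (mdist (i y0) z + r); rewrite /r'; lra.
  pose C := i @^-1` F.
  have cC : compact C.
    apply: (@subclosed_compact _ C _ (preim_closed F cF) (@proper_limit r')).
    by move=> y /Fr'; rewrite ii => /ltW.
  have [_ [s Cs <-]] : exists2 x, [set (L s)%:E | s in [set s | i @` C `<=` V s]] x & (x < a%:E)%E.
    by apply: ereal_inf_lt; apply: le_lt_trans Fa; exact: kap_mu.
  rewrite lte_fin => La.
  have [k hk] : exists k : nat, forall y z', mdist y0 y <= r' + 2 -> F z' ->
      mdist (i y) z' < k.+1%:R^-1 -> V s z'.
    have cK := @proper_limit (r' + 2).
    have oG : open (V s `|` ~` F).
      by apply: openU => //; exact: closed_openC.
    have /compact_near_coveringP/(_ nat \oo (fun k y => forall z', F z' ->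
        mdist (i y) z' < k.+1%:R^-1 -> V s z') _) [] := cK.
      move=> y _; have Gy : (V s `|` ~` F) (i y).
        by have [Fy|] := pselect (F (i y)); [left; apply: Cs; exists y|right].
      have [d d0 dG] := open_sub_ball oG Gy.
      have d20 : 0 < d / 2 by rewrite divr_gt0.
      have [k0 k0d] := inv_nat_lt d20.
      exists (ball y (d / 2), [set k | (k0 <= k)%N]) => /=.
        by split; [exact: nbhsx_ballx|exists k0].
      move=> [y' k] /= [yy' k0k] z' Fz' y'z'.
      have [] // := dG z'; rewrite ballEmdist/= (splitr d).
      apply: le_lt_trans (metric_triangle _ (i y') _) _; apply: ltrD.
        by rewrite ii; move: yy'; rewrite ballEmdist.
      apply: lt_trans y'z' _; apply: le_lt_trans k0d.
      by rewrite lef_pV2 ?posrE// ler_nat.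
    move=> k _ hk; exists k => y z' yr Fz' yz'.
    exact: (hk k (leqnn k) y yr z').
  have k0 : 0 < k.+1%:R^-1 :> R by rewrite invr_gt0.
  have k1 : k.+1%:R^-1 <= 1 :> R by rewrite invf_le1 ?ler1n.
  have nlp := near_subseq phin (near_limit_points k0 r'0).
  apply: filterS2 nlp (near_basic s a La) => n hn; apply: le_lt_trans.
  rewrite !blowup_measureE; apply: le_measure; rewrite ?inE.
  - have := blowup_measurable (lj (phi n)) measurableT (closed_borel cF).
    by rewrite setTI.
  - have := blowup_measurable (lj (phi n)) measurableT (mV s).
    by rewrite setTI.
  move=> x /= Fx; have [y yr yx] := hn x (Fr' _ Fx).
  apply: hk yx => //; apply: ltW; apply: lt_le_trans yr _.
  by rewrite -[leRHS]/(r' + (1 + 1)) addrA lerD2l.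
have mu_fin_ball r : (mu (ball y0 r) < +oo)%E.
  have [s Ks _] := coverV _ setT (image_compact (@proper_limit r)) openT (fun _ _ => I).
  rewrite mu_open; last exact: mball_open.
  apply: (@le_lt_trans _ _ (L s)%:E); last exact: ltry.
  apply: ge_ereal_sup => _ [C [cC Cr] <-]; apply: kap_lb.
  apply: subset_trans Ks; apply: image_subset => y /Cr.
  by rewrite ballEmdist => /ltW.
have muZ_fin z r : (muZ (ball z r) < +oo)%E.
  rewrite muZE; apply: le_lt_trans (mu_fin_ball (mdist (i y0) z + r)).
  apply: le_measure; rewrite ?inE.
  - by have := mi measurableT _ (ball_borel z r); rewrite setTI.
  - exact: ball_borel.
  move=> y /=; rewrite !ballEmdist/= -ii => zy.
  by apply: le_lt_trans (metric_triangle _ z _) _; rewrite ltrD2l.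
exists phi, mu; split => //; last first.
- move=> f cf bf sf; exact: (cvg_integral muZ_fin near_open near_closed).
- apply/seteqP; split => // y _ U [oU Uy].
  have [s s0 sU] := open_sub_ball oU Uy.
  have s20 : 0 < s / 2 by rewrite divr_gt0.
  have yr : mdist y0 y < mdist y0 y + 1 by rewrite ltrDl.
  have r0 : 0 < mdist y0 y + 1 by rewrite ltr_wpDl ?mdist_ge0.
  have [c c0 lower] := blowup_measure_lower r0 s20.
  (* A closed ball makes [near_closed] applicable: limit mass below [c] would force mass below [c]
     for large n, against the uniform lower bound. *)
  pose F : set Z := [set z | mdist (i y) z <= s / 2].
  have cF : closed F.
    rewrite (_ : F = mdist (i y) @^-1` [set t | t <= s / 2])//.
    by have /continuous_closedP := @mdist_continuous R Z (i y); apply; exact: closed_le.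
  have Fs : F `<=` ball (i y) s.
    by move=> z; rewrite /F ballEmdist/= => h; apply: le_lt_trans h _; lra.
  have : (c%:E <= muZ F)%E.
    rewrite leNgt; apply/negP => /(near_closed F c (i y) s cF Fs) h.
    have [n [h1 h2]] := filter_ex (filterI h (near_subseq phin lower)).
    move: h1; apply/negP; rewrite -leNgt; apply: le_trans (h2 y yr) _.
    apply: le_measure; rewrite ?inE; [exact: ball_borel|exact: closed_borel|].
    by move=> z; rewrite /F ballEmdist => /ltW.
  move=> cFle; apply: (@lt_le_trans _ _ c%:E); first by rewrite lte_fin.
  apply: le_trans cFle _; rewrite muZE; apply: le_measure; rewrite ?inE.
  - by have := mi measurableT _ (closed_borel cF); rewrite setTI.
  - exact: open_borel.
  by move=> y' /Fs; rewrite ballEmdist/= ii => yy'; apply: sU; rewrite ballEmdist.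
split.
  move=> y; exists (ball y0 (mdist y0 y + 1)) => //; split; first exact: mball_open.
  by rewrite ballEmdist/= ltrDl.
exact: (proper_inner_regular proper_limit mu_outer mu_fin_ball).
Qed.

End realization.

(** * Cut-off functions and mass bounds under weak convergence *)

Section bump_functions.
Context {R : realType} {Z : completeMetricType R}.
Implicit Types A : set Z.

Definition infdist A (z : Z) : R := inf [set mdist a z | a in A].

Lemma infdist_lb A a z : A a -> infdist A z <= mdist a z.
Proof.
move=> Aa; apply: ge_inf; last by exists a.
by exists 0 => _ [b _ <-]; exact: mdist_ge0.
Qed.

Lemma infdist_ge0 A z : A !=set0 -> 0 <= infdist A z.
Proof.
move=> [a Aa]; apply: lb_le_inf; first by exists (mdist a z), a.
by move=> _ [b _ <-]; exact: mdist_ge0.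
Qed.

Lemma infdist_lt A z (e : R) : A !=set0 -> infdist A z < e -> neighborhood e A z.
Proof.
move=> [a Aa] /inf_lt[|_ [b Ab <-] be]; first by exists (mdist a z), a.
by exists b.
Qed.

Lemma infdist_lip A z z' : A !=set0 -> infdist A z - infdist A z' <= mdist z z'.
Proof.
move=> [a Aa]; rewrite lerBlDl -lerBlDr; apply: lb_le_inf.
  by exists (mdist a z'), a.
move=> _ [b Ab <-]; rewrite lerBlDr; apply: le_trans (infdist_lb z Ab) _.
by rewrite (metric_sym z); exact: metric_triangle.
Qed.

Definition bump A (e : R) (z : Z) : R := Num.max (1 - infdist A z / e) 0.

Lemma bump_continuous A e : A !=set0 -> continuous (bump A e).
Proof.
move=> A0 z; apply: (@continuous_max R Z (fun z => 1 - infdist A z / e) (fun=> 0)).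
  apply: continuousB; first exact: cvg_cst.
  apply: continuousM; last exact: cvg_cst.
  apply: lip_continuous => x y; rewrite ler_norml; apply/andP; split.
    by rewrite lerNl opprB metric_sym infdist_lip.
  exact: infdist_lip.
exact: cvg_cst.
Qed.

Lemma bump_ge0 A e z : 0 <= bump A e z.
Proof. by rewrite le_max lexx orbT. Qed.

Lemma bump_le1 A e z : A !=set0 -> 0 < e -> bump A e z <= 1.
Proof.
move=> A0 e0; rewrite ge_max ler01 andbT gerBl divr_ge0 ?(ltW e0)//.
exact: infdist_ge0.
Qed.

Lemma bump1 A e z : 0 < e -> A z -> bump A e z = 1.
Proof.
move=> e0 Az; have A0 : A !=set0 by exists z.
have d0 : infdist A z = 0.
  by apply/eqP; rewrite eq_le infdist_ge0// andbT -(mdistxx z) infdist_lb.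
by rewrite /bump d0 mul0r subr0 max_l.
Qed.

Lemma bump_neighborhood A e z : A !=set0 -> 0 < e -> bump A e z != 0 ->
  neighborhood e A z.
Proof.
move=> A0 e0 bz; apply: infdist_lt => //; rewrite ltNge; apply/negP => h.
move: bz; rewrite /bump max_r ?eqxx// subr_le0.
by rewrite ler_pdivlMr// mul1r.
Qed.

Lemma open_neighborhood A e : open (neighborhood e A).
Proof.
rewrite (_ : neighborhood e A = \bigcup_(a in A) ball a e).
  by apply: bigcup_open => a _; exact: mball_open.
by apply/seteqP; split => z [a Aa]; rewrite ?ballEmdist => az; exists a => //;
  rewrite ballEmdist.
Qed.

End bump_functions.

Section weak_limits.
Context {R : realType} {Y Z : completeMetricType R}.
Variables (nu : nat -> {measure set (borel Z) -> \bar R})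
  (mu : {measure set (borel Y) -> \bar R}) (i : Y -> Z).
Hypotheses (ii : isometric i) (mi : measurable_fun setT (i : borel Y -> borel Z)).
Hypothesis weak : forall f : Z -> R, continuous f ->
  (exists M : R, forall z, `|f z| <= M) ->
  (exists (z0 : Z) (r : R), forall z, f z != 0 -> mdist z0 z <= r) ->
  (\int[nu n]_z (f z)%:E @[n --> \oo] -->
   \int[image_measure mu mi]_z (f z)%:E)%E.
Local Open Scope ereal_scope.

Let cvg_near_gt (u : nat -> \bar R) (x : \bar R) (a : R) :
  u n @[n --> \oo] --> x -> a%:E < x -> \forall n \near \oo, a%:E < u n.
Proof.
by move=> ux ax; exact: ux (open_ereal_gt' ax).
Qed.

Let cvg_near_lt (u : nat -> \bar R) (x : \bar R) (a : R) :
  u n @[n --> \oo] --> x -> x < a%:E -> \forall n \near \oo, u n < a%:E.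
Proof.
by move=> ux xa; exact: ux (open_ereal_lt' xa).
Qed.

(** The measures [nu n] may give the image of [C] no mass at all, being carried in applications by
    other subsets of [Z]; hence the neighbourhood, with a bump function between the two
    indicators. *)
Lemma weak_liminf (C : set Y) (e a : R) (z0 : Z) (r : R) : C !=set0 ->
  measurable (C : set (borel Y)) -> i @` C `<=` ball z0 r -> (0 < e)%R ->
  a%:E < mu C -> \forall n \near \oo, a%:E < nu n (neighborhood e (i @` C)).
Proof.
move=> C0 mC Cr e0 aC; set A := i @` C.
have A0 : A !=set0 by have [y Cy] := C0; exists (i y), y.
pose f := bump A e.
have mf : measurable_fun setT (f : borel Z -> R).
  by apply: continuous_borel_real; exact: bump_continuous.
have mN : measurable (neighborhood e A : set (borel Z)).
  by apply: open_borel; exact: open_neighborhood.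
have : a%:E < \int[image_measure mu mi]_z (f z)%:E.
  apply: lt_le_trans aC _.
  have fE : \int[mu]_y (f (i y))%:E = \int[image_measure mu mi]_z (f z)%:E.
    apply: (eq_ge0_integral (h := i : borel Y -> borel Z)) => //.
      exact/measurable_EFinP.
    by move=> z; rewrite lee_fin bump_ge0.
  rewrite -fE; apply: (@le_trans _ _ (\int[mu]_y (\1_C y)%:E)).
    by rewrite integral_indic// setIT.
  apply: ge0_le_integral => //.
  - exact/measurable_EFinP.
  - by apply/measurable_EFinP; exact: (measurableT_comp mf mi).
  - move=> y _; rewrite lee_fin indicE /=; case: (boolP (y \in C)) => [/set_mem Cy|_].
      by rewrite /f bump1//; exists y.
    exact: bump_ge0.
have wf := weak (bump_continuous (e := e) A0).
have cf : \int[nu n]_z (f z)%:E @[n --> \oo] --> \int[image_measure mu mi]_z (f z)%:E.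
  apply: wf.
    by exists 1%R => z; rewrite ger0_norm ?bump_ge0// bump_le1.
  exists z0, (r + e)%R => z /(bump_neighborhood A0 e0)[x /Cr]; rewrite ballEmdist/=.
  move=> zx xz; apply: le_trans (metric_triangle _ x _) _.
  by apply: lerD; exact: ltW.
move=> /(cvg_near_gt cf); apply: filterS => n h; apply: lt_le_trans h _.
apply: (@le_trans _ _ (\int[nu n]_z (\1_(neighborhood e A) z)%:E)); last first.
  by rewrite integral_indic// setIT.
apply: ge0_le_integral => //.
- by move=> z _; rewrite lee_fin bump_ge0.
- exact/measurable_EFinP.
- exact/measurable_EFinP.
- move=> z _; rewrite lee_fin indicE; have [->|fz] := eqVneq (f z) 0%R => //.
  by rewrite mem_set ?bump_le1//; exact: bump_neighborhood fz.
Qed.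

Lemma weak_limsup (B : set Z) (e a : R) (z0 : Z) (r : R) : B !=set0 ->
  measurable (B : set (borel Z)) -> B `<=` ball z0 r -> (0 < e)%R ->
  mu (i @^-1` (neighborhood e B)) < a%:E -> \forall n \near \oo, nu n B < a%:E.
Proof.
move=> B0 mB Br e0 Ba; pose f := bump B e.
have mf : measurable_fun setT (f : borel Z -> R).
  by apply: continuous_borel_real; exact: bump_continuous.
have mN : measurable (i @^-1` neighborhood e B : set (borel Y)).
  have mN : measurable (neighborhood e B : set (borel Z)).
    by apply: open_borel; exact: open_neighborhood.
  by have := mi measurableT mN; rewrite setTI.
have : \int[image_measure mu mi]_z (f z)%:E < a%:E.
  apply: le_lt_trans Ba.
  have fE : \int[mu]_y (f (i y))%:E = \int[image_measure mu mi]_z (f z)%:E.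
    apply: (eq_ge0_integral (h := i : borel Y -> borel Z)) => //.
      exact/measurable_EFinP.
    by move=> z; rewrite lee_fin bump_ge0.
  rewrite -fE.
  apply: (@le_trans _ _ (\int[mu]_y (\1_(i @^-1` neighborhood e B) y)%:E)); last first.
    by rewrite integral_indic// setIT.
  apply: ge0_le_integral => //.
  - by move=> y _; rewrite lee_fin bump_ge0.
  - by apply/measurable_EFinP; exact: (measurableT_comp mf mi).
  - exact/measurable_EFinP.
  - move=> y _; rewrite lee_fin indicE /=; have [->|fz] := eqVneq (f (i y)) 0%R => //.
    by rewrite mem_set ?bump_le1//; exact: bump_neighborhood fz.
have cf : \int[nu n]_z (f z)%:E @[n --> \oo] --> \int[image_measure mu mi]_z (f z)%:E.
  apply: weak; first exact: bump_continuous.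
    by exists 1%R => z; rewrite ger0_norm ?bump_ge0// bump_le1.
  exists z0, (r + e)%R => z /(bump_neighborhood B0 e0)[x /Br]; rewrite ballEmdist/=.
  move=> zx xz; apply: le_trans (metric_triangle _ x _) _.
  by apply: lerD; exact: ltW.
move=> /(cvg_near_lt cf); apply: filterS => n; apply: le_lt_trans.
apply: (@le_trans _ _ (\int[nu n]_z (\1_B z)%:E)).
  by rewrite integral_indic// setIT.
apply: ge0_le_integral => //.
- exact/measurable_EFinP.
- exact/measurable_EFinP.
- move=> z _; rewrite lee_fin indicE; case: (boolP (z \in B)) => [/set_mem Bz|_].
    by rewrite /f bump1.
  exact: bump_ge0.
Qed.

Lemma weak_limit_ball_fin (y0 : Y) : (forall r, exists C : R,
    \forall n \near \oo, nu n (ball (i y0) r) <= C%:E) ->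
  forall r, mu (ball y0 r) < +oo.
Proof.
move=> bd r; have [r0|r0] := leP r 0%R.
  rewrite (_ : ball y0 r = set0) ?measure0// -subset0 => y; rewrite ballEmdist/=.
  by move=> /lt_le_trans/(_ r0); rewrite ltNge mdist_ge0.
have [C HC] := bd (r + 1)%R; apply: (@le_lt_trans _ _ C%:E); last exact: ltry.
rewrite leNgt; apply/negP => h.
have B0 : ball y0 r !=set0 by exists y0; exact: ballxx.
have [|n [h1 h2]] := filter_ex (filterI (@weak_liminf _ 1 C (i y0) r B0
  (ball_borel y0 r) _ ltr01 h) HC).
  by move=> _ [y + <-]; rewrite !ballEmdist/= ii.
move: h1; apply/negP; rewrite -leNgt; apply: le_trans h2.
apply: le_measure; rewrite ?inE; [|exact: ball_borel|].
  by apply: open_borel; exact: open_neighborhood.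
move=> z [_ [y + <-]]; rewrite !ballEmdist/= -ii => yr yz.
by apply: le_lt_trans (metric_triangle _ (i y) _) _; exact: ltrD.
Qed.

End weak_limits.

(** * Normalization of blow-up limits *)

Section blowup_limits.
Context {R : realType} {X Y Z : completeMetricType R}.
Variables (m : {measure set (borel X) -> \bar R}) (K N : R).
Hypotheses (N1 : 1 <= N) (mmsX : is_mms m) (cdX : CDe m K N).
Variables (P : X) (y0 : Y) (l : nat -> {posnum R}) (j : nat -> X -> Z) (i : Y -> Z).
Hypotheses (cvl : (l n)%:num @[n --> \oo] --> +oo)
  (real : GH_realization P y0 l j i).
Variable mu : {measure set (borel Y) -> \bar R}.
Local Notation nu := (blowup_measure m real).
Hypothesis weak : forall f : Z -> R, continuous f ->
  (exists M : R, forall z, `|f z| <= M) ->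
  (exists (z0 : Z) (r : R), forall z, f z != 0 -> mdist z0 z <= r) ->
  (\int[nu n]_z (f z)%:E @[n --> \oo] -->
   \int[image_measure mu (isometry_borel real)]_z (f z)%:E)%E.

Let lj n x y : mdist (j n x) (j n y) = (l n)%:num * mdist x y.
Proof. by have [] := real. Qed.

Let ii : isometric i.
Proof. by have [] := real. Qed.

Lemma limit_ball_fin (r : R) : (mu (ball y0 r) < +oo)%E.
Proof.
exact: (weak_limit_ball_fin ii weak (blowup_measure_bounded N1 mmsX cdX cvl real)).
Qed.

Definition tent {T : metricType R} (p x : T) : R := Num.max (1 - mdist p x) 0.

Lemma tent_ge0 (T : metricType R) (p x : T) : 0 <= tent p x.
Proof. by rewrite le_max lexx orbT. Qed.

Lemma tent_le1 (T : metricType R) (p x : T) : tent p x <= 1.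
Proof. by rewrite ge_max ler01 andbT gerBl mdist_ge0. Qed.

Lemma tent_continuous (T : metricType R) (p : T) : continuous (tent p).
Proof.
move=> x; apply: (@continuous_max R T (fun x => 1 - mdist p x) (fun=> 0)).
  by apply: continuousB; [exact: cvg_cst|exact: mdist_continuous].
exact: cvg_cst.
Qed.

Lemma measurable_tent (p : Z) : measurable_fun setT (fun z : borel Z => (tent p z)%:E).
Proof.
by apply/measurable_EFinP; apply: continuous_borel_real; exact: tent_continuous.
Qed.

(** Tents are 1-Lipschitz in their centre, and for centres at distance less than 1 both vanish
    outside [ball q 2]. *)
Lemma tent_lip (p q z : Z) (d : R) : mdist p q < d -> d <= 1 ->
  tent p z <= tent q z + d * \1_(ball q 2) z.
Proof.
move=> pqd d1; have d0 : 0 < d by apply: le_lt_trans pqd; exact: mdist_ge0.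
have h1 := metric_triangle q p z; have h2 := metric_triangle p q z.
rewrite (metric_sym q p) in h1.
rewrite indicE; case: (boolP (z \in (ball q 2 : set Z))) => [_|]; rewrite ?mulr1 ?mulr0 ?addr0.
  rewrite {1}/tent ge_max; apply/andP; split; last first.
    by rewrite addr_ge0 ?tent_ge0// ltW.
  by rewrite /tent -lerBlDr le_max; apply/orP; left; lra.
rewrite notin_setE ballEmdist/= => /negP; rewrite -leNgt => qz.
by rewrite {1}/tent max_r ?tent_ge0//; lra.
Qed.

Lemma blowup_tent : \forall n \near \oo, (\int[nu n]_z (tent (j n P) z)%:E = 1)%E.
Proof.
have [r r0 mr] := mms_small_ball mmsX P.
apply: filterS (near_l cvl r^-1) => n rl.
have rl' : (l n)%:num^-1 <= r.
  by rewrite -(invrK r) lef_pV2//; rewrite posrE ?invr_gt0.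
have mfin : (m (ball P (l n)%:num^-1) < +oo)%E.
  by apply: le_lt_trans mr; exact: le_ball_measure.
have [_ _ <-] := normalization_tent mmsX mfin.
rewrite [RHS]integral_mkcond.
rewrite -(@eq_ge0_integral _ _ _ _ _ (normalized_measure m P (l n)) (nu n)
  (j n : borel X -> borel Z) (fun z => (tent (j n P) z)%:E) (blowup_measurable (lj n)))//.
- apply: eq_integral => x _; rewrite /patch /tent lj.
  case: (boolP (x \in (ball P (l n)%:num^-1 : set X))) => [/set_mem|].
    rewrite ballEmdist/= => h.
    by rewrite max_l// subr_ge0 mulrC -ler_pdivlMr// mul1r ltW.
  rewrite notin_setE ballEmdist/= => /negP; rewrite -leNgt => h.
  by rewrite max_r// subr_le0 mulrC -ler_pdivrMr// mul1r.
- exact: measurable_tent.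
- by move=> z; rewrite lee_fin tent_ge0.
Qed.

(** The blow-ups are normalized by a tent whose centre [j n P] moves with n, while weak convergence
    needs a fixed test function. Recentring at [i y0] costs the distance of the centres times the
    mass of [ball (i y0) 3], which contains the balls of radius 2 about both centres. *)
Lemma normalization_limit : (\int[mu]_y (tent y0 y)%:E = 1)%E.
Proof.
have -> : (\int[mu]_y (tent y0 y)%:E)%E =
    (\int[image_measure mu (isometry_borel real)]_z (tent (i y0) z)%:E)%E.
  rewrite -(@eq_ge0_integral _ _ _ _ _ mu (image_measure mu (isometry_borel real))
    (i : borel Y -> borel Z) (fun z => (tent (i y0) z)%:E) (isometry_borel real))//.
  - by apply: eq_integral => y _; rewrite /tent ii.
  - exact: measurable_tent.
  - by move=> z; rewrite lee_fin tent_ge0.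
have cf : (\int[nu n]_z (tent (i y0) z)%:E @[n --> \oo] -->
   \int[image_measure mu (isometry_borel real)]_z (tent (i y0) z)%:E)%E.
  apply: weak; first exact: tent_continuous.
    by exists 1 => z; rewrite ger0_norm ?tent_ge0 ?tent_le1.
  exists (i y0), 1 => z; rewrite /tent leNgt; apply: contra_neqN => h.
  by rewrite max_r// subr_le0 ltW.
suff c1 : (\int[nu n]_z (tent (i y0) z)%:E @[n --> \oo] --> 1%:E)%E.
  by apply: (cvg_unique _ cf c1).
apply: cvg_ereal_approx => e e0.
have [C0 HC0] := blowup_measure_bounded N1 mmsX cdX cvl real 3.
pose C := `|C0| + 1; have Cgt0 : 0 < C by rewrite ltr_wpDl.
have d0 : 0 < Num.min (e / C) 1 by rewrite lt_min ltr01 andbT divr_gt0.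
apply: filterS3 (near_base real d0) blowup_tent HC0 => n h1 h2 h3.
set d := Num.min (e / C) 1 in d0 h1.
have d1 : d <= 1 by rewrite ge_min lexx orbT.
have dC : d * C <= e by rewrite -ler_pdivlMr// ge_min lexx.
have H p q : mdist (i y0) q < 1 -> mdist p q < d ->
    (\int[nu n]_z (tent p z)%:E <= \int[nu n]_z (tent q z)%:E + e%:E)%E.
  move=> yq pq; have mB := ball_borel q 2.
  apply: (@le_trans _ _ (\int[nu n]_z ((tent q z)%:E + d%:E * (\1_(ball q 2) z)%:E))%E).
    apply: ge0_le_integral => //.
    - by move=> z _; rewrite lee_fin tent_ge0.
    - exact: measurable_tent.
    - apply: emeasurable_funD; first exact: measurable_tent.
      by apply: measurable_funeM; apply/measurable_EFinP; exact: measurable_indic.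
    - by move=> z _; rewrite -EFinM -EFinD lee_fin tent_lip.
  rewrite ge0_integralD//; last 4 first.
  - by move=> z _; rewrite lee_fin tent_ge0.
  - exact: measurable_tent.
  - by move=> z _; rewrite mule_ge0// lee_fin ltW.
  - by apply: measurable_funeM; apply/measurable_EFinP; exact: measurable_indic.
  rewrite ge0_integralZl//; last 2 first.
  - by apply/measurable_EFinP; exact: measurable_indic.
  - by rewrite lee_fin ltW.
  rewrite integral_indic// setIT leeD2l//.
  apply: (@le_trans _ _ (d%:E * C%:E)%E); last by rewrite -EFinM lee_fin.
  rewrite lee_pmul2l//.
  apply: (@le_trans _ _ (nu n (ball (i y0) 3))).
    apply: le_measure; rewrite ?inE//; first exact: ball_borel.
    move=> z; rewrite !ballEmdist/= => qz.
    by apply: le_lt_trans (metric_triangle _ q _) _; lra.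
  apply: le_trans h3 _; rewrite lee_fin /C.
  by apply: le_trans (ler_norm _) _; rewrite lerDl.
rewrite EFinB EFinD; split.
  rewrite leeBlDr// -[leLHS]h2; apply: H; last by rewrite metric_sym.
  by rewrite mdistxx.
rewrite -[X in (_ <= X + _)%E]h2; apply: H => //.
exact: lt_le_trans h1 d1.
Qed.

End blowup_limits.

(** * Affine maps and translations of Euclidean space *)

Section euclidean_geometry.
Context {R : realType} {k : nat}.
Local Notation E := (euclid R k).
Implicit Types x y b w v : E.

Definition origin : E := (0 : 'rV[R]_k).

Definition affine_map (t : R) v x : E := (1 - t) *: (x : 'rV[R]_k) + v.

Definition translate v x : E := (x : 'rV[R]_k) + v.

Lemma sqr_mdist x y : mdist x y ^+ 2 = \sum_(i < k) (x ord0 i - y ord0 i) ^+ 2.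
Proof. by rewrite sqr_sqrtr// sumr_ge0// => i _; exact: sqr_ge0. Qed.

(** Stewart's identity. It quantifies the uniqueness of intermediate points in R^k: almost correct
    distances to [x] and [b] force [w] close to the affine point. *)
Lemma sqr_mdist_affine (t : R) x b w :
  mdist w (affine_map t (t *: (b : 'rV[R]_k)) x) ^+ 2 =
  (1 - t) * mdist w x ^+ 2 + t * mdist w b ^+ 2 - t * (1 - t) * mdist x b ^+ 2.
Proof.
rewrite !sqr_mdist !mulr_sumr -big_split -sumrB/=.
by apply: eq_bigr => a _; rewrite !mxE; ring.
Qed.

Lemma mdist_translate v x y : mdist (translate v x) (translate v y) = mdist x y.
Proof.
by congr Num.sqrt; apply: eq_bigr => a _; rewrite !mxE; congr (_ ^+ 2); ring.
Qed.

Lemma mdist_affine (t : R) v x y :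
  mdist (affine_map t v x) (affine_map t v y) = `|1 - t| * mdist x y.
Proof.
rewrite -[RHS]ger0_norm ?mulr_ge0 ?mdist_ge0//.
rewrite -sqrtr_sqr exprMn real_normK ?num_real// sqr_mdist mulr_sumr.
by congr Num.sqrt; apply: eq_bigr => a _; rewrite !mxE; ring.
Qed.

Lemma mdist_affine_translate (t : R) v x : 0 <= t ->
  mdist (affine_map t v x) (translate v x) = t * mdist origin x.
Proof.
move=> t0; rewrite -[RHS]ger0_norm ?mulr_ge0 ?mdist_ge0//.
rewrite -sqrtr_sqr exprMn sqr_mdist mulr_sumr; congr Num.sqrt.
by apply: eq_bigr => a _; rewrite !mxE; ring.
Qed.

Lemma translateVK v : cancel (translate (- (v : 'rV[R]_k))) (translate v).
Proof. by move=> x; rewrite /translate subrK. Qed.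

Lemma translate_continuous v : continuous (translate v).
Proof.
apply: (@isometric_continuous R E E); exact: mdist_translate.
Qed.

Lemma measurable_translate v :
  measurable_fun setT (translate v : borel E -> borel E).
Proof.
apply: (@blowup_measurable _ _ _ 1) => y y'.
by rewrite mdist_translate mul1r.
Qed.

End euclidean_geometry.

Lemma compact_sub_ball (R : realType) (Y : completeMetricType R) (C : set Y) (y0 : Y) :
  compact C -> exists2 r : R, 0 < r & C `<=` ball y0 r.
Proof.
move=> cC.
have : compact (mdist y0 @` C : set R).
  by apply: continuous_compact cC; apply: continuous_subspaceT; exact: mdist_continuous.
move=> /compact_bounded[M [_ MC]].
have M0 : 0 < `|M| + 1 by rewrite ltr_wpDl.
exists (`|M| + 1 + 1); first by lra.
move=> y Cy; rewrite ballEmdist/=.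
have := MC (`|M| + 1); have := ler_norm M => h /(_ ltac:(lra)) /(_ _ (imageP (mdist y0) Cy)).
by rewrite /= ger0_norm ?mdist_ge0//; lra.
Qed.

(** * Blow-up limits on Euclidean space are translation invariant *)

Section euclidean_limits.
Context {R : realType} {k : nat} {X Z : completeMetricType R}.
Local Notation E := (euclid R k).
Variables (m : {measure set (borel X) -> \bar R}) (K N : R).
Hypotheses (N1 : 1 <= N) (mmsX : is_mms m) (cdX : CDe m K N).
Variables (P : X) (y0 : E) (l : nat -> {posnum R}) (j : nat -> X -> Z) (i : E -> Z).
Hypotheses (cvl : (l n)%:num @[n --> \oo] --> +oo)
  (real : GH_realization P y0 l j i).
Variable mu : {measure set (borel E) -> \bar R}.
Local Notation nu := (blowup_measure m real).
Hypothesis weak : forall f : Z -> R, continuous f ->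
  (exists M : R, forall z, `|f z| <= M) ->
  (exists (z0 : Z) (r : R), forall z, f z != 0 -> mdist z0 z <= r) ->
  (\int[nu n]_z (f z)%:E @[n --> \oo] -->
   \int[image_measure mu (isometry_borel real)]_z (f z)%:E)%E.

Let lj n x y : mdist (j n x) (j n y) = (l n)%:num * mdist x y.
Proof. by have [] := real. Qed.

Let ii : isometric i.
Proof. by have [] := real. Qed.

Let mu_fin r : (mu (ball y0 r) < +oo)%E.
Proof. exact: (limit_ball_fin N1 mmsX cdX cvl weak). Qed.

(* A point at almost t D from x and (1 - t) D from b, where D = |x - b|, is
   close to (1 - t) x + t b by the parallelogram identity. *)
Lemma near_affine_point (C : set E) (r t e eta : R) (b : E) (A : set X) (n : nat) (y : X) :
  C `<=` ball y0 r -> 0 < t < 1 -> 0 < e -> 4 * e <= eta ->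
  e * (5 * (r + mdist y0 b) + 25 * e) <= (eta / 4) ^+ 2 ->
  j n @` A `<=` neighborhood e (i @` C) -> mdist (j n y) (i b) < e ->
  (forall x, mdist (i y0) (j n x) < r + (r + mdist y0 b) + 4 * e ->
    exists2 w, mdist y0 w < r + (r + mdist y0 b) + 4 * e + 1 + e &
      mdist (i w) (j n x) < e) ->
  near_intermediate t (e / (l n)%:num) A [set y] `<=`
    j n @^-1` neighborhood (eta / 2) (i @` (affine_map t (t *: (b : 'rV[R]_k)) @` C)).
Proof.
move=> Cr /andP[t0 t1] e0 e_eta e_sq AC yb H z [x [_ [Ax -> xz zy]]].
have ln0 : 0 < (l n)%:num by [].
have {}xz : mdist (j n x) (j n z) < t * mdist (j n x) (j n y) + e.
  by move: xz; rewrite !lj -(ltr_pM2l ln0) mulrDr mulrCA [X in _ + X]mulrC divfK ?gt_eqF.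
have {}zy : mdist (j n z) (j n y) < (1 - t) * mdist (j n x) (j n y) + e.
  by move: zy; rewrite !lj -(ltr_pM2l ln0) mulrDr mulrCA [X in _ + X]mulrC divfK ?gt_eqF.
have [_ [c Cc <-] cx] := AC _ (imageP (j n) Ax).
have y0c : mdist y0 c < r by have := Cr c Cc; rewrite ballEmdist.
set L := mdist c b.
have L0 : 0 <= L by exact: mdist_ge0.
have Lr : L <= r + mdist y0 b.
  by have := metric_triangle c y0 b; rewrite (metric_sym c y0) -/L; lra.
have xy : mdist (j n x) (j n y) <= L + 2 * e.
  have := metric_triangle (j n x) (i c) (j n y); have := metric_triangle (i c) (i b) (j n y).
  by rewrite ii (metric_sym (j n x) (i c)) (metric_sym (i b) (j n y)) -/L; lra.
have txy : t * mdist (j n x) (j n y) <= t * L + 2 * e.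
  by apply: le_trans (ler_wpM2l (ltW t0) xy) _; rewrite mulrDr lerD2l; nra.
have txy' : (1 - t) * mdist (j n x) (j n y) <= (1 - t) * L + 2 * e.
  apply: le_trans (ler_wpM2l _ xy) _; first by lra.
  by rewrite mulrDr lerD2l; nra.
have tL : t * L <= L by nra.
have [|w _ wz] := H z.
  have := metric_triangle (i y0) (i c) (j n z).
  have := metric_triangle (i c) (j n x) (j n z).
  by rewrite ii; lra.
(* Five errors: one from [w] to z, one for the slack, two for replacing the distance of x and y by
   [L], one from x to [c]. *)
have cw : mdist w c <= t * L + 5 * e.
  have := metric_triangle (i w) (j n z) (i c).
  have := metric_triangle (j n z) (j n x) (i c).
  by rewrite ii (metric_sym (j n z) (j n x)) (metric_sym (j n x) (i c)); lra.
have wb : mdist w b <= (1 - t) * L + 5 * e.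
  have := metric_triangle (i w) (j n z) (i b).
  have := metric_triangle (j n z) (j n y) (i b).
  by rewrite ii; lra.
set w0 := affine_map t (t *: (b : 'rV[R]_k)) c.
have ww0 : mdist w w0 <= eta / 4.
  rewrite -(@ler_sqr R) ?nnegrE ?mdist_ge0//; last by lra.
  apply: le_trans e_sq; rewrite sqr_mdist_affine -/L.
  have cw2 : mdist w c ^+ 2 <= (t * L + 5 * e) ^+ 2.
    by rewrite ler_sqr ?nnegrE ?mdist_ge0//; nra.
  have wb2 : mdist w b ^+ 2 <= ((1 - t) * L + 5 * e) ^+ 2.
    by rewrite ler_sqr ?nnegrE ?mdist_ge0//; nra.
  have h1 := ler_wpM2l (ltW t0) wb2.
  have t10 : 0 <= 1 - t by lra.
  have h2 := ler_wpM2l t10 cw2.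
  (* In Stewart's identity the terms in L^2 cancel; 4 t (1 - t) <= 1 reduces the rest to the
     hypothesis on [e]. *)
  apply: (@le_trans _ _ (20 * (t * (1 - t)) * (e * L) + 25 * e ^+ 2)).
    have -> : 20 * (t * (1 - t)) * (e * L) + 25 * e ^+ 2 =
      (1 - t) * (t * L + 5 * e) ^+ 2 + t * ((1 - t) * L + 5 * e) ^+ 2 -
      t * (1 - t) * L ^+ 2 by ring.
    by lra.
  have tt : 4 * (t * (1 - t)) <= 1.
    have : 0 <= (2 * t - 1) ^+ 2 by exact: sqr_ge0.
    by rewrite sqrrB; lra.
  have eL0 : 0 <= e * L by rewrite mulr_ge0// ltW.
  have h3 := ler_wpM2r eL0 tt.
  have h4 := ler_wpM2l (ltW e0) Lr.
  by lra.
exists (i w0); first by exists w0 => //; exists c.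
apply: le_lt_trans (metric_triangle _ (i w) _) _.
by rewrite ii (metric_sym w0 w); lra.
Qed.

(** The centre of contraction is v / t. It may be arbitrarily far away because the constraint [d0]
    on distances in X reads [l n * d0] after rescaling, which tends to infinity. *)
Lemma limit_contraction (C : set E) (v : E) (t e eta : R) : compact C ->
  0 < t < 1 -> 0 < e < 1 -> 0 < eta ->
  ((((1 - e) * (1 - t)) `^ N)%:E * mu C <=
     mu (neighborhood eta (affine_map t v @` C)))%E.
Proof.
move=> cC t01 e01 eta0.
have mC : measurable (C : set (borel E)) by exact: compact_borel.
have [->|/set0P[c0 Cc0]] := eqVneq C set0; first by rewrite measure0 mule0.
have [r r0 Cr] := compact_sub_ball y0 cC.
case/andP: (t01) => t0 t1; case/andP: (e01) => e0 e1.
pose b : E := t^-1 *: (v : 'rV[R]_k).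
have vE : v = t *: (b : 'rV[R]_k) by rewrite /b scalerA divff ?scale1r// gt_eqF.
set s := ((1 - e) * (1 - t)) `^ N.
have s0 : 0 < s by apply: powR_gt0; rewrite mulr_gt0; lra.
set D := affine_map t v @` C.
have CD0 : mu C \is a fin_num.
  rewrite ge0_fin_numE//; apply: le_lt_trans (mu_fin r).
  by apply: le_measure; rewrite ?inE//; exact: ball_borel.
rewrite leNgt; apply/negP => hlt.
have muN0 : mu (neighborhood eta D) \is a fin_num.
  by rewrite ge0_fin_numE//; apply: lt_trans hlt _; rewrite -(fineK CD0) -EFinM ltry.
(* If the claim failed, [a] would separate the two sides; the weak bounds carry this to a single
   blow-up, where the contraction in X refutes it. *)
have [a Na aC] : exists2 a : R, (mu (neighborhood eta D) < a%:E)%E &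
    (a%:E < s%:E * mu C)%E.
  move: hlt; rewrite -(fineK muN0) -(fineK CD0) -EFinM lte_fin => hlt.
  exists ((fine (mu (neighborhood eta D)) + s * fine (mu C)) / 2); rewrite lte_fin; lra.
set F := r + mdist y0 b.
have F0 : 0 <= F by rewrite addr_ge0 ?mdist_ge0// ltW.
(* These are the conditions of [near_affine_point]; the bound 1 replaces 25 eps by 25 in the
   quadratic one. *)
pose eps := Num.min (Num.min 1 (eta / 4)) ((eta / 4) ^+ 2 / (5 * F + 25)).
have eps0 : 0 < eps.
  by rewrite !lt_min ltr01/= divr_gt0//= divr_gt0// ?exprn_gt0 ?divr_gt0//; lra.
have eps1 : eps <= 1 by rewrite !ge_min lexx.
have eps_eta : 4 * eps <= eta.
  by rewrite -ler_pdivlMl// mulrC !ge_min lexx orbT.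
have eps_sq : eps * (5 * F + 25 * eps) <= (eta / 4) ^+ 2.
  have h : eps <= (eta / 4) ^+ 2 / (5 * F + 25) by rewrite ge_min lexx orbT.
  rewrite ler_pdivlMr in h; last by lra.
  apply: le_trans h; apply: ler_wpM2l; first exact: ltW.
  by rewrite lerD2l; lra.
pose B := neighborhood (eta / 2) (i @` D).
have eta20 : 0 < eta / 2 by rewrite divr_gt0.
have Dr : exists rD, i @` D `<=` ball (i y0) rD.
  exists (mdist y0 (affine_map t v c0) + 2 * r + 1) => _ [_ [c Cc <-] <-].
  rewrite ballEmdist/= ii.
  apply: le_lt_trans (metric_triangle _ (affine_map t v c0) _) _.
  have := mdist_affine t v c0 c.
  have := metric_triangle c0 y0 c; have := Cr _ Cc; have := Cr _ Cc0.
  rewrite !ballEmdist/= (metric_sym c0 y0); have := mdist_ge0 c0 c.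
  by rewrite (@ger0_norm _ (1 - t)); [nra|lra].
have [rD DrD] := Dr.
have BrD : B `<=` ball (i y0) (rD + eta / 2).
  move=> z [d /DrD]; rewrite !ballEmdist/= => yd dz.
  by apply: le_lt_trans (metric_triangle _ d _) _; exact: ltrD.
have B0 : B !=set0.
  exists (i (affine_map t v c0)); exists (i (affine_map t v c0)).
    by exists (affine_map t v c0) => //; exists c0.
  by rewrite mdistxx.
have mB : measurable (B : set (borel Z)) by apply: open_borel; exact: open_neighborhood.
have BN : i @^-1` neighborhood (eta / 2) B `<=` neighborhood eta D.
  move=> y [z [_ [d Dd <-] dz] zy]; exists d => //; rewrite -ii.
  by rewrite (splitr eta); apply: le_lt_trans (metric_triangle _ z _) _; exact: ltrD.
have near_B : \forall n \near \oo, (nu n B < a%:E)%E.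
  apply: (weak_limsup weak B0 mB BrD eta20); apply: le_lt_trans Na.
  apply: le_measure; rewrite ?inE//; last first.
    by apply: open_borel; exact: open_neighborhood.
  have mN : measurable (neighborhood (eta / 2) B : set (borel Z)).
    by apply: open_borel; exact: open_neighborhood.
  by have := isometry_borel real measurableT mN; rewrite setTI.
have near_C : \forall n \near \oo,
    ((a / s)%:E < nu n (neighborhood eps (i @` C)))%E.
  apply: (@weak_liminf _ _ _ _ _ _ _ weak C eps _ (i y0) r) => //.
  - by exists c0.
  - by move=> _ [y /Cr + <-]; rewrite !ballEmdist/= ii.
  - move: aC; rewrite -(fineK CD0) -EFinM !lte_fin => aC.
    by rewrite ltr_pdivrMr// mulrC.
have rb0 : 0 < mdist y0 b + 1 by rewrite ltr_wpDl ?mdist_ge0.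
have rz0 : 0 < r + F + 4 * eps by lra.
have [d0 d00 contr] := measure_contraction N1 mmsX cdX e01.
have [n [[h1 h2] [h3 [h4 h5]]]] := filter_ex (filterI (filterI near_B near_C)
  (filterI (near_approximants real eps0 rb0)
  (filterI (near_limit_points real eps0 rz0) (near_l cvl ((F + 2 * eps) / d0))))).
have [|y _ yb] := h3 b; first by rewrite ltrDl.
pose A := j n @^-1` neighborhood eps (i @` C).
have mA : measurable (A : set (borel X)).
  have mN : measurable (neighborhood eps (i @` C) : set (borel Z)).
    by apply: open_borel; exact: open_neighborhood.
  by have := blowup_measurable (lj n) measurableT mN; rewrite setTI.
have Ay x : A x -> mdist x y <= d0.
  move=> [_ [c Cc <-] cx].
  have ln0 : 0 < (l n)%:num by [].
  rewrite -(ler_pM2l ln0) -lj.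
  have : F + 2 * eps <= (l n)%:num * d0 by rewrite -ler_pdivrMr.
  have := metric_triangle (j n x) (i c) (j n y).
  have := metric_triangle (i c) (i b) (j n y).
  have := metric_triangle c y0 b; have := Cr _ Cc.
  rewrite ballEmdist/= ii (metric_sym (j n x) (i c)) (metric_sym (i b) (j n y)).
  by rewrite (metric_sym c y0) /F; lra.
have d_n0 : 0 < eps / (l n)%:num by rewrite divr_gt0.
have := contr A y t _ mA t01 d_n0 Ay; rewrite -/s => hA.
have IB : near_intermediate t (eps / (l n)%:num) A [set y] `<=` j n @^-1` B.
  rewrite /B /D vE; apply: (near_affine_point Cr t01 eps0 eps_eta eps_sq _ yb h4).
  by move=> _ [x Ax <-].
have mI : measurable (j n @^-1` B : set (borel X)).
  by have := blowup_measurable (lj n) measurableT mB; rewrite setTI.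
have {}hA : (s%:E * m A <= m (j n @^-1` B))%E.
  apply: le_trans hA _; apply: le_measure; rewrite ?inE//.
  by apply: open_borel; exact: open_near_intermediate.
have {}hA : (s%:E * nu n (neighborhood eps (i @` C)) <= nu n B)%E.
  rewrite !blowup_measureE /normalized_measure /mscale/= muleCA.
  by apply: lee_wpmul2l hA; rewrite lee_fin normalization_factor_ge0.
have := le_lt_trans hA h1; apply/negP; rewrite -leNgt.
have sf : (0 < s%:E)%E by rewrite lte_fin.
rewrite -(@divfK _ s _ a) ?gt_eqF// mulrC EFinM.
by apply: lee_wpmul2l; [exact: ltW|exact: ltW].
Qed.


(** For a factor th < 1 and a width eta, a small [t] in [limit_contraction] gives the bound for the
    eta-neighbourhood of the translate. Then eta tends to 0, the translate being compact, and th
    tends to 1. *)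
Lemma limit_translate_compact (C : set E) (v : E) : compact C ->
  (mu C <= mu (translate v @` C))%E.
Proof.
move=> cC; have hausE := @metric_hausdorff R E.
have mC : measurable (C : set (borel E)) by exact: compact_borel.
have [r r0 Cr] := compact_sub_ball origin cC.
have CD0 : mu C \is a fin_num.
  have [r' _ Cr'] := compact_sub_ball y0 cC.
  rewrite ge0_fin_numE//; apply: le_lt_trans (mu_fin r').
  by apply: le_measure; rewrite ?inE//; exact: ball_borel.
have cD : compact (translate v @` C).
  by apply: continuous_compact cC; apply: continuous_subspaceT; exact: translate_continuous.
set D := translate v @` C in cD *.
have step (th eta : R) : 0 < th < 1 -> 0 < eta ->
    (th%:E * mu C <= mu (neighborhood eta D))%E.
  move=> /andP[th0 th1] eta0.
  set x := th `^ N^-1.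
  have N0 : 0 < N by exact: lt_le_trans N1.
  have x0 : 0 < x by exact: powR_gt0.
  have xN : x `^ N = th by rewrite /x -powRrM mulVf ?powRr1// ?ltW// gt_eqF.
  have x1 : x < 1.
    rewrite ltNge; apply/negP => h.
    have := @ge0_ler_powR R N (ltW N0) 1 x; rewrite !nnegrE ler01 (ltW x0) h.
    by move=> /(_ isT isT isT); rewrite powR1 xN leNgt th1.
  (* The contraction error is also set to [t], so the factor is ((1 - t)^2)^N, and (1 - t)^2 >= ((1
     + x) / 2)^2 >= x. The second bound keeps affine image and translate within eta / 2 of each
     other on the ball of radius [r]. *)
  pose t := Num.min ((1 - x) / 2) (eta / (2 * r)).
  have t0 : 0 < t by rewrite lt_min divr_gt0 ?subr_gt0//= divr_gt0 ?mulr_gt0.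
  have tx : t <= (1 - x) / 2 by rewrite ge_min lexx.
  have te : t * r <= eta / 2.
    have : t <= eta / (2 * r) by rewrite ge_min lexx orbT.
    by rewrite ler_pdivlMr ?mulr_gt0//; lra.
  have t01 : 0 < t < 1 by lra.
  have eta20 : 0 < eta / 2 by rewrite divr_gt0.
  apply: le_trans (le_trans (limit_contraction v cC t01 t01 eta20) _).
    apply: lee_wpmul2r => //; rewrite lee_fin -xN.
    apply: ge0_ler_powR; rewrite ?nnegrE ?(ltW N0) ?(ltW x0)//.
      by rewrite mulr_ge0; lra.
    have : ((1 + x) / 2) ^+ 2 <= (1 - t) ^+ 2 by rewrite ler_sqr ?nnegrE; lra.
    have : 0 <= ((1 - x) / 2) ^+ 2 by exact: sqr_ge0.
    by rewrite !expr2; lra.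
  apply: le_measure; rewrite ?inE; try by apply: open_borel; exact: open_neighborhood.
  move=> y [_ [c Cc <-] cy]; exists (translate v c); first by exists c.
  apply: le_lt_trans (metric_triangle _ (affine_map t v c) _) _.
  rewrite metric_sym mdist_affine_translate ?(ltW t0)//.
  have := Cr c Cc; rewrite ballEmdist/= => /ltW/(ler_wpM2l (ltW t0)).
  by lra.
have DD : (mu (neighborhood n.+1%:R^-1 D) @[n --> \oo] --> mu D)%E.
  have ninv_ge0 n : 0 < n.+1%:R^-1 :> R by rewrite invr_gt0.
  have DE : \bigcap_n neighborhood n.+1%:R^-1 D = D.
    apply/seteqP; split => [y Dy|y Dy n _]; last first.
      by exists y => //; rewrite mdistxx.
    apply: (compact_closed hausE cD) => U.
    move=> /(@metricType_numDomainType.nbhs_mdistP R E)[e /= e0 eU].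
    have [n ne] := inv_nat_lt e0.
    have [d Dd dy] := Dy n I; exists d; split => //; apply: eU => /=.
    by rewrite metric_sym; exact: lt_trans ne.
  rewrite -[X in _ --> mu X]DE; apply: nonincreasing_cvg_mu.
  - have [r' _ Dr'] := compact_sub_ball y0 cD.
    apply: le_lt_trans (mu_fin (r' + 1)).
    apply: le_measure; rewrite ?inE; [|exact: ball_borel|].
      by apply: open_borel; exact: open_neighborhood.
    move=> y [d /Dr']; rewrite !ballEmdist/= invr1 => yd dy.
    by apply: le_lt_trans (metric_triangle _ d _) _; exact: ltrD.
  - by move=> n; apply: open_borel; exact: open_neighborhood.
  - by rewrite DE; exact: compact_borel.
  - move=> a b ab; apply/subsetPset => y [d Dd dy]; exists d => //.
    by apply: lt_le_trans dy _; rewrite lef_pV2 ?posrE// ler_nat.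
have {}step (th : R) : 0 < th < 1 -> (th%:E * mu C <= mu D)%E.
  move=> th01; apply: (cvge_to_ge DD); apply: nearW => n.
  by apply: step => //; rewrite invr_gt0.
have c1 : ((1 - n.+2%:R^-1)%:E * mu C @[n --> \oo] --> mu C)%E.
  rewrite -[X in _ --> X]mul1e; apply: cvgeZr => //.
  apply: cvg_EFin; first by near=> n.
  rewrite -[X in _ --> X]subr0; apply: cvgB; first exact: cvg_cst.
  have := @cvg_harmonic R; rewrite -(@cvg_shiftS _ _ _); exact.
apply: (cvge_to_le c1); apply: nearW => n; apply: step.
have n0 : 0 < n.+2%:R^-1 :> R by rewrite invr_gt0.
have n1 : n.+2%:R^-1 < 1 :> R by rewrite invf_lt1// ltr1n.
by rewrite subr_gt0 n1 gtrBl n0.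
Unshelve. all: by end_near. Qed.

(** Inner regularity extends the inequality from compact to Borel sets; applied to the opposite
    vector it becomes an equality. *)
Theorem limit_translation_invariant (v : E) (B : set (borel E)) : radon mu ->
  measurable B -> mu (translate v @^-1` B) = mu B.
Proof.
move=> [_ reg]; suff le_translate w (A : set (borel E)) : measurable A ->
    (mu A <= mu (translate w @^-1` A))%E.
  move=> mB; apply/eqP; rewrite eq_le le_translate// andbT.
  have mB' : measurable (translate v @^-1` B : set (borel E)).
    by have := measurable_translate v measurableT mB; rewrite setTI.
  have := le_translate (- (v : 'rV[R]_k)) _ mB'.
  rewrite -comp_preimage (_ : translate v \o _ = id) ?preimage_id//.
  by apply/funext => x; exact: translateVK.
move=> mA; have mA' : measurable (translate w @^-1` A : set (borel E)).
  by have := measurable_translate w measurableT mA; rewrite setTI.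
rewrite (reg A mA); apply: ge_ereal_sup => _ [C [cC CA] <-].
apply: le_trans (limit_translate_compact (- (w : 'rV[R]_k)) cC) _.
apply: le_measure; rewrite ?inE//.
  apply: compact_borel.
  by apply: continuous_compact cC; apply: continuous_subspaceT; exact: translate_continuous.
by move=> _ [x /CA Ax <-] /=; rewrite translateVK.
Qed.

End euclidean_limits.

(** * Uniqueness of normalized translation-invariant measures *)

Section translation_invariant_measures.
Context {R : realType} {k : nat}.
Local Notation E := (euclid R k).
Hypothesis sE : separable_space E.
Implicit Types mu nu : {measure set (borel E) -> \bar R}.
Local Open Scope ereal_scope.

Let translation_invariant mu := forall (v : E) (B : set (borel E)),
  measurable B -> mu (translate v @^-1` B) = mu B.

Let finite_on_balls mu := forall r : R, mu (ball origin r) < +oo.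

Lemma finite_on_balls_sigma_finite mu : finite_on_balls mu -> sigma_finite setT mu.
Proof.
move=> fin; exists (fun n => ball origin n.+1%:R); last first.
  by move=> n; split; [exact: ball_borel|exact: fin].
apply/seteqP; split => // x _; exists (Num.trunc (mdist origin x)) => //.
by rewrite ballEmdist/= truncnS_gt.
Qed.

Lemma measurable_add_pair : measurable_fun setT
  (fun u : borel E * borel E => translate u.2 u.1 : borel E).
Proof.
refine (@measurability _ _ _ (borel E) setT _ (@open E) erefl _).
move=> _ [U oU <-]; rewrite setTI; apply: (open_prod_borel sE sE).
move=> [x y] /= Uxy; have [r r0 rU] := open_sub_ball oU Uxy.
exists (r / 2)%R; first by rewrite divr_gt0.
move=> [x' y'] /= xx' yy'; apply: rU; rewrite ballEmdist/= (splitr r).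
apply: le_lt_trans (metric_triangle _ (translate y x') _) _.
rewrite mdist_translate; apply: ltrD => //; rewrite /translate.
by have := mdist_translate x' y y'; rewrite /translate ![(_ + (x' : 'rV[R]_k))%R]addrC => ->.
Qed.

Lemma tent_translate (x y : E) : tent origin (translate (- (y : 'rV[R]_k))%R x) = tent y x.
Proof.
rewrite /tent -(mdist_translate y origin) translateVK /translate.
by rewrite /origin add0r.
Qed.

Lemma tent_integral_translate mu : translation_invariant mu ->
  forall x, \int[mu]_y (tent x y)%:E = \int[mu]_y (tent origin y)%:E.
Proof.
move=> inv x.
rewrite -(@eq_ge0_integral _ _ _ _ _ mu mu (translate (- (x : 'rV[R]_k))%R : borel E -> borel E)
  (fun y => (tent origin y)%:E) (measurable_translate _))//.
- by apply: eq_integral => y _; rewrite tent_translate.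
- by move=> B mB; exact: inv.
- exact: measurable_tent.
- by move=> y; rewrite lee_fin tent_ge0.
Qed.

(* Tonelli for the function 1_A(x) f(y - x), where f is even. *)
Theorem translation_invariant_unique mu nu :
  translation_invariant mu -> translation_invariant nu ->
  finite_on_balls mu -> finite_on_balls nu ->
  \int[mu]_y (tent origin y)%:E = 1 -> \int[nu]_y (tent origin y)%:E = 1 ->
  forall A, measurable A -> mu A = nu A.
Proof.
move=> imu inu fmu fnu mu1 nu1 A mA.
pose smu : {sigma_finite_measure set (borel E) -> \bar R} :=
  sigma_finite_pack (finite_on_balls_sigma_finite fmu).
pose snu : {sigma_finite_measure set (borel E) -> \bar R} :=
  sigma_finite_pack (finite_on_balls_sigma_finite fnu).
have mf : measurable_fun setT (fun y : borel E => (tent origin y)%:E).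
  exact: measurable_tent.
have mI : measurable_fun setT (\1_A : borel E -> R) by exact: measurable_indic.
pose F (u : borel E * borel E) := (\1_A u.1)%:E * (tent u.1 u.2)%:E.
have mF : measurable_fun setT F.
  apply: emeasurable_funM.
    apply/measurable_EFinP.
    exact: (measurableT_comp mI measurable_fst).
  apply/measurable_EFinP; apply: measurable_maxr => //.
  by apply: measurable_funB => //; exact: measurable_mdist.
have F0 u : 0 <= F u by rewrite mule_ge0// lee_fin tent_ge0.
pose G (u : borel E * borel E) := (\1_A (translate u.2 u.1))%:E * (tent origin u.1)%:E.
have mG : measurable_fun setT G.
  apply: emeasurable_funM.
    apply/measurable_EFinP.
    exact: (measurableT_comp mI measurable_add_pair).
  exact: (measurableT_comp mf measurable_fst).
have G0 u : 0 <= G u by rewrite mule_ge0// lee_fin tent_ge0.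
(* By invariance of [nu] the integral of the tent centred at [x] does not depend on [x], so it
   equals 1. *)
transitivity (\int[smu]_x \int[snu]_y F (x, y)).
  transitivity (\int[mu]_x (\1_A x)%:E); first by rewrite integral_indic// setIT.
  apply: eq_integral => x _; rewrite /F/= ge0_integralZl//.
  - by rewrite tent_integral_translate// nu1 mule1.
  - by apply: measurable_tent.
  - by move=> y _; rewrite lee_fin tent_ge0.
rewrite fubini_tonelli//.
(* Invariance of [mu] allows x + y in place of x in the inner integral; the tent depends only on the
   distance, so F (x + y, y) = G (x, y). *)
transitivity (\int[snu]_y \int[smu]_x G (x, y)).
  apply: eq_integral => y _.
  rewrite -(@eq_ge0_integral _ _ _ _ _ mu mu (translate y : borel E -> borel E)
    (fun x => F (x, y)) (measurable_translate _))//.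
  - apply: eq_integral => x _; rewrite /F/G/=; congr (_ * (_)%:E).
    rewrite -[in LHS](tent_translate) /tent; congr (Num.max (1 - _) 0)%R.
    rewrite -(mdist_translate (x : 'rV[R]_k)) /translate.
    by rewrite /origin add0r opprD addrCA subrr addr0 addNr metric_sym.
  - by move=> B mB; exact: imu.
  - by apply: (measurableT_comp mF); exact: measurable_pair2.
transitivity (\int[smu]_x \int[snu]_y G (x, y)); first by rewrite (fubini_tonelli G).
(* For fixed x, the indicator in [G] is that of a translate of [A], of [nu]-mass [nu A]. *)
transitivity (\int[mu]_x (nu A * (tent origin x)%:E)).
  apply: eq_integral => x _; rewrite /G/=.
  have mt : measurable (translate x @^-1` A : set (borel E)).
    by have := measurable_translate x measurableT mA; rewrite setTI.
  rewrite -(inu x A mA).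
  transitivity (\int[nu]_y ((\1_(translate x @^-1` A) y)%:E * (tent origin x)%:E)).
    by apply: eq_integral => y _; rewrite /translate addrC.
  rewrite ge0_integralZr//; first by rewrite integral_indic// setIT.
  - by apply/measurable_EFinP; exact: measurable_indic.
  - by rewrite lee_fin tent_ge0.
rewrite ge0_integralZl//; first by rewrite mu1 mule1.
by move=> y _; rewrite lee_fin tent_ge0.
Qed.

End translation_invariant_measures.

(** [pmGH_cvg] for blow-ups with its embeddings made explicit and their source kept equal to X, so
    that they can be composed with isometries of X without changes of type. *)
Definition blowup_limit {R : realType} {X Y Z : completeMetricType R}
    (m : {measure set (borel X) -> \bar R}) (P : X) (y0 : Y)
    (l : nat -> {posnum R}) (j : nat -> X -> Z) (i : Y -> Z)
    (mu : {measure set (borel Y) -> \bar R}) : Prop :=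
  [/\ (l n)%:num @[n --> \oo] --> +oo, GH_realization P y0 l j i &
    forall f : Z -> R, continuous f -> (exists M : R, forall z, `|f z| <= M) ->
      (exists (z0 : Z) (r : R), forall z, f z != 0 -> mdist z0 z <= r) ->
      (\int[pushforward (normalized_measure m P (l n)) (j n : borel X -> borel Z)]_z
          (f z)%:E @[n --> \oo] -->
       \int[pushforward mu (i : borel Y -> borel Z)]_z (f z)%:E)%E].

(** * Transport of tangent spaces by an isometry *)

Section tangent_cones.
Context {R : realType} {X : completeMetricType R}.
Variable m : {measure set (borel X) -> \bar R}.

Lemma ball_rescale (l : {posnum R}) (P : X) (r : R) :
  (ball (P : rescale l X) r : set X) = ball P (r / l%:num).
Proof.
by apply/seteqP; split => x; rewrite !ballEmdist/= ltr_pdivlMr// [_ * l%:num]mulrC.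
Qed.

Lemma TanP (P : X) (Y : pmms R) : Tan m P Y <->
  is_mms (pmms_measure Y) /\ exists (Z : completeMetricType R)
    (l : nat -> {posnum R}) (j : nat -> X -> Z) (i : Y -> Z),
    separable_space Z /\ blowup_limit m P (pmms_point Y) l j i (pmms_measure Y).
Proof.
split=> -[mmsY].
  move=> [l [cvl [Z [j [i [sZ [lj ii] gh weak]]]]]]; split => //.
  exists Z, l, (fun n (x : X) => j n x), i; split => //; split => //.
  split => // e r e0 r0.
  by have := gh e r e0 r0; apply: filterS => n; rewrite -!ball_rescale.
move=> [Z [l [j [i [sZ [cvl [lj ii gh] weak]]]]]]; split => //.
exists l; split => //; exists Z, (fun n (x : rescale (l n) X) => j n x), i.
split => //.
move=> e r e0 r0; have := gh e r e0 r0.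
by apply: filterS => n; rewrite -!ball_rescale.
Qed.

Lemma GH_realization_isometry (Y Z : completeMetricType R) (g h : X -> X) (P : X)
    (y0 : Y) (l : nat -> {posnum R}) (j : nat -> X -> Z) (i : Y -> Z) :
  isometric g -> cancel g h -> cancel h g -> GH_realization P y0 l j i ->
  GH_realization (g P) y0 l (fun n => j n \o h) i.
Proof.
move=> gi gK hK [lj ii gh].
have hi : isometric h by move=> x y; rewrite -gi !hK.
have E n r : (j n \o h) @` ball (g P) r = j n @` ball P r.
  apply/seteqP; split => _ [x Px <-] /=.
    by exists (h x) => //; move: Px; rewrite !ballEmdist/= -(hi (g P)) gK.
  by exists (g x); [move: Px; rewrite !ballEmdist/= gi|rewrite /= gK].
split => // [n x y|e r e0 r0]; first by rewrite /= lj hi.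
by have := gh e r e0 r0; apply: filterS => n; rewrite !E.
Qed.

Lemma blowup_limit_isometry (Y Y' Z : completeMetricType R) (P : X) (y0 : Y)
    (l : nat -> {posnum R}) (j : nat -> X -> Z) (i : Y -> Z)
    (mu : {measure set (borel Y) -> \bar R}) (T : Y -> Y') (S : Y' -> Y)
    (mT : measurable_fun setT (T : borel Y -> borel Y')) :
  isometric T -> cancel T S -> cancel S T -> blowup_limit m P y0 l j i mu ->
  blowup_limit m P (T y0) l j (i \o S) (image_measure mu mT).
Proof.
move=> Ti TK SK [cvl [lj ii gh] weak].
have Si : isometric S by move=> x y; rewrite -Ti !SK.
have E r : (i \o S) @` ball (T y0) r = i @` ball y0 r.
  apply/seteqP; split => _ [x Px <-] /=.
    by exists (S x) => //; move: Px; rewrite !ballEmdist/= -(Si (T y0)) TK.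
  by exists (T x); [move: Px; rewrite !ballEmdist/= Ti|rewrite /= TK].
split => //.
  split => // [x y|e r e0 r0]; first by rewrite /= ii Si.
  by have := gh e r e0 r0; apply: filterS => n; rewrite !E.
have -> : pushforward (image_measure mu mT) (i \o S : borel Y' -> borel Z) =
    pushforward mu (i : borel Y -> borel Z) => //.
apply/funext => A; rewrite /pushforward /image_measure; congr (mu _).
by apply/seteqP; split => y /=; rewrite TK.
Qed.

Lemma radon_isometry (Y Y' : completeMetricType R)
    (mu : {measure set (borel Y) -> \bar R}) (T : Y -> Y') (S : Y' -> Y)
    (mT : measurable_fun setT (T : borel Y -> borel Y')) :
  isometric T -> cancel T S -> cancel S T -> radon mu -> radon (image_measure mu mT).
Proof.
move=> Ti TK SK [locfin reg].
have Si : isometric S by move=> x y; rewrite -Ti !SK.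
have Tc := isometric_continuous Ti; have Sc := isometric_continuous Si.
split.
  move=> y'; have [U [oU Uy] Ufin] := locfin (S y').
  exists (S @^-1` U); first by split => //; move/continuousP : Sc; apply.
  rewrite -[ltLHS]/(mu (T @^-1` (S @^-1` U))) -comp_preimage.
  by rewrite (_ : S \o T = id) ?preimage_id//; apply/funext => y; exact: TK.
move=> B mB; have mTB : measurable (T @^-1` B : set (borel Y)).
  by have := mT measurableT _ mB; rewrite setTI.
rewrite -[LHS]/(mu (T @^-1` B)); apply/eqP; rewrite eq_le; apply/andP; split.
  rewrite (reg _ mTB); apply: ge_ereal_sup => _ [C [cC CB] <-].
  apply: ereal_sup_ubound; exists (T @` C).
    split; last by move=> _ [y /CB By <-].
    by apply: continuous_compact cC; exact: continuous_subspaceT.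
  congr (mu _); apply/seteqP; split => y /=; last by move=> Cy; exists y.
  by move=> [x Cx /(can_inj TK) <-].
apply: ge_ereal_sup => _ [C [cC CB] <-]; apply: le_measure; rewrite ?inE//.
have mC : measurable (C : set (borel Y')) by exact: compact_borel.
by have := mT measurableT _ mC; rewrite setTI.
Qed.

Variables K N : R.
Hypotheses (N1 : 1 <= N) (mmsX : is_mms m) (cdX : CDe m K N).

Lemma blowup_limit_exists (Y Z : completeMetricType R) (P : X) (y0 : Y)
    (l : nat -> {posnum R}) (j : nat -> X -> Z) (i : Y -> Z) :
  separable_space Z -> (l n)%:num @[n --> \oo] --> +oo ->
  GH_realization P y0 l j i ->
  exists (l' : nat -> {posnum R}) (j' : nat -> X -> Z)
    (mu : {measure set (borel Y) -> \bar R}),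
    [/\ radon mu, Defs.support mu = setT & blowup_limit m P y0 l' j' i mu].
Proof.
move=> sZ cvl real.
have [phi [mu [phin rmu smu weak]]] := blowup_compactness N1 mmsX cdX cvl real sZ.
exists (l \o phi), (j \o phi), mu; split => //.
have [lj ii gh] := real; split => //.
- apply/cvgryPge => A; move/cvgryPge : cvl => /(_ A); exact: near_subseq.
- split => // [n x y|e r e0 r0]; first exact: lj.
  exact: (near_subseq phin (gh e r e0 r0)).
Qed.

(** Base points, scales and embeddings are unrelated: translation invariance, finiteness on balls
    and the tent normalization already determine the measure. *)
Lemma euclidean_blowup_limit_unique (k : nat) (Z Z' : completeMetricType R) (P P' : X)
    (l l' : nat -> {posnum R}) (j : nat -> X -> Z) (j' : nat -> X -> Z')
    (i : euclid R k -> Z) (i' : euclid R k -> Z')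
    (mu mu' : {measure set (borel (euclid R k)) -> \bar R}) :
  separable_space (euclid R k) -> radon mu -> radon mu' ->
  blowup_limit m P origin l j i mu -> blowup_limit m P' origin l' j' i' mu' ->
  forall A, measurable A -> mu A = mu' A.
Proof.
move=> sE rmu rmu' [cvl real weak] [cvl' real' weak'].
apply: (translation_invariant_unique sE).
- by move=> v B mB; exact: (limit_translation_invariant N1 mmsX cdX cvl (real := real) weak).
- by move=> v B mB; exact: (limit_translation_invariant N1 mmsX cdX cvl' (real := real') weak').
- by move=> r; exact: (limit_ball_fin N1 mmsX cdX cvl (real := real) weak).
- by move=> r; exact: (limit_ball_fin N1 mmsX cdX cvl' (real := real') weak').
- exact: (normalization_limit N1 mmsX cdX cvl (real := real) weak).
- exact: (normalization_limit N1 mmsX cdX cvl' (real := real') weak').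
Qed.

Variables (g h : X -> X) (p : X) (k : nat).
Hypotheses (gi : isometric g) (gK : cancel g h) (hK : cancel h g).
Hypothesis pk : regular_points m k p.

Let muE := pmms_measure (@euclid_pmms R k).

(** The embeddings at [p], precomposed with [h], realize the metric convergence at [g p]; a
    subsequence has a limit measure, equal to normalized Lebesgue measure because the latter is the
    blow-up limit at [p]. *)
Lemma isometry_tangent_euclid : Tan m (g p) (@euclid_pmms R k).
Proof.
have [/TanP[mmsE [Z [l [j [i [sZ lim]]]]]] _] := pk; apply/TanP; split => //.
have [cvl real _] := lim; have [sE _ rE _] := mmsE.
have [l' [j' [mu [rmu _ lim']]]] := blowup_limit_exists sZ cvl
  (GH_realization_isometry gi gK hK real).
have muE' : forall A, measurable A -> mu A = muE A.
  exact: (euclidean_blowup_limit_unique sE rmu rE lim' lim).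
have [cvl' real' weak'] := lim'; exists Z, l', j', i; split; first exact: sZ.
split; [exact: cvl'|exact: real'|move=> f cf bf sf].
have mi := isometry_borel real.
rewrite -[X in _ --> X](_ : (\int[pushforward mu (i : borel (euclid R k) -> borel Z)]_z (f z)%:E = _)%E).
  exact: (weak' f cf bf sf).
apply: (@eq_measure_integral _ _ _ setT (image_measure muE mi) (image_measure mu mi)).
move=> A mA _; apply: muE'.
by have := mi measurableT _ mA; rewrite setTI.
Qed.

(** Moved back to [p], the metric space Y is a tangent for some other measure [mu], and regularity
    of [p] gives an isometry T onto R^k. T pushes the original measure of Y to a blow-up limit at
    [g p] on R^k, and uniqueness shows that T also respects the measures. *)
Lemma isometry_tangent_unique (Y : pmms R) : Tan m (g p) Y ->
  pmms_isomorphic Y (@euclid_pmms R k).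
Proof.
move=> /TanP[mmsY [Z [l [j [i [sZ lim]]]]]].
have [/TanP[mmsE [ZE [lE [jE [iE [_ limE]]]]]] uniqE] := pk.
have [cvl real _] := lim; have [sE _ rE _] := mmsE; have [sY geoY rY _] := mmsY.
have hi : isometric h by move=> x y; rewrite -gi !hK.
have realp := GH_realization_isometry hi hK gK real; rewrite gK in realp.
have [l' [j' [mu [rmu smu lim']]]] := blowup_limit_exists sZ cvl realp.
have /uniqE[T [/= Ti [S TK SK] T0 _]] : Tan m p (@Pmms R Y mu (pmms_point Y)).
  by apply/TanP; split; [split|exists Z, l', j', i].
exists T; split => //; first by exists S.
have mT : measurable_fun setT (T : borel Y -> borel (euclid R k)).
  by apply: (@blowup_measurable _ _ _ 1) => x y; rewrite mul1r; exact: Ti.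
have limT := blowup_limit_isometry mT Ti TK SK lim.
have rT := radon_isometry mT Ti TK SK rY.
rewrite T0 in limT.
exact: (euclidean_blowup_limit_unique sE rT rE limT limE).
Qed.

End tangent_cones.

Theorem proposition5p1 (R : realType) (K N : R)
    (X : completeMetricType R) (m : {measure set (borel X) -> \bar R})
    (k : nat) (g : X -> X) (p : X) :
  1 <= N -> is_mms m -> RCDstar m K N -> (1 <= k)%N -> k%:R <= N ->
  is_isometry g -> regular_points m k p -> regular_points m k (g p).
Proof.
move=> N1 mmsX [cdX _] _ _ [gi [h gK hK]] pk; split.
  exact: (isometry_tangent_euclid N1 mmsX cdX gi gK hK pk).
exact: (isometry_tangent_unique N1 mmsX cdX gi gK hK pk).
Qed.
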